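(* Let $(k_n)_{n\geq 1}$ be an increasing sequence of integers tending to $+\infty$ and let $f$ be a fixed Boolean function (independent of $n$). Then, as $n\to+\infty$, \[\mathbb{P}_n\langle f\rangle \sim \lambda_{\langle f\rangle}\,\mathsf{rat}_n^{R(f)+1},\] where $\lambda_{\langle f\rangle}$ is a positive constant.
   Context: Variables are $x_1,x_2,\dots$; Boolean functions are maps $\{0,1\}^{\mathbb N}\to\{0,1\}$; a literal is $x_i$ or $\bar x_i=1-x_i$. An $\mathsf{and/or}$ tree is a finite binary plane tree with internal nodes labelled $\land$ or $\lor$ and leaves labelled by literals; its size is its number of leaves. Two $\mathsf{and/or}$ trees $A,B$ are equivalent if (1) they have the same underlying plane tree with the same connective labels, (2) two leaves carry the same variable (negated or not) in $A$ iff they do in $B$, and (3) two leaves carry the same literal in $A$ iff they do in $B$. Functions $f,g$ are equivalent iff $g$ is obtained from $f$ by an injective renaming of variables together with negation of some variables; $\langle f\rangle$ is the class of $f$. $T_n$ is the number of equivalence classes of trees of size $n$ in which at most $k_n$ distinct variables occur; $T_n\langle f\rangle$ is the number of those computing a function in $\langle f\rangle$; $\mathbb{P}_n\langle f\rangle=T_n\langle f\rangle/T_n$. $L(f)$ is the minimal size of a tree computing $f$, $E(f)$ its number of essential variables ($x$ essential iff $f_{|x\leftarrow0}\not\equiv f_{|x\leftarrow1}$), $R(f)=L(f)-E(f)$. With ${n\brace p}$ the Stirling numbers of the second kind, $B_{n,k}=\sum_{p=1}^{k}{n\brace p}2^{-p}$ and $\mathsf{rat}_n = B_{n-1,k_n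}/B_{n,k_n}$.
   Formalization: For the two constant functions L(f) is taken to be 0, so R(f)=0, instead of the literal minimal size 2: with exponent 3 the claim fails, as their probability is of order rat_n. Boolean functions are those depending on finitely many variables, so that L(f) exists. *)

(* Defs.v *)
From mathcomp Require Import all_boot all_order all_algebra.
From mathcomp Require Import finmap.
From mathcomp Require Import all_classical all_reals all_analysis.

Set Implicit Arguments.
Unset Strict Implicit.
Unset Printing Implicit Defensive.
Import Order.TTheory GRing.Theory Num.Theory.
Import numFieldNormedType.Exports.

Local Open Scope classical_set_scope.
Local Open Scope ring_scope.

(** Number of elements of a finite set; the junk value 0 is returned on infinite
    sets, but it is applied below only to finite sets (as far as essential variables are
    concerned, for functions depending on finitely many variables). *)
Definition ncard (T : choiceType) (A : set T) : nat := #|` fset_set A|%fset.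

(** Variables are indexed from 0: [a i] is the value of x_{i+1}. *)
Definition assignment := nat -> bool.
Definition boolfun := assignment -> bool.

(** [(i, b)] is the variable of index [i], negated iff [b = true]. *)
Definition literal : Type := nat * bool.
Definition eval_literal (l : literal) (a : assignment) : bool := a l.1 (+) l.2.

Inductive connective := And | Or.

Inductive tree (L : Type) :=
| Leaf of L
| Node of connective & tree L & tree L.

Definition aotree := tree literal.

Fixpoint leaves L (A : tree L) : seq L :=
  match A with
  | Leaf l => [:: l]
  | Node _ A1 A2 => leaves A1 ++ leaves A2
  end.

Definition tsize L (A : tree L) : nat := size (leaves A).

Fixpoint skeleton L (A : tree L) : tree unit :=
  match A with
  | Leaf _ => Leaf tt
  | Node c A1 A2 => Node c (skeleton A1) (skeleton A2)
  end.

Fixpoint eval (A : aotree) : boolfun := fun a =>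
  match A with
  | Leaf l => eval_literal l a
  | Node And A1 A2 => eval A1 a && eval A2 a
  | Node Or A1 A2 => eval A1 a || eval A2 a
  end.

Definition computes (A : aotree) (f : boolfun) : Prop := eval A =1 f.

(** Number of distinct variables occurring in [A]. *)
Definition nvars (A : aotree) : nat := size (undup (map fst (leaves A))).

(** Leaves are numbered from left to right, starting from 0. *)
Definition leaf_at (A : aotree) (i : nat) : literal := nth (0%N, false) (leaves A) i.

Definition tree_equiv (A B : aotree) : Prop :=
  [/\ skeleton A = skeleton B,
      forall i j, (i < tsize A)%N -> (j < tsize A)%N ->
        (leaf_at A i).1 = (leaf_at A j).1 <-> (leaf_at B i).1 = (leaf_at B j).1
    & forall i j, (i < tsize A)%N -> (j < tsize A)%N ->
        leaf_at A i = leaf_at A j <-> leaf_at B i = leaf_at B j].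

Definition tree_class (A : aotree) : set aotree := [set B | tree_equiv A B].

(** A variable [i] of [f] is renamed into [sigma i], and negated iff [eps i].
    For functions depending on finitely many variables, an injective renaming of
    these variables always extends to an injection [sigma] on all indices. *)
Definition fun_equiv (f g : boolfun) : Prop :=
  exists (sigma : nat -> nat) (eps : nat -> bool),
    injective sigma /\ forall a, g a = f (fun i => a (sigma i) (+) eps i).

Definition tree_classes (k n : nat) : set (set aotree) :=
  [set tree_class A | A in [set A | tsize A = n /\ (nvars A <= k)%N]].

Definition tree_classes_of (f : boolfun) (k n : nat) : set (set aotree) :=
  [set tree_class A | A in
    [set A | [/\ tsize A = n, (nvars A <= k)%N
               & exists2 g, fun_equiv f g & computes A g]]].

Definition T_ (k : nat -> nat) (n : nat) : nat := ncard (tree_classes (k n) n).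

Definition Tof (k : nat -> nat) (f : boolfun) (n : nat) : nat :=
  ncard (tree_classes_of f (k n) n).

Definition prob (R : realType) (k : nat -> nat) (f : boolfun) (n : nat) : R :=
  (Tof k f n)%:R / (T_ k n)%:R.

(** A function on infinitely many variables can be computed by a finite tree only
    if it depends on finitely many of them. *)
Definition finitary (f : boolfun) : Prop :=
  exists m : nat, forall a b : assignment,
    (forall i, (i < m)%N -> a i = b i) -> f a = f b.

Definition is_constant (f : boolfun) : Prop := exists c : bool, forall a, f a = c.

Definition min_tree_size (f : boolfun) (m : nat) : Prop :=
  (exists2 A, computes A f & tsize A = m) /\
  (forall A, computes A f -> (m <= tsize A)%N).

(** Minimal size of a tree computing [f], with the usual convention that both
    constant functions have complexity 0. The convention matters: a constant
    function is computed by trees of size 2 such as [x \/ ~ x], but it is obtained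
    with probability of order [rat], as for a function with [mult f = 0]. *)
Definition complexity (f : boolfun) : nat :=
  if `[< is_constant f >] then 0%N else xget 0%N [set m | min_tree_size f m].

Definition set_var (a : assignment) (i : nat) (b : bool) : assignment :=
  fun j => if j == i then b else a j.

Definition essential (f : boolfun) (i : nat) : Prop :=
  exists a, f (set_var a i false) <> f (set_var a i true).

Definition num_essential (f : boolfun) : nat := ncard [set i | essential f i].

(** [L(f) - E(f)]. The subtraction does not truncate for finitary [f]: a tree
    computing [f] has a leaf for each essential variable of [f]. *)
Definition mult (f : boolfun) : nat := (complexity f - num_essential f)%N.

(** Stirling numbers of the second kind. *)
Definition stirling2 (n p : nat) : nat :=
  #|[set P : {set {set 'I_n}} | finset.partition P [set: 'I_n]%SET & #|P| == p]|.

Definition B_ (R : realType) (n k : nat) : R :=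
  \sum_(1 <= p < k.+1) (stirling2 n p)%:R * 2 ^- p.

Definition rat_ (R : realType) (k : nat -> nat) (n : nat) : R :=
  B_ R n.-1 (k n) / B_ R n (k n).

(* Main.v *)
(** Write [B_ R n k] as a mixture over [j] of the powers [j ^ n]: then [T_n] and [Tof] are
    mixtures, with the same weights, of the numbers of trees labelled by the literals of [j]
    variables, so that a proportion [c / j ^ r] among labelled trees turns into
    [c * B_{n-r,k} / B_{n,k}], and log-concavity of [p! * stirling2 n p] in [p] makes
    consecutive quotients of the [B_] asymptotically equal.

    The leaves of a tree are cut into levels. If the leaves of two consecutive levels carry
    distinct variables seen nowhere above, they can be set so as to fix the values of all the
    subtrees entering the lower levels, hence everything below is irrelevant. Simplifying the
    finite pattern left above gives a tree computing [f] that is too small, unless the pattern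
    has at least [R(f)+1] repetitions. With exactly [R(f)+1] repetitions the computed function
    is determined by the pattern alone, and more repetitions cost a further factor [1 / j].
    Patterns have bounded moments because the equation counting them is subcritical with
    respect to that of tree shapes, so their weights have a limit mean; this is the constant
    [lambda], which is positive since [A /\ (x \/ ~ x \/ C)] computes [f] whenever [A] does. *)

(* No relation between the growth of [k n] and that of [n] is assumed, so no range of numbers of
   variables can be singled out: all estimates must be uniform in the number [j] of available
   variables. They are proved for every [j >= 1], with an error carrying an additional factor
   [K / j]. The weights of the mixture are positive, so such an estimate can be summed termwise, and
   its error becomes a quotient of [B_] shifted by one more index. These weights are a truncation of
   the Poisson law of parameter 1/2, whose factorial moments are the [2^-p] of [B_]; they fit
   because a class of trees with [p] variables has [2^p j^_p] labelled representatives.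

   A cut needs two consecutive levels because giving one level a common value forces only one truth
   value below, fixed by the parity of the level; the other truth value needs the next level too.
   Since each pair of levels that is not fresh uses up a repetition or an essential variable, a
   fresh pair exists within a depth that depends on [f] only.

   The error terms grow polynomially with the size of the pattern, which is why moments of every
   order are bounded and not only the mean. *)
From HB Require Import structures.
Require Import Defs.
From mathcomp Require Import all_boot all_order all_algebra.
From mathcomp Require Import finmap.
From mathcomp Require Import all_classical all_reals all_analysis.
From mathcomp Require Import ring lra zify.
Import Defs.
Import Order.TTheory GRing.Theory Num.Theory.
Import numFieldNormedType.Exports.

Set Implicit Arguments.
Unset Strict Implicit.
Unset Printing Implicit Defensive.

(** * Stirling numbers and the numbers [B_] *)

Section Partitions.

Local Open Scope ring_scope.

(** A map with kernel [P] amounts to an injection of the blocks of [P] into the [j] values; [rep]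
    chooses a point in each block to recover this injection. *)
Lemma card_ffun_kernel n j (P : {set {set 'I_n}}) :
  finset.partition P [set: 'I_n] ->
  #|[set c : {ffun 'I_n -> 'I_j} | preim_partition c [set: 'I_n] == P]|
  = (j ^_ #|P|)%N.
Proof.
move=> Ppart; have [/eqP Pcover Ptriv P0] := and3P Ppart.
have inP x : x \in finset.cover P by rewrite Pcover inE.
pose D := {B : {set 'I_n} | B \in P}.
pose blk x : D := exist (fun B => B \in P) (finset.pblock P x) (finset.pblock_mem (inP x)).
have ex_rep (B : D) : exists x, x \in sval B.
  by apply/finset.set0Pn; apply: contraNneq P0 => <-; apply: (svalP B).
pose rep B := xchoose (ex_rep B).
have blkK B : blk (rep B) = B.
  by apply/val_inj/def_pblock => //; [apply: (svalP B) | apply: (xchooseP (ex_rep B))].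
have cardD : #|{: D}| = #|P| by rewrite card_sig; apply: eq_card => B; rewrite !inE.
rewrite -cardD -[j in RHS]card_ord -card_inj_ffuns.
pose F (h : {ffun D -> 'I_j}) : {ffun 'I_n -> 'I_j} := [ffun x => h (blk x)].
have Finj : injective F.
  move=> h h' /ffunP eqF; apply/ffunP => B.
  by have := eqF (rep B); rewrite !ffunE blkK.
rewrite -(card_imset _ Finj); apply: eq_card => c; rewrite inE.
apply/eqP/imsetP => [kerc | [h /[!inE] /injectiveP hinj ->]].
  have eqc x y : (c x == c y) = (finset.pblock P x == finset.pblock P y).
    rewrite eq_pblock // -kerc /preim_partition pblock_equivalence_partition ?inE //.
    by move=> x1 x2 x3 _ _ _; split=> //= /eqP ->.
  exists [ffun B => c (rep B)].
    rewrite inE; apply/injectiveP => B B'; rewrite !ffunE => /eqP.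
    rewrite eqc => /eqP eqB; rewrite -[B]blkK -[B']blkK; exact: val_inj.
  apply/ffunP => x; rewrite !ffunE; apply/eqP; rewrite eqc.
  by have /(congr1 sval)/= -> := blkK (blk x).
rewrite -[RHS](preim_partition_pblock Ppart); apply: eq_imset => x.
apply/setP => y; rewrite !inE /= !ffunE (inj_eq hinj).
by rewrite -val_eqE.
Qed.

Lemma stirling2_gt n p : (n < p)%N -> stirling2 n p = 0%N.
Proof.
move=> ltnp; apply/eqP; rewrite cards_eq0; apply/eqP/setP => P; rewrite !inE.
apply/negP => /andP[/[dup] Ppart /and3P[_ _ P0] /eqP cardP].
suff : (#|P| <= #|[set: 'I_n]%SET|)%N by rewrite cardP cardsT card_ord leqNgt ltnp.
rewrite (card_partition Ppart) -sum1_card; apply: leq_sum => B BP; rewrite card_gt0.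
by apply: contraNneq P0 => <-.
Qed.

(** Sorts the maps from [n] points to [j] values by their kernel. *)
Lemma sum_stirling2_ffact n j N : (n < N)%N ->
  (\sum_(p < N) stirling2 n p * j ^_ p)%N = (j ^ n)%N.
Proof.
move=> ltnN; rewrite -[j in RHS]card_ord -[n in RHS]card_ord -card_ffun.
rewrite -sum1_card.
rewrite (partition_big (fun c : {ffun 'I_n -> 'I_j} => preim_partition c [set: 'I_n])
  (fun P => finset.partition P [set: 'I_n])) /=; last first.
  move=> c _; exact: preim_partitionP.
transitivity (\sum_(P : {set {set 'I_n}} | finset.partition P [set: 'I_n]) j ^_ #|P|)%N; last first.
  apply: eq_bigr => P Ppart; rewrite -card_ffun_kernel // -sum1_card.
  by apply: eq_bigl => c; rewrite inE.
have cardP_lt (P : {set {set 'I_n}}) : finset.partition P [set: 'I_n] -> (#|P| < N)%N.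
  move=> Ppart; rewrite ltnNge; apply/negP => leNP.
  have : stirling2 n #|P| = 0%N by apply: stirling2_gt; apply: leq_trans leNP.
  move/eqP; rewrite cards_eq0 => /eqP/setP/(_ P); rewrite !inE Ppart eqxx //.
case: N ltnN cardP_lt => // N ltnN cardP_lt.
rewrite (partition_big (fun P : {set {set 'I_n}} => inord #|P| : 'I_N.+1) predT) //=.
apply: eq_bigr => p _.
rewrite /stirling2 -sum1_card big_distrl /=.
apply: eq_big => [P|P]; last by rewrite inE mul1n => /andP[_ /eqP ->].
rewrite inE; case: (boolP (finset.partition P _)) => //= /cardP_lt ltPN.
by rewrite -val_eqE /= inordK.
Qed.

(** The recurrence allows the inductions on [n] below; [stirling2E] identifies it with the count of
    partitions. *)
Fixpoint st2 (n p : nat) : nat :=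
  match n, p with
  | 0, 0 => 1
  | 0, _.+1 => 0
  | _.+1, 0 => 0
  | n'.+1, p'.+1 => (p'.+1 * st2 n' p'.+1 + st2 n' p')%N
  end.

Lemma st2_gt n p : (n < p)%N -> st2 n p = 0%N.
Proof.
elim: n p => [|n IHn] [|p] //= ltnp; rewrite !IHn ?muln0 //.
exact: ltnW.
Qed.

Lemma sum_st2_ffact n j N : (n < N)%N ->
  (\sum_(p < N) st2 n p * j ^_ p)%N = (j ^ n)%N.
Proof.
elim: n N => [|n IHn] [|N] // ltnN.
  by rewrite big_ord_recl big1.
rewrite big_ord_recl /= mul0n add0n expnS -(IHn N) // big_distrr /=.
have -> : (\sum_(i < N) st2 n.+1 (bump 0 i) * j ^_ bump 0 i =
  \sum_(i < N) ((i.+1 * st2 n i.+1) * j ^_ i.+1) + \sum_(i < N) st2 n i * j ^_ i.+1)%N.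
  by rewrite -big_split /=; apply: eq_bigr => i _; rewrite /bump add1n /= mulnDl.
have -> : (\sum_(i < N) ((i.+1 * st2 n i.+1) * j ^_ i.+1) =
   \sum_(i < N) (i * st2 n i) * j ^_ i)%N.
  transitivity (\sum_(i < N.+1) (i * st2 n i) * j ^_ i)%N.
    by rewrite big_ord_recl /= !mul0n add0n.
  by rewrite big_ord_recr /= (@st2_gt n N) ?muln0 ?mul0n ?addn0.
rewrite -big_split /=; apply: eq_bigr => i _.
rewrite ffactnSr mulnCA !mulnA [in RHS]mulnC -[(_ * j ^_ i)%N in LHS]mulnA mulnC mulnA.
have [leij|ltji] := leqP i j; last by rewrite !ffact_small // !muln0.
by rewrite [(st2 n i * _)%N]mulnC -mulnDr subnKC // mulnAC.
Qed.

(** Evaluating at [j = p] kills the terms of index above [p], so the coefficients are recovered one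
    after the other. *)
Lemma ffact_sum_inj (a b : nat -> nat) N :
  (forall j, \sum_(p < N) a p * j ^_ p = \sum_(p < N) b p * j ^_ p)%N ->
  forall p, (p < N)%N -> a p = b p.
Proof.
move=> eqab; elim/ltn_ind => p IHp ltpN.
have split_sum (c : nat -> nat) : (\sum_(q < N) c q * p ^_ q = \sum_(q < p) c q * p ^_ q + c p * p`!)%N.
  rewrite -(big_mkord xpredT (fun q => c q * p ^_ q)%N) (big_cat_nat (n := p.+1)) //=.
  rewrite big_mkord big_ord_recr /= ffactnn [X in (_ + X)%N](_ : _ = 0)%N ?addn0 //.
  rewrite big_nat_cond big1 // => q /andP[/andP[ltpq _] _]; rewrite ffact_small ?muln0 //.
have := eqab p; rewrite !split_sum.
have -> : (\sum_(q < p) a q * p ^_ q = \sum_(q < p) b q * p ^_ q)%N.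
  by apply: eq_bigr => q _; rewrite IHp // (ltn_trans _ ltpN).
by move/addnI/eqP; rewrite eqn_mul2r -leqn0 leqNgt fact_gt0 => /eqP.
Qed.

Lemma stirling2E n p : stirling2 n p = st2 n p.
Proof.
have [lepn|ltnp] := leqP p n; last by rewrite stirling2_gt // st2_gt.
apply: (@ffact_sum_inj (stirling2 n) (st2 n) n.+1) => // j.
by rewrite sum_stirling2_ffact // sum_st2_ffact.
Qed.

(** * The weights of the mixture *)

Definition alt_exp (R : realType) (i : nat) : R :=
  \sum_(l < i.+1) (- 2^-1) ^+ l / l`!%:R.

(** Poisson weights of parameter 1/2 in which exp(-1/2) is replaced by its partial sum of degree
    [k - j]. This makes the factorial moments of order [p <= k] exactly [2^-p] and the others zero:
    a truncated Dobinski formula. *)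
Definition mix_weight (R : realType) (k j : nat) : R :=
  2^-1 ^+ j / j`!%:R * alt_exp R (k - j).

Lemma alt_expS (R : realType) i :
  alt_exp R i.+1 = alt_exp R i + (- 2^-1) ^+ i.+1 / i.+1`!%:R.
Proof. by rewrite /alt_exp big_ord_recr. Qed.

Lemma fact_neq0 (R : realType) n : n`!%:R != 0 :> R.
Proof. by rewrite pnatr_eq0 -lt0n fact_gt0. Qed.

(** Adds up the coefficients of degree at most [n] in exp(X/2) exp(-X/2) = 1; the induction step
    adds the one of degree [n.+1], which is zero by the binomial formula. *)
Lemma exp_alt_exp_conv (R : realType) n :
  \sum_(i < n.+1) 2^-1 ^+ i / i`!%:R * alt_exp R (n - i) = 1.
Proof.
elim: n => [|n IHn]; first by rewrite /alt_exp !big_ord_recl !big_ord0 /= !addr0 !expr0 fact0 divr1 mulr1.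
have -> : \sum_(i < n.+2) 2^-1 ^+ i / i`!%:R * alt_exp R (n.+1 - i) =
   \sum_(i < n.+1) 2^-1 ^+ i / i`!%:R * alt_exp R (n - i) +
   \sum_(i < n.+2) (2^-1 ^+ i / i`!%:R) * ((- 2^-1) ^+ (n.+1 - i) / (n.+1 - i)`!%:R).
  rewrite big_ord_recr [X in _ = _ + X]big_ord_recr /= subnn addrA -big_split /=.
  congr (_ + _); last by rewrite /alt_exp big_ord_recl big_ord0 addr0 /=.
  apply: eq_bigr => i _; rewrite -mulrDr subSn -?alt_expS //.
  by rewrite -ltnS.
rewrite IHn; apply/eqP; rewrite -[X in _ == X]addr0 (inj_eq (addrI _)); apply/eqP.
transitivity ((- 2^-1 + 2^-1) ^+ n.+1 / n.+1`!%:R : R); last first.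
  by rewrite addrC subrr expr0n mul0r.
rewrite exprDn mulr_suml; apply: eq_bigr => i _.
have lein : (i <= n.+1)%N by rewrite -ltnS.
rewrite -(bin_fact lein) !natrM -mulr_natr.
have H1 : ('C(n.+1, i))%:R != 0 :> R by rewrite pnatr_eq0 -lt0n bin_gt0.
have H2 := fact_neq0 R i; have H3 := fact_neq0 R (n.+1 - i).
by field; rewrite H1 H2 H3.
Qed.

Lemma mix_weight_ffact (R : realType) k p :
  \sum_(j < k.+1) mix_weight R k j * (j ^_ p)%:R = if (p <= k)%N then 2^-1 ^+ p else 0.
Proof.
case: leqP => [lepk|ltkp]; last first.
  apply: big1 => j _; rewrite ffact_small ?mulr0 //; apply: leq_trans ltkp; exact: ltn_ord.
rewrite -(big_mkord xpredT (fun j => mix_weight R k j * (j ^_ p)%:R)).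
rewrite (big_cat_nat (n := p)) //=; last by apply: leq_trans lepk _.
rewrite big_nat_cond big1 ?add0r; last first.
  by move=> j /andP[/andP[_ ltjp] _]; rewrite ffact_small ?mulr0.
rewrite -{1}[p]add0n big_addn subSn // big_mkord.
transitivity (2^-1 ^+ p * \sum_(i < (k - p).+1) 2^-1 ^+ i / i`!%:R * alt_exp R (k - p - i)); last first.
  by rewrite exp_alt_exp_conv mulr1.
rewrite mulr_sumr; apply: eq_bigr => i _.
rewrite /mix_weight subnDA subnAC addnC exprD.
have := ffact_fact (leq_addr i p); rewrite addKn => <-; rewrite natrM.
have H1 : ((p + i) ^_ p)%:R != 0 :> R by rewrite pnatr_eq0 -lt0n ffact_gt0 leq_addr.
have H2 := fact_neq0 R i.
by field; rewrite H1 H2.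
Qed.

Lemma alt_exp_bounds (R : realType) i :
  4^-1 <= alt_exp R i <= 2.
Proof.
have E0 : alt_exp R 0 = 1 by rewrite /alt_exp big_ord_recl big_ord0 addr0 expr0 fact0 divr1.
(* The next term of the series is at most half of the margin [2^-(j+2)]; the other half is the new
   margin. *)
suff H j : 4^-1 + 2^-1 ^+ j.+2 <= alt_exp R j.+1 <= 1 - 2^-1 ^+ j.+2.
  case: i => [|i]; first by rewrite E0; lra.
  have := H i; have : 0 < (2^-1 : R) ^+ i.+2 by rewrite exprn_gt0.
  by lra.
elim: j => [|j /andP[IH1 IH2]].
  by rewrite alt_expS E0 factS fact0 muln1 !expr2 expr1; lra.
rewrite alt_expS.
have X0 : 0 < (2^-1 : R) ^+ j.+2 by rewrite exprn_gt0.
have : `|(- 2^-1) ^+ j.+2 / (j.+2)`!%:R| <= (2^-1 : R) ^+ j.+3.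
  rewrite normrM normrX normrN [X in X ^+ _ * _]ger0_norm ?invr_ge0 // [X in _ * X]ger0_norm ?invr_ge0 //.
  rewrite [2^-1 ^+ j.+3]exprSr ler_pM2l //.
  rewrite lef_pV2 ?posrE ?ltr0n ?fact_gt0 // ler_nat.
  by rewrite factS -[2%N]muln1 leq_mul ?fact_gt0.
rewrite ler_norml [(2^-1) ^+ j.+3]exprSr => /andP[H1 H2].
by apply/andP; split; lra.
Qed.

Lemma mix_weight_ge (R : realType) k j :
  2^-1 ^+ j / j`!%:R / 4 <= mix_weight R k j.
Proof.
rewrite /mix_weight ler_wpM2l ?divr_ge0 ?exprn_ge0 //.
by case/andP: (alt_exp_bounds R (k - j)).
Qed.

Lemma mix_weight_gt0 (R : realType) k j : 0 < mix_weight R k j.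
Proof.
apply: lt_le_trans (mix_weight_ge R k j).
by rewrite !divr_gt0 ?exprn_gt0 ?ltr0n ?fact_gt0.
Qed.

Lemma mix_weight_le2 (R : realType) k j : mix_weight R k j <= 2.
Proof.
rewrite /mix_weight -[leRHS]mul1r; apply: ler_pM.
- by rewrite divr_ge0 ?exprn_ge0.
- by case/andP: (alt_exp_bounds R (k - j)) => H _; apply: le_trans H; rewrite invr_ge0.
- rewrite -[leRHS]mulr1; apply: ler_pM; rewrite ?exprn_ge0 ?invr_ge0 ?exprn_ile1 ?invf_le1 ?ler1n //.
  exact: fact_gt0.
- by case/andP: (alt_exp_bounds R (k - j)).
Qed.

Lemma BE (R : realType) n k : (0 < n)%N ->
  B_ R n k = \sum_(p < k.+1) (st2 n p)%:R * 2^-1 ^+ p.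
Proof.
case: n => // n _; rewrite big_ord_recl /= mul0r add0r.
rewrite /B_ big_add1 /= big_mkord; apply: eq_bigr => i _.
by rewrite stirling2E exprVn.
Qed.

Lemma B_mixture (R : realType) n k : (0 < n)%N ->
  B_ R n k = \sum_(j < k.+1) mix_weight R k j * j%:R ^+ n.
Proof.
move=> n_gt0; rewrite BE //.
(* This range covers both the sum over [p <= k] in [B_] and the expansion of [j ^ n] over
   [p <= n]. *)
transitivity (\sum_(p < (n + k).+1) \sum_(j < k.+1)
    (st2 n p)%:R * (mix_weight R k j * (j ^_ p)%:R) : R).
  rewrite (big_ord_widen _ (fun p => (st2 n p)%:R * 2^-1 ^+ p : R) (_ : (k.+1 <= (n + k).+1)%N)).
    rewrite big_mkcond; apply: eq_bigr => p _; rewrite ltnS.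
    by rewrite -mulr_sumr mix_weight_ffact; case: leqP => // _; rewrite mulr0.
  by rewrite ltnS leq_addl.
rewrite exchange_big /=; apply: eq_bigr => j _.
rewrite -natrX -(@sum_st2_ffact n j (n + k).+1) ?ltnS ?leq_addr // natr_sum mulr_sumr.
by apply: eq_bigr => p _; rewrite natrM mulrCA.
Qed.

Lemma B_gt0 (R : realType) n k : (0 < n)%N -> (0 < k)%N -> 0 < B_ R n k.
Proof.
move=> n0 k0; rewrite B_mixture // big_ord_recr /=; apply: ltr_wpDl.
  by apply: sumr_ge0 => j _; rewrite mulr_ge0 ?exprn_ge0 // ltW // mix_weight_gt0.
by rewrite mulr_gt0 ?mix_weight_gt0 // exprn_gt0 // ltr0n.
Qed.

(** The negative terms of the difference have [j < M] and are of order [M ^ n], which the single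
    term [j = 2 * M] outweighs. The bounds on the weights being uniform in [k], so is [N]. This is
    what makes [rat_] tend to 0. *)
Lemma B_ratio_large (R : realType) (M : nat) : exists N : nat, forall n k,
  (N <= n)%N -> (N <= k)%N -> M%:R * B_ R n k <= B_ R n.+1 k.
Proof.
have [->|M_gt0] := posnP M.
  exists 1%N => n k n0 k0; rewrite mul0r ltW // B_gt0 //.
pose c : R := 2^-1 ^+ M.*2 / (M.*2)`!%:R / 4.
have c_gt0 : 0 < c by rewrite !divr_gt0 ?exprn_gt0 ?ltr0n ?fact_gt0.
pose N0 := Num.bound ((2 * M)%:R / c).
have HN0 : (2 * M)%:R <= c * 2 ^+ N0.
  rewrite mulrC -ler_pdivrMr //; apply: le_trans (_ : N0%:R <= _).
    by apply/ltW/archi_boundP; rewrite divr_ge0 // ltW.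
  by rewrite -natrX ler_nat ltnW // ltn_expl.
exists (N0 + M.*2).+1 => n k leNn leNk; rewrite -subr_ge0.
rewrite !B_mixture ?(leq_trans _ leNn) // mulr_sumr -sumrB.
set F := BIG_F.
(* [G] bounds each term from below; among the nonnegative ones it keeps only [j = 2 * M]. *)
pose G (j : nat) : R := (if j == M.*2 then c * M.*2%:R ^+ n * M%:R else 0)
   - (if (j < M)%N then 2 * M%:R ^+ n * M%:R else 0).
apply: (@le_trans _ _ (\sum_(j < k.+1) G j)); last first.
  apply: ler_sum => j _; rewrite /F /G.
  have w0 := mix_weight_gt0 R k j.
  have -> : mix_weight R k j * j%:R ^+ n.+1 - M%:R * (mix_weight R k j * j%:R ^+ n) =
    mix_weight R k j * (j%:R ^+ n * (j%:R - M%:R)) by rewrite exprSr; ring.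
  case: ltnP => [ltjM|leMj].
    have /negPf-> : (j != M.*2 :> nat) by rewrite neq_ltn (leq_trans ltjM) // -addnn leq_addr.
    rewrite sub0r lerNl -mulrN -mulrN opprB -[leRHS]mulrA; apply: ler_pM.
    - by rewrite ltW.
    - by rewrite mulr_ge0 // ?subr_ge0 ?ler_nat ?exprn_ge0 // ltnW.
    - exact: mix_weight_le2.
    - apply: ler_pM; rewrite ?exprn_ge0 ?subr_ge0 ?ler_nat ?(ltnW ltjM) //.
        by rewrite lerXn2r ?nnegrE // ler_nat ltnW.
      by rewrite lerBlDr lerDl.
  rewrite subr0; case: eqP => [->|_]; last first.
    by rewrite mulr_ge0 ?(ltW w0) // mulr_ge0 ?exprn_ge0 ?subr_ge0 ?ler_nat.
  rewrite -[leLHS]mulrA -[in leRHS]natrB -addnn ?leq_addr // addnK.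
  by rewrite ler_wpM2r ?mulr_ge0 ?exprn_ge0 // addnn mix_weight_ge.
rewrite sumrB -!big_mkcond /= subr_ge0.
rewrite -(big_ord_widen _ (fun _ => 2 * M%:R ^+ n * M%:R : R)); last first.
  by move: leNk; rewrite -addnn; lia.
rewrite sumr_const card_ord.
have lt2M : (M.*2 < k.+1)%N by move: leNk; rewrite -addnn; lia.
rewrite (big_pred1 (Ordinal lt2M)) //=.
have -> : M.*2%:R = M%:R * 2 :> R by rewrite -muln2 natrM.
rewrite exprMn -[_ *+ M]mulr_natr.
have -> : c * (M%:R ^+ n * 2 ^+ n) * M%:R = (c * 2 ^+ n) * (M%:R ^+ n * M%:R) by ring.
have -> : 2 * M%:R ^+ n * M%:R * M%:R = (2 * M)%:R * (M%:R ^+ n * M%:R) :> R by rewrite natrM; ring.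
rewrite ler_wpM2r ?mulr_ge0 ?exprn_ge0 //.
apply: (le_trans HN0); rewrite ler_wpM2l ?(ltW c_gt0) // ler_weXn2l ?ler1n //.
by apply: leq_trans leNn; lia.
Qed.

(** * Log-concavity and consecutive quotients of [B_] *)

Definition surj_count (n p : nat) : nat := (p`! * st2 n p)%N.

Lemma surj_countS n p :
  surj_count n.+1 p.+1 = (p.+1 * (surj_count n p.+1 + surj_count n p))%N.
Proof. by rewrite /surj_count /= factS; ring. Qed.

(** Cross products for all [a <= b], rather than for [b = a + 1], tolerate vanishing terms and
    provide the hypotheses [h1] to [h3] that expanding the recurrence calls for. *)
Lemma surj_count_logconcave n a b : (a <= b)%N ->
  (surj_count n a * surj_count n b.+1 <= surj_count n a.+1 * surj_count n b)%N.
Proof.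
elim: n a b => [|n IHn] a b leab; first by rewrite /surj_count /= !muln0.
case: a leab => [|a]; first by rewrite {1}/surj_count /= muln0 mul0n.
case: b => [//|b]; rewrite ltnS => leab; rewrite !surj_countS.
set u := surj_count n.
have h1 : (u a.+1 * u b.+2 <= u a.+2 * u b.+1)%N by apply: IHn.
have h2 : (u a * u b.+1 <= u a.+1 * u b)%N by apply: IHn.
have h3 : (u a * u b.+2 <= u a.+2 * u b)%N.
  move: leab; rewrite leq_eqVlt => /predU1P[<-|ltab]; first by rewrite mulnC.
  apply: (@leq_trans (u a.+1 * u b.+1)); apply: IHn => //; exact: leqW (ltnW _).
have h4 : (a.+1 * b.+2 <= a.+2 * b.+1)%N by lia.
have -> : (a.+1 * (u a.+1 + u a) * (b.+2 * (u b.+2 + u b.+1)) =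
  (a.+1 * b.+2) * (u a.+1 * u b.+2 + u a.+1 * u b.+1 + u a * u b.+2 + u a * u b.+1))%N by ring.
have -> : (a.+2 * (u a.+2 + u a.+1) * (b.+1 * (u b.+1 + u b)) =
  (a.+2 * b.+1) * (u a.+2 * u b.+1 + u a.+1 * u b.+1 + u a.+2 * u b + u a.+1 * u b))%N by ring.
by rewrite leq_mul // !leq_add.
Qed.

(* Symmetrization: twice the difference of the two sides is a sum of products
   [(p - q) * (s p * y q - y p * s q)] of two factors of the same sign. *)
Lemma chebyshev_sum (R : realType) (s y : nat -> R) N :
  (forall p q, (q < p)%N -> (p < N)%N -> y p * s q <= s p * y q) ->
  (\sum_(p < N) p%:R * y p) * (\sum_(p < N) s p) <=
  (\sum_(p < N) p%:R * s p) * (\sum_(p < N) y p).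
Proof.
move=> sy; rewrite -subr_ge0 !mulr_suml.
under eq_bigr do rewrite mulr_sumr.
under [X in _ - X]eq_bigr do rewrite mulr_sumr.
rewrite -sumrB; under eq_bigr do rewrite -sumrB.
set S := \sum_(i < N) _; have : 0 <= S + S; last by lra.
rewrite {2}/S exchange_big /= /S -big_split sumr_ge0 //= => i _.
rewrite -big_split sumr_ge0 //= => j _.
have -> : i%:R * s i * y j - i%:R * y i * s j + (j%:R * s j * y i - j%:R * y j * s i) =
  (i%:R - j%:R) * (s i * y j - y i * s j) by ring.
case: (ltngtP i j) => [ltij|ltji|->].
- by rewrite mulr_le0 // ?subr_le0 ?ler_nat 1?ltnW // mulrC [leRHS]mulrC sy.
- by rewrite mulr_ge0 // ?subr_ge0 ?ler_nat 1?ltnW // sy.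
- by rewrite subrr mul0r.
Qed.

Lemma sum_stirling_step (R : realType) (s s' F : nat -> R) k :
  s' 0%N = 0 -> (forall p, s' p.+1 = p.+1%:R * s p.+1 + 2^-1 * s p) ->
  \sum_(p < k.+1) F p * s' p =
  \sum_(p < k.+1) F p * (p%:R * s p) + 2^-1 * \sum_(p < k) F p.+1 * s p.
Proof.
move=> s'0 s'S; rewrite big_ord_recl s'0 mulr0 add0r.
rewrite [X in _ = X + _]big_ord_recl mul0r mulr0 add0r mulr_sumr -big_split /=.
by apply: eq_bigr => p _; rewrite /bump add1n s'S; ring.
Qed.

(** [M0], [M1], [M2] stand for the moments of the measure [st2 n p / 2 ^ p] cut at [k], [B1] and
    [P1] for mass and first moment at rank [n.+1], [B2] for the mass at rank [n.+2]. [cs] is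
    Cauchy-Schwarz; [lc] says that the second factorial moment is at most that of a Poisson law, so
    the variance does not exceed the mean. *)
Lemma moment_step (R : realType) (M0 M1 M2 B1 P1 B2 : R) :
  0 < M0 -> 0 <= M1 -> M1 <= B1 <= M1 + M0 / 2 -> M2 <= P1 <= M2 + (M1 + M0) / 2 ->
  P1 <= B2 <= P1 + B1 / 2 -> M1 * M1 <= M2 * M0 -> (M2 - M1) * M0 <= M1 * M1 ->
  2 * M0 <= B1 -> B1 * (B1 - 4 * M0) <= B2 * M0 <= B1 * (B1 + 4 * M0).
Proof.
move=> M00 M10 /andP[B1l B1u] /andP[P1l P1u] /andP[B2l B2u] cs lc B1ge.
have H1 : B2 * M0 <= (M2 + (M1 + M0) / 2 + B1 / 2) * M0 by rewrite ler_wpM2r ?(ltW M00) //; lra.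
have H2 : M2 * M0 <= B2 * M0 by rewrite ler_wpM2r ?(ltW M00) //; lra.
have H3 : M1 * M1 <= B1 * B1 by rewrite ler_pM.
have H4 : (B1 - M0 / 2) * (B1 - M0 / 2) <= M1 * M1 by rewrite ler_pM //; lra.
have H5 : M1 * M0 <= B1 * M0 by rewrite ler_wpM2r ?(ltW M00).
have H6 : 2 * M0 * M0 <= B1 * M0 by rewrite ler_wpM2r ?(ltW M00).
have H7 : 0 <= M0 * M0 by rewrite mulr_ge0 ?ltW.
apply/andP; split; lra.
Qed.

(** Divided by the square of [B_ R n.+1 k], the bounds read [1 - 4 q] and [1 + 4 q] with [q] the
    quotient of [B_ R n k] by [B_ R n.+1 k]: two consecutive quotients are equivalent once they tend
    to 0. *)
Lemma B_step (R : realType) n k : (0 < n)%N -> (0 < k)%N ->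
  2 * B_ R n k <= B_ R n.+1 k ->
  B_ R n.+1 k * (B_ R n.+1 k - 4 * B_ R n k) <= B_ R n.+2 k * B_ R n k
    <= B_ R n.+1 k * (B_ R n.+1 k + 4 * B_ R n k).
Proof.
move=> n0 k0; have := B_gt0 R n0 k0; rewrite !BE //.
pose s m p : R := (st2 m p)%:R * 2^-1 ^+ p.
have s_ge0 m p : 0 <= s m p by rewrite mulr_ge0 ?exprn_ge0.
have s0 m : s m.+1 0%N = 0 by rewrite /s mul0r.
have sS m p : s m.+1 p.+1 = p.+1%:R * s m p.+1 + 2^-1 * s m p.
  by rewrite /s /= natrD natrM exprS; ring.
have stepF F m := sum_stirling_step F k (s0 m) (sS m).
rewrite -![\sum_(p < k.+1) _]/(\sum_(p < k.+1) s _ p).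
have le_sum (F : nat -> R) : (forall p, 0 <= F p) -> 0 <= \sum_(p < k) F p <= \sum_(p < k.+1) F p.
  by move=> F0; rewrite big_ord_recr /= lerDl F0 sumr_ge0.
have one m N : \sum_(p < N) s m p = \sum_(p < N) 1 * s m p.
  by apply: eq_bigr => p _; rewrite mul1r.
have B1E : \sum_(p < k.+1) s n.+1 p = \sum_(p < k.+1) p%:R * s n p + 2^-1 * \sum_(p < k) s n p.
  by rewrite one (stepF (fun=> 1)) -one; under eq_bigr do rewrite mul1r.
have B2E : \sum_(p < k.+1) s n.+2 p = \sum_(p < k.+1) p%:R * s n.+1 p + 2^-1 * \sum_(p < k) s n.+1 p.
  by rewrite one (stepF (fun=> 1)) -one; under eq_bigr do rewrite mul1r.
have P1E := stepF (fun p => p%:R) n.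
move=> M0_gt0; set M0 := \sum_(p < k.+1) s n p in M0_gt0 *.
set M1 := \sum_(p < k.+1) p%:R * s n p in B1E *.
set M2 := \sum_(p < k.+1) p%:R * (p%:R * s n p) in P1E *.
set B1 := \sum_(p < k.+1) s n.+1 p in B1E *.
apply: (@moment_step _ M0 M1 M2 B1 (\sum_(p < k.+1) p%:R * s n.+1 p)) => //.
- by apply: sumr_ge0 => p _; rewrite mulr_ge0.
- by rewrite B1E; have := le_sum _ (s_ge0 n); rewrite -/M0 => /andP[? ?]; apply/andP; split; lra.
- rewrite P1E; have /andP[] := le_sum (fun p => p.+1%:R * s n p) (fun p => mulr_ge0 (ler0n _ _) (s_ge0 n p)).
  have -> : \sum_(p < k.+1) p.+1%:R * s n p = M1 + M0.
    by rewrite /M1 /M0 -big_split /=; apply: eq_bigr => p _; rewrite mulrSr mulrDl mul1r.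
  by move=> ? ?; apply/andP; split; lra.
- by rewrite B2E; have := le_sum _ (s_ge0 n.+1); rewrite -/B1 => /andP[? ?]; apply/andP; split; lra.
- apply: (@chebyshev_sum _ (fun p => p%:R * s n p) (s n)) => p q ltqp _.
  have -> : s n p * (q%:R * s n q) = q%:R * (s n p * s n q) by ring.
  by rewrite -mulrA ler_wpM2r ?mulr_ge0 // ler_nat ltnW.
(* By log-concavity of [p! * st2 n p] the ratio [y p / s n p] is nonincreasing, so [chebyshev_sum]
   applies. Cutting [y] at [k] makes its sum exactly [M1]. *)
- pose y p : R := if (p < k)%N then p.+1%:R * s n p.+1 else 0.
  have -> : M2 - M1 = \sum_(p < k.+1) p%:R * y p.
    rewrite big_ord_recr /= {2}/y ltnn mulr0 addr0 /M2 /M1 -sumrB big_ord_recl !mul0r subrr add0r.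
    by apply: eq_bigr => p _; rewrite /y ltn_ord lift0 mulrSr; ring.
  have {2}-> : M1 = \sum_(p < k.+1) y p.
    rewrite big_ord_recr /= {2}/y ltnn addr0 /M1 big_ord_recl !mul0r add0r.
    by apply: eq_bigr => p _; rewrite /y ltn_ord lift0.
  apply: chebyshev_sum => p q ltqp; rewrite ltnS => lepk.
  rewrite /y (leq_trans ltqp lepk); case: ltnP => ltpk; last first.
    by rewrite mul0r !mulr_ge0.
  have := surj_count_logconcave n (ltnW ltqp); rewrite /surj_count !factS.
  have [f1 f2] := (fact_gt0 p, fact_gt0 q).
  have -> : (q`! * st2 n q * (p.+1 * p`! * st2 n p.+1) =
     (p`! * q`!) * (p.+1 * st2 n p.+1 * st2 n q))%N by ring.
  have -> : (q.+1 * q`! * st2 n q.+1 * (p`! * st2 n p) =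
     (p`! * q`!) * (q.+1 * st2 n q.+1 * st2 n p))%N by ring.
  rewrite leq_pmul2l ?muln_gt0 ?f1 ?f2 // -(ler_nat R) !natrM => H.
  have -> : p.+1%:R * s n p.+1 * s n q = (p.+1%:R * (st2 n p.+1)%:R * (st2 n q)%:R) * 2^-1 ^+ (p + q).+1.
    by rewrite /s !exprS exprD; ring.
  have -> : s n p * (q.+1%:R * s n q.+1) = (q.+1%:R * (st2 n q.+1)%:R * (st2 n p)%:R) * 2^-1 ^+ (p + q).+1.
    by rewrite /s !exprS exprD; ring.
  by rewrite ler_wpM2r // exprn_ge0.
Qed.

End Partitions.

(** * Counting tree shapes *)

Section Shapes.

Local Open Scope classical_set_scope.
Local Open Scope ring_scope.

Definition convol (R : realType) (f g : nat -> R) (n : nat) : R :=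
  \sum_(i < n.+1) f i * g (n - i)%N.

(* Number of [and/or] tree shapes: [T = z + 2 T^2] for the generating function. *)
Definition shape_seq (R : realType) (s : nat -> R) : Prop :=
  [/\ s 0%N = 0, s 1%N = 1 & forall n, s n.+2 = 2 * convol s s n.+2].

Lemma convolC (R : realType) (f g : nat -> R) n : convol f g n = convol g f n.
Proof.
rewrite /convol (reindex_inj rev_ord_inj) /=; apply: eq_bigr => i _.
by rewrite mulrC subSS subKn // -ltnS.
Qed.

Lemma shape_seq_ge (R : realType) (s : nat -> R) : shape_seq s -> forall n,
  0 < s n.+1 /\ s n.+1 <= s n.+2.
Proof.
case=> s0 s1 sS.
have step n : (forall m, (m <= n)%N -> 0 <= s m.+1) -> s n.+1 <= s n.+2.
  move=> s_ge0; rewrite sS /convol big_ord_recl s0 mul0r add0r big_ord_recl /= /bump s1 mul1r subSS subn0.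
  set S := (X in 2 * (_ + X)); have : 0 <= S.
    apply: sumr_ge0 => i _; have Hi : (i < n.+1)%N := ltn_ord i.
    rewrite !leq0n /= !add1n !subSS; case E: (n - i)%N => [|m]; first by rewrite s0 mulr0.
    by rewrite mulr_ge0 ?s_ge0 //; lia.
  by have := s_ge0 n (leqnn n); lra.
have s_gt0 n : 0 < s n.+1.
  elim/ltn_ind: n => [[|n] IHn]; first by rewrite s1.
  apply: lt_le_trans (step n _); first exact: IHn.
  by move=> m lemn; rewrite ltW // IHn.
by move=> n; split=> //; apply: step => m _; exact: ltW.
Qed.

Lemma shape_seq_ge0 (R : realType) (s : nat -> R) : shape_seq s -> forall n, 0 <= s n.
Proof.
move=> hs [|n]; first by case: hs => ->.
by have [/ltW] := shape_seq_ge hs n.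
Qed.

Lemma shape_seq_mono (R : realType) (s : nat -> R) : shape_seq s ->
  forall m n, (m <= n)%N -> s m <= s n.
Proof.
move=> hs m n /subnK <-; elim: (n - m)%N => [//|d IHd].
apply: (le_trans IHd); rewrite addSn; case: (d + m)%N => [|e].
  by case: hs => -> -> _.
by have [_] := shape_seq_ge hs e.
Qed.

(* With [P] the truncated generating function and [E = P - X - 2 P^2] of large
   valuation, differentiation gives [(1 - 8 X) P' = 1 - 4 P] modulo [E] and [E']. *)
Lemma shape_seq_ratio (R : realType) (s : nat -> R) : shape_seq s -> forall n,
  n.+2%:R * s n.+2 = (8 * n.+1%:R - 4) * s n.+1.
Proof.
move=> [s0 s1 sS] n; pose P : {poly R} := \poly_(i < n.+4) s i.
pose E : {poly R} := P - 'X - 2%:R * (P * P).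
have P_coef i : (i < n.+4)%N -> P`_i = s i by move=> H; rewrite coef_poly H.
have coef_nat m (p : {poly R}) i : (m%:R * p)`_i = m%:R * p`_i by rewrite -polyC_natr coefCM.
have E_coef i : (i < n.+4)%N -> E`_i = 0.
  move=> lti; rewrite /E !coefB coef_nat coefX P_coef // coefM.
  have -> : \sum_(j < i.+1) P`_j * P`_(i - j) = convol s s i.
    by apply: eq_bigr => j _; have := ltn_ord j; rewrite ltnS => leji; rewrite !P_coef //; lia.
  case: i lti => [|[|i]] lti.
  - by rewrite /convol big_ord_recl big_ord0 /= s0 mul0r addr0 mulr0 !subr0.
  - by rewrite /convol !big_ord_recl big_ord0 /= s0 s1 mul0r mulr0 !addr0 mulr0 subr0 subrr.
  - by rewrite sS subr0 subrr.
have E'_coef i : (i < n.+3)%N -> E^`()`_i = 0 by move=> H; rewrite coef_deriv E_coef // mul0rn.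
have mul_coef0 (A B : {poly R}) i : (forall j, (j <= i)%N -> A`_j = 0) -> (A * B)`_i = 0.
  by move=> A0; rewrite coefM big1 // => j _; rewrite A0 ?mul0r // -ltnS.
have dE : E^`() = P^`() - 1 - 4%:R * P * P^`().
  by rewrite /E !derivB derivX -[2%:R]polyC_natr !derivM derivC polyC_natr; ring.
have key : P^`() - 8%:R * (P^`() * 'X) = 1 - 4%:R * P + (E^`() * (1 - 4%:R * P) + E * (8%:R * P^`())).
  by rewrite dE /E; ring.
have z1 : (E^`() * (1 - 4%:R * P))`_n.+1 = 0.
  by apply: mul_coef0 => j H; apply: E'_coef; lia.
have z2 : (E * (8%:R * P^`()))`_n.+1 = 0.
  by apply: mul_coef0 => j H; apply: E_coef; lia.
have := congr1 (fun p : {poly R} => p`_n.+1) key.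
rewrite /= coefB !coefD z1 z2 coefN.
have c1 : P`_n.+1 = s n.+1 by apply: P_coef; lia.
have c2 : P`_n.+2 = s n.+2 by apply: P_coef; lia.
have e0 : (n.+1 == 0%N) = false by [].
rewrite coef1 !coef_nat coefMX !coef_deriv e0 succnK c1 c2 mulr0n -[s n.+1 *+ _]mulr_natl -[s n.+2 *+ _]mulr_natl.
by move=> H; lra.
Qed.

Lemma shape_seq_ratio_cvg (R : realType) (s : nat -> R) : shape_seq s ->
  s n / s n.+1 @[n --> \oo] --> (8^-1 : R).
Proof.
move=> hs; rewrite -(cvg_shiftS (fun n => s n / s n.+1)) /=.
have s_gt0 n : 0 < s n.+1 by case: (shape_seq_ge hs n).
have ratioE n : s n.+1 / s n.+2 = n.+2%:R / (8 * n.+1%:R - 4).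
  have H := shape_seq_ratio hs n.
  have d_gt0 : 0 < 8 * n.+1%:R - 4 :> R by rewrite mulrSr; have := ler0n R n; lra.
  have d_neq0 := lt0r_neq0 d_gt0; have s_neq0 := lt0r_neq0 (s_gt0 n.+1).
  by rewrite -[s n.+1](mulKf d_neq0) -H mulrA mulfK // mulrC.
apply: (@squeeze_cvgr _ _ _ _ (fun=> 8^-1) (fun n => 8^-1 + harmonic n)).
- near=> n; rewrite ratioE /= /harmonic.
  have n0 := ler0n R n.
  have e1 : n.+1%:R = n%:R + 1 :> R by rewrite mulrSr.
  have e2 : n.+2%:R = n%:R + 2 :> R by rewrite 2!mulrSr -addrA.
  rewrite e2 e1; have d_gt0 : 0 < 8 * (n%:R + 1) - 4 :> R by lra.
  rewrite ler_pdivlMr // ler_pdivrMr //; apply/andP; split; first by lra.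
  have : (n%:R + 1)^-1 * (n%:R + 1) = 1 :> R by rewrite mulVf // gt_eqF //; lra.
  have : 0 < (n%:R + 1)^-1 :> R by rewrite invr_gt0; lra.
  by nra.
- exact: cvg_cst.
- by rewrite -[X in _ --> X]addr0; apply: cvgD; [exact: cvg_cst|exact: cvg_harmonic].
Unshelve. all: by end_near. Qed.

Lemma shape_seq_shift_cvg (R : realType) (s : nat -> R) i : shape_seq s ->
  s (n - i)%N / s n @[n --> \oo] --> (8^-1 ^+ i : R).
Proof.
move=> hs; rewrite -(cvg_shiftn i.+1 (fun n => s (n - i)%N / s n)) /=.
have s_neq0 n : s n.+1 != 0 by rewrite gt_eqF //; case: (shape_seq_ge hs n).
elim: i => [|i IHi].
  apply: cvg_near_cst; near=> n; rewrite subn0 addn1 divff //.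
rewrite exprSr.
apply: (@cvg_trans _ ((s (n + i.+1 - i)%N / s (n + i.+1)%N) * (s (n + i.+1)%N / s (n + i.+1).+1) @[n --> \oo])).
  apply: near_eq_cvg; near=> n.
  have -> : (n + i.+2 - i.+1 = n + i.+1 - i)%N by lia.
  by rewrite !addnS mulrA divfK.
apply: cvgM => //.
exact: (cvg_comp _ _ (cvg_addnr i.+1) (shape_seq_ratio_cvg hs)).
Unshelve. all: by end_near. Qed.

(* The ratio formula makes [n s_n / 8^n] telescope. *)
Lemma shape_seq_partial_sum (R : realType) (s : nat -> R) n : shape_seq s ->
  \sum_(i < n.+1) s i * 8^-1 ^+ i = 4^-1 - 2 * (n.+1%:R * s n.+1 * 8^-1 ^+ n.+1).
Proof.
move=> hs; elim: n => [|n IHn].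
  by case: hs => s0 s1 _; rewrite big_ord_recl big_ord0 s0 s1 expr1; lra.
rewrite big_ord_recr /= IHn (shape_seq_ratio hs) [8^-1 ^+ n.+2]exprS; lra.
Qed.

(** The generating function takes the value 1/4 at its singularity 1/8, because the remainder in
    [shape_seq_partial_sum] is at most of order [n^(-1/2)]. *)
Lemma shape_seq_tail (R : realType) (s : nat -> R) (e : R) : shape_seq s -> 0 < e ->
  exists M, 4^-1 - e <= \sum_(i < M) s i * 8^-1 ^+ i.
Proof.
move=> hs e_gt0; pose b n : R := n.+1%:R * s n.+1 * 8^-1 ^+ n.+1.
have b_ge0 n : 0 <= b n by rewrite !mulr_ge0 ?(shape_seq_ge0 hs) ?exprn_ge0 ?invr_ge0 ?ler0n.
have bS n : b n.+1 = b n * (1 - (2 * n.+1%:R)^-1).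
  rewrite /b (shape_seq_ratio hs) [8^-1 ^+ n.+2]exprS.
  have H : n.+1%:R != 0 :> R by rewrite pnatr_eq0.
  by move: (n.+1%:R : R) (s n.+1) (8^-1 ^+ n.+1 : R) H => m x y H; field.
(* Preserved because [(m + 1) (1 - 1 / (2 m))^2 <= m]. *)
have b2 n : n.+1%:R * b n ^+ 2 <= 1.
  elim: n => [|n IHn].
    have -> : b 0%N = 8^-1 by case: hs => _ s1 _; rewrite /b s1 !mul1r expr1.
    by rewrite mul1r expr2; lra.
  apply: le_trans IHn; rewrite bS exprMn mulrCA [leRHS]mulrC ler_wpM2l ?exprn_ge0 //.
  have m_ge1 : 1 <= n.+1%:R :> R by rewrite ler1n.
  rewrite [n.+2%:R]mulrSr; set m := n.+1%:R in m_ge1 *.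
  have m_neq0 : m != 0 by rewrite gt_eqF //; lra.
  have -> : (m + 1) * (1 - (2 * m)^-1) ^+ 2 = m - (3 * m - 1) / (4 * m ^+ 2).
    by field.
  by rewrite lerBlDr lerDl divr_ge0 ?mulr_ge0 ?exprn_ge0 //; lra.
pose N := Num.bound ((4 / e ^+ 2)).
have HN : 4 / e ^+ 2 < N%:R by apply: archi_boundP; rewrite divr_ge0 ?exprn_ge0 ?ltW.
exists N.+1; rewrite shape_seq_partial_sum // -/(b N) lerB // -ler_pdivlMl //.
have [//|lt_eb] := leP (b N) (2^-1 * e).
have := b2 N; rewrite leNgt => /negP[]; apply: (@lt_le_trans _ _ (N%:R * (e ^+ 2 / 4))).
  by rewrite -ltr_pdivrMr ?divr_gt0 ?exprn_gt0 // mul1r invfM invrK mulrC.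
apply: ler_pM; rewrite ?ler_nat // ?divr_ge0 ?exprn_ge0 ?ltW //.
have -> : e ^+ 2 / 4 = (2^-1 * e) ^+ 2 by field.
by rewrite ltr_pXn2r ?nnegrE ?b_ge0 ?mulr_ge0 ?invr_ge0 ?(ltW e_gt0).
Qed.

Lemma convol_split (R : realType) (f g : nat -> R) n M : (M + M <= n)%N ->
  convol f g n = \sum_(i < M) f i * g (n - i)%N +
    \sum_(M <= i < n.+1 - M) f i * g (n - i)%N + \sum_(i < M) g i * f (n - i)%N.
Proof.
move=> leMn; rewrite /convol -(big_mkord xpredT (fun i => f i * g (n - i)%N)).
rewrite (big_cat_nat (n := M)) //=; last by lia.
rewrite [X in _ + X](big_cat_nat (n := n.+1 - M)) /=; [|lia|lia].
rewrite big_mkord addrA; congr (_ + _).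
rewrite big_nat_rev /= -{1}[(n.+1 - M)%N]add0n big_addn.
have -> : (n.+1 - (n.+1 - M))%N = M by lia.
rewrite big_mkord; apply: eq_bigr => i _; have lti := ltn_ord i.
have -> : (n.+1 - M + n.+1 - (i + (n.+1 - M)).+1 = n - i)%N by lia.
by rewrite mulrC; congr (g _ * _); lia.
Qed.

Lemma cvg_sum_ord (R : realType) (u : nat -> nat -> R) (l : nat -> R) M :
  (forall i, u i n @[n --> \oo] --> l i) ->
  \sum_(i < M) u i n @[n --> \oo] --> \sum_(i < M) l i.
Proof.
move=> ul; elim: M => [|M IHM].
  rewrite big_ord0; under eq_fun do rewrite big_ord0; exact: cvg_cst.
rewrite big_ord_recr /=; under eq_fun do rewrite big_ord_recr /=.
exact: cvgD.
Qed.

(** Each end of the convolution carries nearly 1/4 of [s n], since [s (n - i) / s n] tends to [8^-i]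
    and the series at 1/8 sums to 1/4. The whole convolution is half of [s n], so almost nothing is
    left for the middle. *)
Lemma shape_seq_middle (R : realType) (s : nat -> R) (e : R) : shape_seq s -> 0 < e ->
  exists M N, forall n, (N <= n)%N ->
    (M + M <= n)%N /\ \sum_(M <= i < n.+1 - M) s i * s (n - i)%N <= e * s n.
Proof.
move=> hs e_gt0; have e8 : 0 < e / 8 by rewrite divr_gt0.
have [M HM] := shape_seq_tail hs e8.
have /cvgrPdist_le /(_ _ e8) [N _ HN] : \sum_(i < M) s i * (s (n - i)%N / s n) @[n --> \oo]
    --> \sum_(i < M) s i * 8^-1 ^+ i.
  apply: (@cvg_sum_ord _ (fun i n => s i * (s (n - i)%N / s n)) (fun i => s i * 8^-1 ^+ i)) => i.
  by apply: cvgM; [exact: cvg_cst|exact: shape_seq_shift_cvg].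
exists M, (N + (M + M) + 2)%N => n len; split; first by lia.
have /HN : (N <= n)%N by lia.
rewrite ler_norml => /andP[_ Hn].
have {Hn} : 4^-1 - e / 4 <= \sum_(i < M) s i * (s (n - i)%N / s n) by lra.
case: n len => [|[|n]] len; [by lia|by lia|].
have sn_gt0 : 0 < s n.+2 by case: (shape_seq_ge hs n.+1).
have -> : \sum_(i < M) s i * (s (n.+2 - i)%N / s n.+2) =
   (\sum_(i < M) s i * s (n.+2 - i)%N) / s n.+2.
  by rewrite mulr_suml; apply: eq_bigr => i _; rewrite mulrA.
rewrite ler_pdivlMr // => Hn.
have es_gt0 : 0 < e * s n.+2 by rewrite mulr_gt0.
have [_ _ sS] := hs; have := sS n; rewrite (@convol_split _ _ _ _ M); [|lia].
by rewrite mulrBl in Hn; lra.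
Qed.

(** * Convolutions of sequences dominated by the shape counts *)

Lemma convol_le (R : realType) (s f g : nat -> R) C C' : shape_seq s ->
  (forall n, 0 <= f n <= C * s n) -> (forall n, 0 <= g n <= C' * s n) ->
  forall n, 0 <= convol f g n <= C * C' * s n.
Proof.
move=> hs hf hg n; apply/andP; split.
  apply: sumr_ge0 => i _; case/andP: (hf i) => ? _; case/andP: (hg (n - i)%N) => ? _.
  exact: mulr_ge0.
have C0 : 0 <= C by case: hs (hf 1%N) => _ -> _ /andP[]; rewrite mulr1; apply: le_trans.
have C'0 : 0 <= C' by case: hs (hg 1%N) => _ -> _ /andP[]; rewrite mulr1; apply: le_trans.
apply: (@le_trans _ _ (C * C' * convol s s n)).
  rewrite /convol mulr_sumr; apply: ler_sum => i _.
  case/andP: (hf i) => ? ?; case/andP: (hg (n - i)%N) => ? ?.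
  by rewrite mulrACA ler_pM.
rewrite ler_wpM2l ?mulr_ge0 //; case: n => [|[|n]].
- by rewrite /convol big_ord_recl big_ord0; case: hs => -> _ _; rewrite mul0r addr0.
- by rewrite /convol !big_ord_recl big_ord0 /=; case: hs => -> -> _; rewrite mul0r mulr0 !addr0.
- by have := shape_seq_ge0 hs n.+2; case: hs => _ _ ->; lra.
Qed.

Lemma approx_cvg (R : realType) (u : nat -> R) :
  (forall e, 0 < e -> exists2 v : nat -> R, cvgn v &
    exists N, forall n, (N <= n)%N -> `|u n - v n| <= e) -> cvgn u.
Proof.
move=> uv; apply/cauchy_cvgP/cauchy_exP => e e_gt0.
have e3 : 0 < e / 3 by rewrite divr_gt0.
have [v vcvg [N HN]] := uv _ e3.
have /cvgrPdist_le /(_ _ e3) [N' _ HN'] := vcvg.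
exists (limn v); exists (maxn N N') => //= n /=; rewrite geq_max => /andP[leN leN'].
rewrite /ball /=; have := HN _ leN; have := HN' _ leN' => /=.
rewrite distrC => H1 H2; rewrite distrC.
have -> : u n - limn v = (u n - v n) + (v n - limn v) by ring.
by apply: (le_lt_trans (ler_normD _ _)); lra.
Qed.

Lemma dominated_shift_cvg (R : realType) (s g : nat -> R) i : shape_seq s ->
  cvgn (fun n => g n / s n) -> cvgn (fun n => g (n - i)%N / s n).
Proof.
move=> hs /cvg_ex[/= l gl]; apply/cvg_ex; exists (l * 8^-1 ^+ i) => /=.
apply: (@cvg_trans _ ((g (n - i)%N / s (n - i)%N) * (s (n - i)%N / s n) @[n --> \oo])).
  apply: near_eq_cvg; exists i.+1 => //= n /= ltin.
  have : s (n - i)%N != 0.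
    by rewrite gt_eqF // -(subnSK ltin); case: (shape_seq_ge hs (n - i.+1)%N).
  by move=> H; rewrite mulrA divfK.
apply: cvgM; last exact: shape_seq_shift_cvg.
rewrite -(cvg_shiftn i (fun n => g (n - i)%N / s (n - i)%N)).
by under eq_fun do rewrite addnK.
Qed.

(** Without its middle, the convolution has a fixed number of terms at each end, each with a limit;
    the middle is at most [C * C] times that of [s]. *)
Lemma convol_ratio_cvg (R : realType) (s f g : nat -> R) C : shape_seq s ->
  (forall n, 0 <= f n <= C * s n) -> (forall n, 0 <= g n <= C * s n) ->
  cvgn (fun n => f n / s n) -> cvgn (fun n => g n / s n) ->
  cvgn (fun n => convol f g n / s n).
Proof.
move=> hs hf hg fcvg gcvg; apply: approx_cvg => e e_gt0.
have C0 : 0 <= C by case: hs (hf 1%N) => _ -> _ /andP[]; rewrite mulr1; apply: le_trans.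
have d_gt0 : 0 < e / (C * C + 1) by rewrite divr_gt0 // ltr_wpDl // mulr_ge0.
have [M [N HN]] := shape_seq_middle hs d_gt0.
exists (fun n => \sum_(i < M) f i * (g (n - i)%N / s n) + \sum_(i < M) g i * (f (n - i)%N / s n)).
  apply: is_cvgD.
    have H i := dominated_shift_cvg (i := i) hs gcvg.
    apply/cvg_ex; eexists; apply: (@cvg_sum_ord _ (fun i n => f i * (g (n - i)%N / s n))) => i.
    by apply: cvgM; [exact: cvg_cst|exact: H].
  have H i := dominated_shift_cvg (i := i) hs fcvg.
  apply/cvg_ex; eexists; apply: (@cvg_sum_ord _ (fun i n => g i * (f (n - i)%N / s n))) => i.
  by apply: cvgM; [exact: cvg_cst|exact: H].
exists N.+1 => n ltNn; have [leM Hmid] := HN n (ltnW ltNn).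
have sn_gt0 : 0 < s n by case: n ltNn {leM Hmid} => // n _; case: (shape_seq_ge hs n).
rewrite (convol_split f g leM).
have sumE (a b : nat -> R) : \sum_(i < M) a i * (b (n - i)%N / s n) = (\sum_(i < M) a i * b (n - i)%N) / s n.
  by rewrite mulr_suml; apply: eq_bigr => i _; rewrite mulrA.
rewrite !sumE -mulrDl -mulrBl.
set S1 := \sum_(i < M) _; set S2 := \sum_(i < M) _; set m := \sum_(M <= i < _) _.
have -> : S1 + m + S2 - (S1 + S2) = m by ring.
have m_ge0 : 0 <= m.
  apply: sumr_ge0 => i _; case/andP: (hf i) => ? _; case/andP: (hg (n - i)%N) => ? _.
  exact: mulr_ge0.
rewrite ger0_norm ?divr_ge0 ?(ltW sn_gt0) // ler_pdivrMr //.
apply: (@le_trans _ _ (C * C * \sum_(M <= i < n.+1 - M) s i * s (n - i)%N)).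
  rewrite mulr_sumr; apply: ler_sum => i _.
  case/andP: (hf i) => ? ?; case/andP: (hg (n - i)%N) => ? ?.
  by rewrite mulrACA ler_pM.
apply: (@le_trans _ _ (C * C * (e / (C * C + 1) * s n))); first by rewrite ler_wpM2l ?mulr_ge0.
rewrite mulrA ler_wpM2r ?(ltW sn_gt0) //.
rewrite mulrA ler_pdivrMr ?ltr_wpDl ?mulr_ge0 // mulrDr mulr1 mulrC lerDl ltW //.
Qed.

(* The equation [F = H + 3 T F] is subcritical since [3 T < 1] at the singularity
   [1/8], where [T = 1/4]. *)
Lemma subcritical_bound (R : realType) (s F H : nat -> R) C : shape_seq s ->
  F 0%N = 0 -> (forall n, 0 <= F n) -> (forall n, H n <= C * s n) ->
  (forall n, F n = H n + 3 * convol s F n) ->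
  exists C', forall n, F n <= C' * s n.
Proof.
move=> hs F0 F_ge0 HC FE.
have gen (k t x h a b c : R) : 0 <= k * x -> a <= k * (4^-1 * x) -> b <= k * (48^-1 * x) -> c <= t * x ->
  h <= C * x -> 16 * (C + 3 * t) * x <= k * x -> h + 3 * (a + b + c) <= k * x by lra.
have e48 : 0 < 48^-1 :> R by rewrite invr_gt0.
have [M [N HN]] := shape_seq_middle hs e48.
have s_ge0 := shape_seq_ge0 hs.
have s_gt0 n : 0 < s n.+1 by case: (shape_seq_ge hs n).
have C_ge0 : 0 <= C.
  have [s0 s1 _] := hs; have := HC 1%N; have := FE 1%N.
  rewrite /convol !big_ord_recl big_ord0 /= s0 F0 s1 mul0r mulr0 !addr0 mulr0 addr0 mulr1 => <-.
  by apply: le_trans; apply: F_ge0.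
pose S := \sum_(i < M) F i; have S_ge0 : 0 <= S by apply: sumr_ge0 => i _.
(* The first summand handles the indices below the threshold, the second closes the induction: the
   recursive terms take at most [3 * (1/4 + 1/48) = 13/16] of [K], and [C + 3 * S] at most 1/16. *)
pose K := \sum_(i < N + 2) F i / s i + 16 * (C + 3 * S).
have K_ge0 : 0 <= K.
  rewrite addr_ge0 ?mulr_ge0 ?addr_ge0 ?mulr_ge0 //.
  by apply: sumr_ge0 => i _; rewrite divr_ge0.
exists K; elim/ltn_ind => n IHn.
have [ltnN|leNn] := ltnP n (N + 2).
  case: n ltnN {IHn} => [|n] ltnN; first by rewrite F0 mulr_ge0.
  rewrite -ler_pdivrMr // /K (bigD1 (Ordinal ltnN)) //= -addrA lerDl addr_ge0 //.
    by apply: sumr_ge0 => i _; rewrite divr_ge0.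
  by rewrite mulr_ge0 ?addr_ge0 ?mulr_ge0.
have [leM mid] : (M + M <= n)%N /\ \sum_(M <= i < n.+1 - M) s i * s (n - i)%N <= 48^-1 * s n.
  by apply: HN; lia.
have sF i : (i <= n)%N -> s i * F (n - i)%N <= s i * (K * s (n - i)%N).
  case: i => [|i] lein; first by have [-> _ _] := hs; rewrite !mul0r.
  by rewrite ler_wpM2l // IHn //; lia.
rewrite FE (convol_split s F leM).
have b1 : \sum_(i < M) s i * F (n - i)%N <= K * (4^-1 * s n).
  apply: (@le_trans _ _ (K * \sum_(i < M) s i * s (n - i)%N)).
    rewrite mulr_sumr; apply: ler_sum => i _; rewrite mulrCA; apply: sF.
    by have := ltn_ord i; lia.
  rewrite ler_wpM2l //; have [_ _ sS] := hs.
  case: n leNn leM mid {IHn sF} => [|[|n]] leNn leM mid; [lia|lia|].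
  rewrite sS (convol_split s s leM).
  set m := \sum_(M <= i < _) _; have : 0 <= m by apply: sumr_ge0 => i _; rewrite mulr_ge0.
  by lra.
have b2 : \sum_(M <= i < n.+1 - M) s i * F (n - i)%N <= K * (48^-1 * s n).
  apply: (@le_trans _ _ (K * \sum_(M <= i < n.+1 - M) s i * s (n - i)%N)).
    rewrite mulr_sumr big_nat_cond [leRHS]big_nat_cond; apply: ler_sum => i /andP[/andP[_ lti] _].
    by rewrite mulrCA; apply: sF; lia.
  by rewrite ler_wpM2l.
have b3 : \sum_(i < M) F i * s (n - i)%N <= S * s n.
  rewrite /S mulr_suml; apply: ler_sum => i _; rewrite ler_wpM2l //.
  by apply: shape_seq_mono => //; lia.
have HCn := HC n.
have Ks : 16 * (C + 3 * S) * s n <= K * s n.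
  rewrite ler_wpM2r // /K lerDr; apply: sumr_ge0 => i _; rewrite divr_ge0 //.
exact: (gen _ _ _ _ _ _ _ (mulr_ge0 K_ge0 (s_ge0 n)) b1 b2 b3 HCn Ks).
Qed.

End Shapes.

(** * Words up to renaming *)

Section Words.

Local Open Scope ring_scope.

HB.instance Definition _ (L : Type) := gen_eqMixin (tree L).
HB.instance Definition _ (L : Type) := gen_choiceMixin (tree L).

Fixpoint words (T : Type) (ls : seq T) (n : nat) : seq (seq T) :=
  if n is m.+1 then [seq x :: w | x <- ls, w <- words ls m] else [:: [::]].

Lemma count_wordsS (T : Type) (ls : seq T) n (P : pred (seq T)) :
  count P (words ls n.+1) = (\sum_(x <- ls) count (fun w => P (x :: w)) (words ls n))%N.
Proof.
rewrite -sum1_count big_mkcond /= big_allpairs_dep /=; apply: eq_bigr => x _.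
by rewrite -big_mkcond sum1_count.
Qed.

Lemma mem_words (T : eqType) (ls : seq T) n (w : seq T) :
  (w \in words ls n) = (size w == n) && all (mem ls) w.
Proof.
elim: n w => [|n IHn] [|x w] //=; last first.
  apply/allpairsP/idP => [[[y v] /= [yls vw [-> ->]]]|].
    by move: vw; rewrite IHn eqSS yls.
  rewrite eqSS => /and3P[sw xls wls]; exists (x, w) => /=; split=> //.
  by rewrite IHn sw.
by apply/negP => /allpairsP[[y v] /= [_ _]].
Qed.

Lemma size_words (T : Type) (ls : seq T) n : size (words ls n) = (size ls ^ n)%N.
Proof. by elim: n => //= n IHn; rewrite size_allpairs IHn expnS. Qed.

(** Letters outside the mask are free, and those inside form an arbitrary word of the smaller
    length. *)
Lemma count_mask_words (T : Type) (ls : seq T) (bs : bitseq) (Q : pred (seq T)) :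
  count (fun w => Q (mask bs w)) (words ls (size bs)) =
  (size ls ^ count negb bs * count Q (words ls (count id bs)))%N.
Proof.
elim: bs Q => [|b bs IHbs] Q; first by rewrite /= mul1n.
rewrite [size _]/= count_wordsS; case: b.
  rewrite [count negb _]/= [count id _]/= add0n add1n count_wordsS big_distrr /=.
  by apply: eq_bigr => x _; rewrite -(IHbs (fun v => Q (x :: v))).
rewrite /= add1n add0n expnS -mulnA -IHbs big_const_seq count_predT iter_addn_0.
by rewrite mulnC.
Qed.

Definition lits (j : nat) : seq literal := [seq (i, b) | i <- iota 0 j, b <- [:: false; true]].

Lemma size_lits j : size (lits j) = (2 * j)%N.
Proof. by rewrite size_allpairs size_iota mulnC. Qed.

Lemma mem_lits j (l : literal) : (l \in lits j) = (l.1 < j)%N.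
Proof.
apply/allpairsP/idP => [[[i b] /= [Hi _ ->]]|Hl].
  by move: Hi; rewrite mem_iota.
exists l; rewrite mem_iota add0n Hl; split=> //; last by case: l {Hl}.
by case: l.2; rewrite !inE.
Qed.

Lemma uniq_lits j : uniq (lits j).
Proof. by apply: allpairs_uniq => //; [apply: iota_uniq|case=> [? ?] [? ?] _ _ [-> ->]]. Qed.

Definition word_nvars (w : seq literal) : nat := size (undup (map fst w)).

Definition word_rep (w : seq literal) : nat := (size w - word_nvars w)%N.

Lemma word_nvars_cons l w :
  word_nvars (l :: w) = ((l.1 \notin map fst w) + word_nvars w)%N.
Proof. by rewrite /word_nvars /=; case: ifP. Qed.

Lemma word_nvars_size w : (word_nvars w <= size w)%N.
Proof. by rewrite /word_nvars (leq_trans (size_undup _)) ?size_map. Qed.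

Definition rename_lit (sigma : nat -> nat) (eps : nat -> bool) (l : literal) : literal :=
  (sigma l.1, l.2 (+) eps l.1).

(** Equivalence of trees without the condition on shapes, read on the words of leaves. *)
Definition word_equiv (u v : seq literal) : Prop :=
  [/\ size u = size v,
      forall i j, (i < size u)%N -> (j < size u)%N ->
        (nth (0%N, false) u i).1 = (nth (0%N, false) u j).1 <->
        (nth (0%N, false) v i).1 = (nth (0%N, false) v j).1
    & forall i j, (i < size u)%N -> (j < size u)%N ->
        nth (0%N, false) u i = nth (0%N, false) u j <->
        nth (0%N, false) v i = nth (0%N, false) v j].

Lemma word_equiv_refl u : word_equiv u u.
Proof. by split. Qed.

Lemma word_equiv_sym u v : word_equiv u v -> word_equiv v u.
Proof.
case=> suv vars lit; split=> // i j; rewrite -suv => lti ltj.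
  by rewrite vars.
by rewrite lit.
Qed.

Lemma word_equiv_trans u v w : word_equiv u v -> word_equiv v w -> word_equiv u w.
Proof.
case=> suv vars lit [svw vars' lit']; split; first by rewrite suv.
  by move=> i j lti ltj; rewrite vars // vars' // -suv.
by move=> i j lti ltj; rewrite lit // lit' // -suv.
Qed.

(** A variable of [u] is sent to the variable that [v] carries at its first occurrence, and is
    negated iff the signs differ there. *)
Lemma word_equivP u v : word_equiv u v <->
  exists sigma eps, {in map fst u &, injective sigma} /\ v = map (rename_lit sigma eps) u.
Proof.
pose l0 : literal := (0%N, false).
have nthfst (w : seq literal) i : (i < size w)%N -> (nth l0 w i).1 \in map fst w.
  by move=> lti; apply/map_f/mem_nth.
split=> [[suv vars lit]|[sigma [eps [sinj ->]]]]; last first.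
  split=> [|i j lti ltj|i j lti ltj]; first by rewrite size_map.
    rewrite !(nth_map l0) //=; split=> [->//|]; apply: sinj; exact: nthfst.
  rewrite !(nth_map l0) //; split=> [->//|].
  case: (nth l0 u i) (nth l0 u j) (nthfst u i lti) (nthfst u j ltj) => [a1 a2] [b1 b2] /= ha hb.
  by case=> /(sinj _ _ ha hb) <- /addIb <-.
pose idx x := index x (map fst u).
have idx_lt x : x \in map fst u -> (idx x < size u)%N.
  by move=> xu; rewrite /idx -(size_map fst) index_mem.
have idxK x : x \in map fst u -> (nth l0 u (idx x)).1 = x.
  by move=> xu; rewrite -(nth_map l0 0%N) ?idx_lt // nth_index.
exists (fun x => (nth l0 v (idx x)).1).
exists (fun x => (nth l0 v (idx x)).2 (+) (nth l0 u (idx x)).2); split.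
  move=> x y xu yu /= /vars; rewrite !idxK //.
  by apply=> //; exact: idx_lt.
apply: (@eq_from_nth _ l0); rewrite ?size_map // -suv => i lti.
rewrite (nth_map l0) // /rename_lit.
have iu := nthfst u i lti; set k := idx _.
have ltk : (k < size u)%N by exact: idx_lt.
have vk : (nth l0 u k).1 = (nth l0 u i).1 by exact: idxK.
have /(vars k i ltk lti) wk := vk; have := lit k i ltk lti.
move: vk wk; rewrite -/l0.
case: (nth l0 u i) (nth l0 u k) (nth l0 v i) (nth l0 v k) => [a1 a2] [b1 b2] [c1 c2] [d1 d2] /= -> -> H.
congr (_, _); move: H; case: a2; case: b2; case: c2; case: d2 => //= -[H1 H2].
all: by [have := H1 erefl | have := H2 erefl].
Qed.

Lemma size_undup_map_in (T U : eqType) (f : T -> U) (s : seq T) :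
  {in s &, injective f} -> size (undup (map f s)) = size (undup s).
Proof.
elim: s => //= x s IHs finj.
have -> : (f x \in map f s) = (x \in s).
  apply/mapP/idP => [[y ys eqf]|xs]; last by exists x.
  by rewrite (finj x y) ?inE ?eqxx ?ys ?orbT.
have IH : size (undup (map f s)) = size (undup s).
  by apply: IHs => y z ys zs; apply: finj; rewrite inE ?ys ?zs orbT.
by case: ifP => //= _; rewrite IH.
Qed.

Lemma map_fst_rename sigma eps w :
  map fst (map (rename_lit sigma eps) w) = map sigma (map fst w).
Proof. by rewrite -!map_comp. Qed.

Lemma word_equiv_nvars u v : word_equiv u v -> word_nvars u = word_nvars v.
Proof.
move/word_equivP => [sigma [eps [sinj ->]]].
by rewrite /word_nvars map_fst_rename (size_undup_map_in sinj).
Qed.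

Lemma word_equiv_cons_old x y u sigma eps :
  {in map fst u &, injective sigma} -> x.1 \in map fst u ->
  word_equiv (x :: u) (y :: map (rename_lit sigma eps) u) <-> y = rename_lit sigma eps x.
Proof.
move=> sinj xu; split=> [/word_equivP[sigma' [eps' [_ [-> eqr]]]]|->].
  have /mapP[l lu xl] := xu.
  have /eq_in_map/(_ l lu) [] := eqr.
  by rewrite /rename_lit xl => -> /addbI ->.
apply/word_equivP; exists sigma, eps; split=> //= a b.
rewrite !inE => /predU1P[->|au] /predU1P[->|bu]; exact: sinj.
Qed.

Lemma word_equiv_cons_new x y u v : word_equiv u v -> x.1 \notin map fst u ->
  word_equiv (x :: u) (y :: v) <-> y.1 \notin map fst v.
Proof.
move=> /word_equivP[sigma [eps [sinj vE]]] xu; split.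
  move=> /word_equivP[sigma' [eps' [sinj' [-> ->]]]].
  rewrite map_fst_rename; apply: contra xu => /mapP[a au /= eqs].
  by rewrite (sinj' x.1 a) //= inE ?eqxx ?au ?orbT.
rewrite vE map_fst_rename => yv; apply/word_equivP.
exists (fun z => if z == x.1 then y.1 else sigma z).
exists (fun z => if z == x.1 then x.2 (+) y.2 else eps z); split.
  move=> a b; rewrite !inE.
  case: eqP => [->|_] /=.
    move=> _; case: eqP => [->//|_] /= bu eqy.
    by move: yv; rewrite eqy map_f.
  move=> au; case: eqP => [->|_] /= => [_ eqy|bu]; last exact: sinj.
  by move: yv; rewrite -eqy map_f.
rewrite /=; congr (_ :: _).
  by rewrite /rename_lit eqxx addbA addbb addFb -surjective_pairing.
apply/eq_in_map => l lu; rewrite /rename_lit.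
by case: eqP => // eql; move: xu; rewrite -eql map_f.
Qed.

Lemma count_lits_notin j (F : seq nat) : all (fun i => i < j)%N F ->
  count (fun l : literal => l.1 \notin F) (lits j) = (2 * (j - size (undup F)))%N.
Proof.
move=> Fj; rewrite -sum1_count big_mkcond big_allpairs_dep /=.
under eq_bigr => i _ do rewrite !big_cons big_nil /= addn0.
have -> : (\sum_(i <- iota 0 j) ((if i \notin F then 1 else 0) + (if i \notin F then 1 else 0)) =
   2 * count [pred i | i \notin F] (iota 0 j))%N.
  by rewrite big_split /= -big_mkcond sum1_count mul2n addnn.
congr (2 * _)%N.
have := count_predC [pred i | i \in F] (iota 0 j); rewrite size_iota.
have -> : count [pred i | i \in F] (iota 0 j) = size (undup F).
  rewrite -size_filter; apply/perm_size/uniq_perm; rewrite ?filter_uniq ?iota_uniq ?undup_uniq //.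
  move=> i; rewrite mem_filter mem_undup mem_iota /= add0n.
  by case: (boolP (i \in F)) => //= iF; apply: (allP Fj).
by move=> /(congr1 (subn^~ (size (undup F)))) /=; rewrite addKn => <-; apply: eq_count => i.
Qed.

(** Letter by letter: a variable already seen forces the image of the letter, while a new one leaves
    [2 * (j - p)] literals when [p] variables are in use. *)
Lemma count_word_equiv u j :
  count (fun v => `[< word_equiv u v >]) (words (lits j) (size u)) =
  (2 ^ word_nvars u * j ^_ (word_nvars u))%N.
Proof.
elim: u => [|x u IHu].
  by rewrite /= addn0; case: asboolP => // -[]; exact: word_equiv_refl.
rewrite [size _]/= count_wordsS.
under eq_bigr do rewrite -sum1_count big_mkcond.
rewrite exchange_big /=.
pose c := (if x.1 \in map fst u then 1 else 2 * (j - word_nvars u))%N.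
transitivity (\sum_(v <- words (lits j) (size u)) (if `[< word_equiv u v >] then c else 0))%N.
  rewrite big_seq [RHS]big_seq; apply: eq_bigr => v.
  rewrite mem_words => /andP[/eqP sv /allP vj].
  rewrite -big_mkcond sum1_count; case: asboolP => [uv|nuv]; last first.
    apply/eqP; rewrite -leqn0 leqNgt -has_count; apply/hasPn => y _.
    apply/asboolPn => /word_equivP[sigma [eps [sinj [_ eqv]]]]; apply: nuv.
    apply/word_equivP; exists sigma, eps; split=> // a b au bu.
    by apply: sinj; rewrite inE ?au ?bu orbT.
  rewrite /c; case: ifPn => xu.
    have /word_equivP[sigma [eps [sinj vE]]] := uv.
    rewrite (eq_count (a2 := pred1 (rename_lit sigma eps x))) => [|y]; last first.
      by apply/asboolP/eqP; rewrite vE => /word_equiv_cons_old; apply.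
    rewrite count_uniq_mem ?uniq_lits //.
    have /mapP[l lu xl] := xu.
    have : rename_lit sigma eps l \in v by rewrite vE map_f.
    by move/vj; rewrite !inE !mem_lits /= xl => ->.
  rewrite (eq_count (a2 := fun y => y.1 \notin map fst v)) => [|y]; last first.
    apply/asboolP/idP; first by move/(word_equiv_cons_new _ uv xu).
    by move/(word_equiv_cons_new _ uv xu).
  rewrite count_lits_notin -?/(word_nvars v) ?(word_equiv_nvars uv) //.
  by apply/allP => i /mapP[l /vj]; rewrite inE mem_lits => ? ->.
rewrite -big_mkcond big_const_seq iter_addn_0 IHu word_nvars_cons /c mulnC.
case: (x.1 \in _) => /=; first by rewrite add0n muln1.
by rewrite add1n expnS ffactnSr; ring.
Qed.

(* A repetition is created when a letter reuses one of the at most [m] variables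
   already present. *)
Lemma count_word_rep_ge (R : realType) j m k : (0 < j)%N ->
  (count (fun w => k <= word_rep w)%N (words (lits j) m))%:R <=
  (2 * j)%:R ^+ m * m%:R ^+ (2 * k) / j%:R ^+ k :> R.
Proof.
move=> j_gt0; have jR : 0 < j%:R :> R by rewrite ltr0n.
have all_le k' m' : (count (fun w => k' <= word_rep w)%N (words (lits j) m') <= (2 * j) ^ m')%N.
  by rewrite (leq_trans (count_size _ _)) // size_words size_lits.
elim: m k => [|m IHm] [|k].
- by rewrite muln0 !expr0 divr1 !mulr1.
- rewrite /= mulnS expr0n mulr0 mul0r.
  by rewrite /word_rep /word_nvars.
- by rewrite muln0 !expr0 divr1 mulr1 -natrX ler_nat; exact: all_le.
(* Adding a letter gives more than [k] repetitions either because they were there already, or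
   because there were at least [k] and the letter is one of the at most [2 * m] literals on used
   variables. *)
have step : (count (fun w => k < word_rep w)%N (words (lits j) m.+1) <=
   (2 * j) * count (fun w => k < word_rep w)%N (words (lits j) m) +
   (2 * m) * count (fun w => k <= word_rep w)%N (words (lits j) m))%N.
  rewrite count_wordsS; under eq_bigr do rewrite -sum1_count big_mkcond.
  rewrite exchange_big /=.
  apply: (@leq_trans (\sum_(w <- words (lits j) m) ((if (k < word_rep w)%N then 2 * j else 0) +
     (if (k <= word_rep w)%N then 2 * m else 0)))%N).
    rewrite big_seq [leqRHS]big_seq; apply: leq_sum => w; rewrite mem_words => /andP[/eqP sw /allP wj].
    rewrite -big_mkcond sum1_count.
    have repc l : word_rep (l :: w) = (word_rep w + (l.1 \in map fst w))%N.
      rewrite /word_rep word_nvars_cons /=; have := word_nvars_size w.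
      by case: (l.1 \in _) => /=; lia.
    case: (ltnP k (word_rep w)) => [ltk|lek].
      by rewrite (leq_trans (count_size _ _)) // size_lits leq_addr.
    rewrite add0n; case: (leqP k (word_rep w)) => [gek|ltk]; last first.
      rewrite leqn0 -leqn0 leqNgt -has_count; apply/hasPn => l _.
      by rewrite repc; case: (_ \in _); lia.
    have rk : word_rep w = k by lia.
    apply: (@leq_trans (count (fun l : literal => l.1 \in map fst w) (lits j))).
      by apply: sub_count => l; rewrite repc rk; case: (_ \in _) => //; lia.
    have := count_predC (fun l : literal => l.1 \in map fst w) (lits j).
    rewrite size_lits.
    have -> : count (predC (fun l : literal => l.1 \in map fst w)) (lits j) =
      count (fun l : literal => l.1 \notin map fst w) (lits j) by [].
    rewrite count_lits_notin; last first.
      by apply/allP => i /mapP[l /wj]; rewrite inE mem_lits => ? ->.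
    have : (size (undup (map fst w)) <= m)%N by rewrite -sw; exact: word_nvars_size.
    set U := size (undup _); set V := count _ _ => leU eqV.
    have -> : V = (2 * j - 2 * (j - U))%N by rewrite -eqV addnK.
    by move: leU; lia.
  rewrite big_split /= -!big_mkcond !big_const_seq !iter_addn_0.
  by [].
apply: (@le_trans _ _ ((2 * j)%:R * ((2 * j)%:R ^+ m * m%:R ^+ (2 * k.+1) / j%:R ^+ k.+1) +
   (2 * m)%:R * ((2 * j)%:R ^+ m * m%:R ^+ (2 * k) / j%:R ^+ k))).
  move: step; rewrite -(ler_nat R) natrD (natrM _ (2 * j)%N) (natrM _ (2 * m)%N) => /le_trans; apply.
  by rewrite lerD // ler_wpM2l // IHm.
have -> : (2 * j)%:R * ((2 * j)%:R ^+ m * m%:R ^+ (2 * k.+1) / j%:R ^+ k.+1) +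
   (2 * m)%:R * ((2 * j)%:R ^+ m * m%:R ^+ (2 * k) / j%:R ^+ k) =
   (2 * j)%:R ^+ m.+1 * (m%:R ^+ (2 * k.+1) + m%:R ^+ (2 * k).+1) / j%:R ^+ k.+1 :> R.
  have j0 : j%:R != 0 :> R by rewrite gt_eqF.
  rewrite mulnS !exprS !natrM; field.
  by rewrite j0 expf_neq0.
rewrite ler_wpM2r ?invr_ge0 ?exprn_ge0 // ler_wpM2l ?exprn_ge0 //.
rewrite mulnS !exprS mulrSr.
set x : R := m%:R; set y := x ^+ (2 * k); have x0 : 0 <= x by exact: ler0n.
have y0 : 0 <= y by rewrite exprn_ge0.
have : y <= (x + 1) ^+ (2 * k) by rewrite lerXn2r ?nnegrE ?addr_ge0 // lerDl.
set z := _ ^+ _ => yz; have : (x + 1) * ((x + 1) * y) <= (x + 1) * ((x + 1) * z).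
  by rewrite !ler_wpM2l ?addr_ge0.
apply: le_trans; rewrite -subr_ge0.
have -> : (x + 1) * ((x + 1) * y) - (x * (x * y) + x * y) = (x + 1) * y by ring.
by rewrite mulr_ge0 ?addr_ge0.
Qed.

End Words.

(** * Classes of trees as a mixture of labelled trees *)

Section Classes.

Local Open Scope classical_set_scope.
Local Open Scope ring_scope.

(** Rebuilds a tree from its shape and its word of leaves; [x0] only fills in words that are too
    short. *)
Fixpoint relabel (L : Type) (x0 : L) (t : tree unit) (w : seq L) : tree L :=
  match t with
  | Leaf _ => Leaf (head x0 w)
  | Node c t1 t2 =>
      Node c (relabel x0 t1 (take (tsize t1) w)) (relabel x0 t2 (drop (tsize t1) w))
  end.

Lemma tsizeE (L : Type) c (A1 A2 : tree L) : tsize (Node c A1 A2) = (tsize A1 + tsize A2)%N.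
Proof. exact: size_cat. Qed.

Lemma tsize_gt0 (L : Type) (A : tree L) : (0 < tsize A)%N.
Proof. by elim: A => [//|c A1 IH1 A2 IH2]; rewrite tsizeE addn_gt0 IH1. Qed.

Lemma tsize_skeleton (L : Type) (A : tree L) : tsize (skeleton A) = tsize A.
Proof. by elim: A => [//|c A1 IH1 A2 IH2]; rewrite [skeleton _]/= !tsizeE IH1 IH2. Qed.

Lemma leaves_relabel (L : Type) (x0 : L) t w : size w = tsize t -> leaves (relabel x0 t w) = w.
Proof.
elim: t w => [u|c t1 IH1 t2 IH2] w /=; first by case: w => [|x [|]].
rewrite tsizeE => sw; rewrite IH1 ?IH2 ?cat_take_drop //.
  by rewrite size_drop sw addKn.
by rewrite size_takel // sw leq_addr.
Qed.

Lemma skeleton_relabel (L : Type) (x0 : L) t w : skeleton (relabel x0 t w) = t.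
Proof. by elim: t w => [[]|c t1 IH1 t2 IH2] w //=; rewrite IH1 IH2. Qed.

Lemma relabel_leaves (L : Type) (x0 : L) A : relabel x0 (skeleton A) (leaves A) = A.
Proof.
elim: A => [//|c A1 IH1 A2 IH2] /=.
by rewrite tsize_skeleton take_size_cat // drop_size_cat // IH1 IH2.
Qed.

(** [fuel] bounds the recursion, and [n] units suffice. The splits [i = 0] and [i = n] add nothing,
    as no tree has size 0. *)
Fixpoint shapes_rec (fuel n : nat) : seq (tree unit) :=
  if fuel is f.+1 then
    if n == 1%N then [:: Leaf tt] else
    flatten [seq flatten [seq [:: Node And t1 t2; Node Or t1 t2] |
      t1 <- shapes_rec f i, t2 <- shapes_rec f (n - i)] | i <- iota 0 n.+1]
  else [::].

Lemma shapes_recS f n : (1 < n)%N -> shapes_rec f.+1 n =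
  flatten [seq flatten [seq [:: Node And t1 t2; Node Or t1 t2] |
      t1 <- shapes_rec f i, t2 <- shapes_rec f (n - i)] | i <- index_iota 0 n.+1].
Proof. by rewrite /index_iota subn0; case: n => [|[|n]]. Qed.

Definition shapes (n : nat) : seq (tree unit) := shapes_rec n n.

Lemma shapes_rec0 f : shapes_rec f 0 = [::].
Proof. by elim: f => [|f IHf] //=; rewrite IHf. Qed.

Lemma shapes_rec_fuel f n : (n <= f)%N -> shapes_rec f n = shapes n.
Proof.
rewrite /shapes; have [m] := ubnP n; elim: m n f => [//|m IHm] [|n] [|f] //.
  by rewrite shapes_rec0.
rewrite !ltnS => ltnm lenf; have [->//|n_gt0] := posnP n.
rewrite !shapes_recS // ; congr flatten; apply/eq_in_map => i.
rewrite mem_index_iota => /andP[_]; rewrite ltnS leq_eqVlt => /predU1P[->|]; first by rewrite subnn !shapes_rec0 !allpairs0r.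
rewrite ltnS => lein; case: i lein => [|i] lein; first by rewrite !shapes_rec0.
by rewrite !(IHm i.+1) ?(IHm (n.+1 - i.+1)%N) //; lia.
Qed.

Lemma shapes1 : shapes 1 = [:: Leaf tt]. Proof. by []. Qed.

Lemma sum_shapesS (V : nmodType) (F : tree unit -> V) n :
  \sum_(t <- shapes n.+2) F t =
  \sum_(i < n.+3) \sum_(t1 <- shapes i) \sum_(t2 <- shapes (n.+2 - i))
     (F (Node And t1 t2) + F (Node Or t1 t2)).
Proof.
rewrite /shapes shapes_recS // big_flatten big_map big_mkord; apply: eq_bigr => i _; rewrite big_flatten big_allpairs_dep.
have [->|i0] := posnP i; first by rewrite shapes_rec0 !big_nil.
have [ltin|] := ltnP i n.+2; last first.
  move=> lein; have -> : (n.+2 - i = 0)%N by lia.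
  by rewrite big1 ?[RHS]big1 // => t _; rewrite shapes_rec0 big_nil.
rewrite (@shapes_rec_fuel n.+1 i) ?(@shapes_rec_fuel n.+1 (n.+2 - i)%N); [|lia|lia].
apply: eq_bigr => t1 _; apply: eq_bigr => t2 _.
by rewrite !big_cons big_nil /= addr0.
Qed.

Lemma sum_node_pred1 (V : nmodType) (a : V) c (t1 t2 u1 u2 : tree unit) :
  (if Node And t1 t2 == Node c u1 u2 then a else 0) +
  (if Node Or t1 t2 == Node c u1 u2 then a else 0) =
  if (t1 == u1) && (t2 == u2) then a else 0.
Proof.
case: andP => [[/eqP-> /eqP->]|H].
  case: c; first by rewrite eqxx; case: eqP => [//|_]; rewrite addr0.
  by case: eqP => [//|_]; rewrite eqxx add0r.
case: eqP => [[_ e1 e2]|_]; first by case: H; rewrite e1 e2 !eqxx.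
case: eqP => [[_ e1 e2]|_]; first by case: H; rewrite e1 e2 !eqxx.
by rewrite addr0.
Qed.

(** Says that [shapes n] lists every tree of size [n] exactly once and nothing else. The summation
    form follows the recursion [sum_shapesS] and serves both for membership and for reindexing. *)
Lemma sum_shapes_pred1 (V : nmodType) (a : V) t0 n :
  \sum_(t <- shapes n) (if t == t0 then a else 0) = if n == tsize t0 then a else 0.
Proof.
elim: t0 n a => [[]|c u1 IH1 u2 IH2] [|[|n]] a.
- by rewrite big_nil.
- by rewrite shapes1 big_seq1 eqxx.
- rewrite sum_shapesS big1 // => i _; rewrite big1 // => t1 _; rewrite big1 // => t2 _.
  by case: eqP => // _; case: eqP => // _; rewrite addr0.
- by rewrite big_nil tsizeE; case: eqP => //; have := tsize_gt0 u1; lia.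
- rewrite shapes1 big_seq1 tsizeE; case: eqP => // _.
  by case: eqP => //; have := tsize_gt0 u1; have := tsize_gt0 u2; lia.
rewrite sum_shapesS.
transitivity (\sum_(i < n.+3) if (i == tsize u1 :> nat) && (n.+2 - i == tsize u2)%N then a else 0).
  apply: eq_bigr => i _.
  transitivity (\sum_(t1 <- shapes i) if t1 == u1 then
      \sum_(t2 <- shapes (n.+2 - i)) (if t2 == u2 then a else 0) else 0).
    apply: eq_bigr => t1 _; under eq_bigr do rewrite sum_node_pred1.
    by case: eqP => // _; rewrite big1.
  by rewrite IH1 IH2; case: eqP.
rewrite tsizeE; have [e|ne] := eqVneq n.+2 (tsize u1 + tsize u2)%N.
  have lt1 : (tsize u1 < n.+3)%N by lia.
  rewrite (bigD1 (Ordinal lt1)) //= eqxx /= big1 ?addr0.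
    by rewrite e addKn eqxx.
  by move=> i; rewrite -val_eqE /= => /negPf->.
rewrite big1 // => i _; case: ifP => // /andP[/eqP ei /eqP e2].
by move: ne; rewrite -ei -e2 subnKC ?eqxx // -ltnS.
Qed.

Lemma mem_shapes t n : (t \in shapes n) = (n == tsize t).
Proof.
have := @sum_shapes_pred1 nat 1%N t n; rewrite -big_mkcond sum1_count => H.
by rewrite -has_pred1 has_count [count _ _]H; case: eqP.
Qed.

Lemma shape_seq_shapes (R : realType) : @shape_seq R (fun n => (size (shapes n))%:R).
Proof.
split=> // n; have sizeE m : (size (shapes m))%:R = \sum_(t <- shapes m) 1 :> R.
  by rewrite big_const_seq count_predT iter_addr_0.
rewrite sizeE sum_shapesS /convol mulr_sumr; apply: eq_bigr => i _.
rewrite !sizeE mulr_suml mulr_sumr; apply: eq_bigr => t1 _.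
by rewrite mul1r mulr_sumr; apply: eq_bigr => t2 _; rewrite mulr1.
Qed.

Definition l0 : literal := (0%N, false).

Lemma tree_equivE A B : tree_equiv A B <->
  skeleton A = skeleton B /\ word_equiv (leaves A) (leaves B).
Proof.
split=> [[sk vars lit]|[sk [_ vars lit]]]; last by split.
have e : tsize A = tsize B by rewrite -[LHS]tsize_skeleton sk tsize_skeleton.
by split=> //; split.
Qed.

Lemma tree_equiv_refl A : tree_equiv A A.
Proof. by apply/tree_equivE; split=> //; apply: word_equiv_refl. Qed.

Lemma tree_equiv_sym A B : tree_equiv A B -> tree_equiv B A.
Proof. by move/tree_equivE=> [sk w]; apply/tree_equivE; split=> //; apply: word_equiv_sym. Qed.

Lemma tree_equiv_trans A B C : tree_equiv A B -> tree_equiv B C -> tree_equiv A C.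
Proof.
move/tree_equivE=> [sk w] /tree_equivE[sk' w']; apply/tree_equivE.
by rewrite sk sk'; split=> //; apply: word_equiv_trans w'.
Qed.

Lemma tree_class_eq A B : tree_class A = tree_class B <-> tree_equiv A B.
Proof.
split=> [/seteqP[_ sub]|eqAB]; first by apply: sub; apply: tree_equiv_refl.
apply/seteqP; split=> C /= H; last exact: tree_equiv_trans H.
by apply: tree_equiv_trans H; apply: tree_equiv_sym.
Qed.

Definition labelled_trees (j n : nat) : seq aotree :=
  [seq relabel l0 t w | t <- shapes n, w <- words (lits j) n].

Lemma count_labelled_trees (P : pred aotree) j n : count P (labelled_trees j n) =
  (\sum_(t <- shapes n) count (fun w => P (relabel l0 t w)) (words (lits j) n))%N.
Proof.
rewrite -sum1_count big_mkcond big_allpairs_dep /=; apply: eq_bigr => t _.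
by rewrite -big_mkcond sum1_count.
Qed.

Lemma mem_labelled_trees j n A :
  A \in labelled_trees j n -> tsize A = n /\ all (fun l => l.1 < j)%N (leaves A).
Proof.
case/allpairsP => -[t w] /= []; rewrite mem_shapes mem_words => /eqP nt /andP[/eqP sw /allP wj] ->.
rewrite -[LHS]tsize_skeleton skeleton_relabel leaves_relabel ?sw //; split=> //.
by apply/allP => l /wj; rewrite inE mem_lits.
Qed.

Lemma labelled_trees_nvars j n A : A \in labelled_trees j n -> (nvars A <= j)%N.
Proof.
case/mem_labelled_trees => _ /allP Aj; rewrite -(size_iota 0 j).
apply: uniq_leq_size; first exact: undup_uniq.
by move=> i; rewrite mem_undup mem_iota add0n => /mapP[l /Aj ? ->].
Qed.

Lemma count_tree_class A j :
  count (fun B => tree_class B == tree_class A) (labelled_trees j (tsize A)) =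
  (2 ^ nvars A * j ^_ (nvars A))%N.
Proof.
rewrite count_labelled_trees -count_word_equiv.
transitivity (\sum_(t <- shapes (tsize A)) (if t == skeleton A then
   count (fun v => `[< word_equiv (leaves A) v >]) (words (lits j) (tsize A)) else 0))%N; last first.
  by rewrite (@sum_shapes_pred1 nat) tsize_skeleton eqxx.
rewrite !big_seq; apply: eq_bigr => t; rewrite mem_shapes => /eqP nt.
case: eqP => [tA|ntA]; last first.
  apply/eqP; rewrite -leqn0 leqNgt -has_count; apply/hasPn => w _.
  apply/eqP => /tree_class_eq/tree_equivE[]; rewrite skeleton_relabel //.
apply: eq_in_count => w; rewrite mem_words => /andP[/eqP sw _].
apply/eqP/asboolP => [/tree_class_eq/tree_equivE[_]|H].
  by rewrite leaves_relabel ?sw //; apply: word_equiv_sym.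
apply/tree_class_eq/tree_equivE; rewrite skeleton_relabel leaves_relabel ?sw //.
by split=> //; apply: word_equiv_sym.
Qed.

Lemma count_by_class (X Y : eqType) (cl : X -> Y) (s : seq X) (P : pred X) (C : seq Y) :
  uniq C -> {in s, forall x, P x = (cl x \in C)} ->
  count P s = (\sum_(y <- C) count (fun x => cl x == y) s)%N.
Proof.
move=> uC; elim: s => [|x s IHs] Ps /=; first by rewrite big1.
rewrite big_split /= -IHs; last by move=> y ys; apply: Ps; rewrite inE ys orbT.
congr (_ + _)%N; rewrite Ps ?inE ?eqxx //.
under eq_bigr do rewrite eq_sym.
by rewrite -(count_uniq_mem _ uC) -sum1_count big_mkcond; apply: eq_bigr => y _ /=; case: (y == cl x).
Qed.

(* The weights [mix_weight] invert the counts [2^p j^_p] of the labelled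
   representatives of a class with [p] variables. *)
Lemma ncard_tree_classes (R : realType) (good : pred aotree) (D : set aotree) k n :
  (forall A B, tree_equiv A B -> good A -> good B) ->
  (forall A, D A <-> [/\ tsize A = n, (nvars A <= k)%N & good A]) ->
  (ncard [set tree_class A | A in D])%:R =
  \sum_(j < k.+1) mix_weight R k j * (count good (labelled_trees j n))%:R.
Proof.
move=> good_equiv DE.
(* Labels among [k] variables reach every class in question: one with [p <= k] variables has
   [2 ^ p * k ^_ p > 0] such representatives. *)
pose C := undup [seq tree_class A | A <- labelled_trees k n & good A].
have CP K : K \in C <-> exists2 A, D A & tree_class A = K.
  rewrite mem_undup; split=> [/mapP[A]|[A /DE[sA nA gA] <-]].
    rewrite mem_filter => /andP[gA /[dup] /labelled_trees_nvars nA /mem_labelled_trees[sA _] ->].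
    by exists A => //; apply/DE.
  have : (0 < count (fun B => tree_class B == tree_class A) (labelled_trees k (tsize A)))%N.
    by rewrite count_tree_class muln_gt0 expn_gt0 ffact_gt0.
  rewrite -has_count => /hasP[B]; rewrite sA => Bl /eqP eqBA.
  rewrite -eqBA; apply: map_f; rewrite mem_filter Bl andbT.
  by apply: (good_equiv A) => //; apply/tree_class_eq.
have -> : ncard [set tree_class A | A in D] = size C.
  rewrite /ncard; have -> : [set tree_class A | A in D] = [set` [fset K in C]%fset].
    apply/seteqP; split=> K /=; rewrite inE /=; first by move/CP.
    by move/CP.
  by rewrite set_fsetK card_fseq undup_id // undup_uniq.
transitivity (\sum_(K <- C) \sum_(j < k.+1) mix_weight R k j *
    (count (fun B => tree_class B == K) (labelled_trees j n))%:R).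
  transitivity (\sum_(K <- C) 1 : R); first by rewrite big_const_seq count_predT iter_addr_0.
  rewrite !big_seq; apply: eq_bigr => K.
  case/CP => A /DE[sA nA gA] <-.
  rewrite -sA; under eq_bigr do rewrite count_tree_class natrM mulrCA.
  by rewrite -mulr_sumr mix_weight_ffact nA natrX -exprMn mulfV ?expr1n ?pnatr_eq0.
rewrite exchange_big /=; apply: eq_bigr => j _.
rewrite -mulr_sumr -natr_sum -(count_by_class (P := good)) ?undup_uniq //.
move=> A Aj; apply/idP/idP => [gA|/CP[B /DE[sB nB gB] /tree_class_eq eqBA]]; last exact: good_equiv gB.
apply/CP; exists A => //; apply/DE; split=> //; first by case/mem_labelled_trees: Aj.
by apply: leq_trans (labelled_trees_nvars Aj) _; rewrite -ltnS.
Qed.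

End Classes.

(** * Patterns at the root of a tree *)

Section Patterns.

(** These are the connectives at which the value [odd q] has to come from both children; at the
    other connective it is absorbing, so the left child alone can impose it. *)
Definition stays (c : connective) (q : nat) : bool := if c is And then odd q else ~~ odd q.

Definition next_level (c : connective) (q : nat) : nat := if stays c q then q else q.+1.

(* At an even level both subtrees of an [Or] node stay at that level, while the right
   subtree of an [And] node moves to the next level; odd levels are dual. *)
Fixpoint level_leaves (L : Type) (q : nat) (A : tree L) : seq (nat * L) :=
  match A with
  | Leaf l => [:: (q, l)]
  | Node c A1 A2 => level_leaves q A1 ++ level_leaves (next_level c q) A2
  end.

(** [None] is a hole, a part of the tree about which nothing is retained. *)
Fixpoint prune (L : Type) (keep : pred L) (d q : nat) (A : tree L) : tree (option L) :=
  if d <= q then Leaf None else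
  match A with
  | Leaf l => Leaf (if keep l then Some l else None)
  | Node c A1 A2 => Node c (prune keep d q A1) (prune keep d (next_level c q) A2)
  end.

(* [can v P a]: [v] is the value of [P] at [a] for some choice of constants at the holes. *)
Fixpoint can (v : bool) (P : tree (option literal)) (a : assignment) : bool :=
  match P with
  | Leaf None => true
  | Leaf (Some l) => eval_literal l a == v
  | Node And P1 P2 => if v then can v P1 a && can v P2 a else can v P1 a || can v P2 a
  | Node Or P1 P2 => if v then can v P1 a || can v P2 a else can v P1 a && can v P2 a
  end.

Lemma leq_next_level c q : q <= next_level c q.
Proof. by rewrite /next_level; case: ifP. Qed.

Lemma next_level_leq c q d : q < d -> next_level c q <= d.
Proof. by rewrite /next_level; case: ifP => // _ /ltnW. Qed.

Lemma level_leaves_ge (L : eqType) q (A : tree L) x : x \in level_leaves q A -> q <= x.1.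
Proof.
elim: A q => [l|c A1 IH1 A2 IH2] q /=; first by rewrite inE => /eqP->.
rewrite mem_cat => /orP[/IH1//|/IH2]; exact: leq_trans (leq_next_level c q).
Qed.

Lemma snd_level_leaves (L : Type) q (A : tree L) : map snd (level_leaves q A) = leaves A.
Proof. by elim: A q => [//|c A1 IH1 A2 IH2] q /=; rewrite map_cat IH1 IH2. Qed.

Lemma prune_hole (L : Type) (keep : pred L) d q (A : tree L) : d <= q -> prune keep d q A = Leaf None.
Proof. by case: A => [l|c A1 A2] /= ->. Qed.

Lemma prune_node (L : Type) (keep : pred L) d q c (A1 A2 : tree L) : q < d ->
  prune keep d q (Node c A1 A2) = Node c (prune keep d q A1) (prune keep d (next_level c q) A2).
Proof. by move=> ltqd; rewrite /= ltnNge in ltqd *; rewrite (negPf ltqd). Qed.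

Lemma prune_leaf (L : Type) (keep : pred L) d q (l : L) : q < d ->
  prune keep d q (Leaf l) = Leaf (if keep l then Some l else None).
Proof. by move=> ltqd; rewrite /= ltnNge in ltqd *; rewrite (negPf ltqd). Qed.

Lemma can_node c v P1 P2 a : can v (Node c P1 P2) a =
  if v == (if c is And then true else false) then can v P1 a && can v P2 a
  else can v P1 a || can v P2 a.
Proof. by case: c; case: v. Qed.

Lemma eval_both c A1 A2 a v : eval A1 a = v -> eval A2 a = v -> eval (Node c A1 A2) a = v.
Proof. by case: c => /= -> ->; rewrite ?andbb ?orbb. Qed.

Lemma eval_either c A1 A2 a v : v <> (if c is And then true else false) ->
  eval A1 a = v \/ eval A2 a = v -> eval (Node c A1 A2) a = v.
Proof. by case: c; case: v => //= _ [->|->]; rewrite ?andbF ?orbT. Qed.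

Lemma can_eval keep d q A a : can (eval A a) (prune keep d q A) a.
Proof.
elim: A q => [l|c A1 IH1 A2 IH2] q /=; case: leqP => // _.
  by case: (keep l) => //=.
have := IH1 q; have := IH2 (next_level c q).
by case: c; case: (eval A1 a); case: (eval A2 a) => /= H2 H1; rewrite ?H1 ?H2 ?orbT.
Qed.

(** Enlarging the holes can only make more values possible. *)
Lemma can_prune_mono keep d d' q A v a : d' <= d ->
  can v (prune xpredT d q A) a -> can v (prune keep d' q A) a.
Proof.
move=> led; elim: A q => [l|c A1 IH1 A2 IH2] q.
  have [ledq|ltq] := leqP d' q; first by rewrite [X in _ -> can _ X _]prune_hole.
  by rewrite !prune_leaf ?(leq_trans ltq led) //; case: (keep l).
have [ledq|ltq] := leqP d' q; first by rewrite [X in _ -> can _ X _]prune_hole.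
rewrite !prune_node ?(leq_trans ltq led) // !can_node.
have := IH1 q; have := IH2 (next_level c q).
case: eqP => _ H2 H1.
  by case/andP => /H1-> /H2->.
by case/orP => [/H1->|/H2->]; rewrite ?orbT.
Qed.

(** Where both children stay, both are forced; elsewhere the left child is forced to the absorbing
    value. *)
Lemma level_forced q A a :
  {in level_leaves q A, forall x, x.1 = q -> eval_literal x.2 a = odd q} -> eval A a = odd q.
Proof.
elim: A q => [l|c A1 IH1 A2 IH2] q H /=; first by apply: (H (q, l)); rewrite ?inE.
have E1 : eval A1 a = odd q by apply: IH1 => x xA; apply: H; rewrite /= mem_cat xA.
have E2 : stays c q -> eval A2 a = odd q.
  move=> st; apply: IH2 => x xA; apply: H.
  by rewrite /= mem_cat /next_level st xA orbT.
move: E1 E2; rewrite /stays; case: c {H} => ->; case: (odd q) => //=; exact.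
Qed.

(** The opposite value is given to both children. A right child that drops to level [q.+1] takes it
    by [level_forced], since it is the value attached to the parity of [q.+1]. *)
Lemma two_levels_forced q A a :
  {in level_leaves q A, forall x, x.1 < q.+2 -> eval_literal x.2 a = ~~ odd q} ->
  eval A a = ~~ odd q.
Proof.
elim: A q => [l|c A1 IH1 A2 IH2] q H /=; first by apply: (H (q, l)); rewrite ?inE.
have E1 : eval A1 a = ~~ odd q by apply: IH1 => x xA; apply: H; rewrite /= mem_cat xA.
have E2 : eval A2 a = ~~ odd q.
  have H2 x : x \in level_leaves (next_level c q) A2 -> x.1 < q.+2 -> eval_literal x.2 a = ~~ odd q.
    by move=> xA; apply: H; rewrite /= mem_cat xA orbT.
  move: H2; rewrite /next_level; case: ifP => _ H2; first by apply: IH2 => x /H2.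
  by rewrite -oddS; apply: level_forced => x /H2 H3 eqx; apply: H3; rewrite eqx.
by case: c {H E2 IH2} E1 E2 => -> ->; rewrite ?andbb ?orbb.
Qed.

(** * Forcing the value of a tree through its free leaves *)

Definition free_leaves (K : pred nat) (d q : nat) (A : aotree) : seq literal :=
  [seq x.2 | x <- level_leaves q A & if x.1 < d then ~~ K x.2.1 else x.1 < d.+2].

Lemma uniq_literal_assignment (F : seq literal) (v : bool) : uniq (map fst F) ->
  exists b : assignment, {in F, forall l, eval_literal l b = v}.
Proof.
move=> uF; exists (fun x => v (+) (nth (0, false) F (index x (map fst F))).2) => l lF.
rewrite /eval_literal.
have -> : nth (0, false) F (index l.1 (map fst F)) = l; last by rewrite addbK.
have li : index l F < size F by rewrite index_mem.
rewrite -{1}(nth_index (0, false) lF) -(nth_map _ 0) // index_uniq ?size_map //.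
by rewrite nth_index.
Qed.

(* An unrepeated free leaf can be set independently of the rest, and setting the free
   leaves of the levels [d] and [d.+1] sets the value of all subtrees entering level [d]. *)
Lemma force_value K d q A v a : q <= d ->
  uniq (map fst (free_leaves K d q A)) ->
  can v (prune (fun l : literal => K l.1) d q A) a ->
  exists b : assignment, forall a', (forall x, K x -> a' x = a x) ->
    {in map fst (free_leaves K d q A), a' =1 b} -> eval A a' = v.
Proof.
elim: A q v => [l|c A1 IH1 A2 IH2] q v leqd uF.
  case: (ltnP q d) => [ltqd|ledq].
    rewrite prune_leaf // /free_leaves /= ltqd; case: ifP => Kl /=.
      move/eqP => <-; exists a => a' aK _; rewrite /eval_literal aK //.
    move=> _; exists (fun=> v (+) l.2) => a' _ /(_ l.1); rewrite inE eqxx => /(_ erefl).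
    by rewrite /eval_literal => ->; rewrite addbK.
  move=> _; have [b bF] := uniq_literal_assignment v uF; exists b => a' _ a'b.
  have lF : l \in free_leaves K d q (Leaf l).
    have lt2 : q < d.+2 by lia.
    by rewrite /free_leaves /= [q < d]ltnNge ledq /= lt2 /= inE.
  by rewrite /= -(bF l lF) /eval_literal a'b // map_f.
have [ledq|ltqd] := leqP d q.
  have eqd : q = d by apply/eqP; rewrite eqn_leq leqd.
  rewrite {}eqd in uF *; move=> _.
  have [b bF] := uniq_literal_assignment v uF; exists b => a' _ a'b.
  have H : {in level_leaves d (Node c A1 A2), forall x, x.1 < d.+2 -> eval_literal x.2 a' = v}.
    move=> x xA ltx; have xF : x.2 \in free_leaves K d d (Node c A1 A2).
      apply/mapP; exists x => //; rewrite mem_filter xA andbT.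
      by rewrite ltnNge (level_leaves_ge xA) /=.
    by rewrite -(bF _ xF) /eval_literal a'b // map_f.
  have [vd|vd] := eqVneq v (odd d).
    by rewrite vd; apply: level_forced => x xA eqx; rewrite -vd; apply: H; rewrite ?eqx.
  have vE : v = ~~ odd d by move: vd; clear; case: v; case: (odd d).
  by rewrite vE; apply: two_levels_forced => x xA ltx; rewrite H.
have FE : free_leaves K d q (Node c A1 A2) =
   free_leaves K d q A1 ++ free_leaves K d (next_level c q) A2.
  by rewrite /free_leaves /= filter_cat map_cat.
move: uF; rewrite {}FE map_cat cat_uniq => /and3P[u1 /hasPn dis u2].
rewrite prune_node //.
have lenx := next_level_leq c ltqd.
have use1 : can v (prune (fun l => K l.1) d q A1) a -> exists b : assignment,
   forall a', (forall x, K x -> a' x = a x) ->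
   {in map fst (free_leaves K d q A1), a' =1 b} -> eval A1 a' = v by exact: IH1.
have use2 : can v (prune (fun l => K l.1) d (next_level c q) A2) a -> exists b : assignment,
   forall a', (forall x, K x -> a' x = a x) ->
   {in map fst (free_leaves K d (next_level c q) A2), a' =1 b} -> eval A2 a' = v by exact: IH2.
rewrite can_node; case: eqP => [cv /andP[/use1[b1 B1] /use2[b2 B2]]|cv].
  exists (fun x => if x \in map fst (free_leaves K d q A1) then b1 x else b2 x) => a' aK a'b.
  have E1 : eval A1 a' = v.
    by apply: B1 => // x xF; rewrite a'b ?mem_cat ?xF.
  have E2 : eval A2 a' = v.
    apply: B2 => // x xF; rewrite a'b ?mem_cat ?xF ?orbT //.
    by rewrite (negPf (dis x xF)).
  exact: eval_both.
case/orP => [/use1[b1 B1]|/use2[b2 B2]].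
  exists b1 => a' aK a'b; apply: eval_either cv _; left.
  by apply: B1 => // x xF; rewrite a'b ?mem_cat ?xF.
exists b2 => a' aK a'b; apply: eval_either cv _; right.
by apply: B2 => // x xF; rewrite a'b ?mem_cat ?xF ?orbT.
Qed.

(** Passes from [a] to [b] one variable at a time, below the bound given by [finitary]; inessential
    variables do not change the value. *)
Lemma essential_agree g a b : finitary g ->
  (forall x, essential g x -> a x = b x) -> g a = g b.
Proof.
move=> [m gm] ab; pose h i : assignment := fun x => if x < i then b x else a x.
have -> : g b = g (h m) by apply: gm => x ltx; rewrite /h ltx.
have -> : g a = g (h 0) by apply: gm.
elim: m {gm} => [//|m ->].
have hE v : set_var (h m) m v = fun x => if x == m then v else h m x by [].
have e0 : h m = set_var (h m) m (a m).
  by apply/funext => x; rewrite /set_var; case: eqP => // ->; rewrite /h ltnn.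
have e1 : h m.+1 = set_var (h m) m (b m).
  apply/funext => x; rewrite /set_var /h ltnS leq_eqVlt.
  by case: eqP => // ->; rewrite ltnn.
rewrite {1}e0 e1; have [es|nes] := pselect (essential g m); first by rewrite ab.
have eq01 : g (set_var (h m) m false) = g (set_var (h m) m true).
  by apply: contrapT => ne; apply: nes; exists (h m).
by case: (a m); case: (b m).
Qed.

(** [force_value] makes [A] take the value [v] by a choice of the free variables. These lie outside
    [K], hence are inessential, so this choice leaves [g a] unchanged. *)
Lemma fresh_robust (K : pred nat) d A g : finitary g -> computes A g ->
  (forall x, essential g x -> K x) ->
  uniq (map fst (free_leaves K d 0 A)) -> all (fun l => ~~ K l.1) (free_leaves K d 0 A) ->
  forall v a, can v (prune (fun l : literal => K l.1) d 0 A) a -> v = g a.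
Proof.
move=> fin Ag VK uF /allP nF v a cv.
have [b Hb] := force_value (leq0n d) uF cv.
pose a' : assignment := fun x => if K x then a x else b x.
rewrite -(Hb a') ?Ag; first last.
- by move=> x /mapP[l lF ->]; rewrite /a' (negPf (nF l lF)).
- by move=> x Kx; rewrite /a' Kx.
by apply: essential_agree => // x /VK Kx; rewrite /a' Kx.
Qed.

(** * Simplifying a pattern to a small tree *)

Lemma count_leaves_prune (L : eqType) (keep p : pred L) d q (A : tree L) :
  count (oapp p false) (leaves (prune keep d q A)) =
  count (fun x => [&& x.1 < d, keep x.2 & p x.2]) (level_leaves q A).
Proof.
elim: A q => [l|c A1 IH1 A2 IH2] q; have [ledq|ltqd] := leqP d q.
- by rewrite prune_hole //= ltnNge ledq.
- by rewrite prune_leaf //= ltqd; case: (keep l).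
- rewrite prune_hole //; apply/esym; rewrite (eq_in_count (a2 := pred0)) ?count_pred0 //.
  by move=> x /level_leaves_ge leqx /=; rewrite ltnNge (leq_trans ledq leqx).
- by rewrite prune_node //= !count_cat IH1 IH2.
Qed.

Lemma size_prune_no_hole (keep : pred literal) d q A :
  all isSome (leaves (prune keep d q A)) -> size (leaves (prune keep d q A)) = tsize A.
Proof.
elim: A q => [l|c A1 IH1 A2 IH2] q; have [ledq|ltqd] := leqP d q.
- by rewrite prune_hole.
- by rewrite prune_leaf.
- by rewrite prune_hole.
- by rewrite prune_node //= all_cat size_cat => /andP[/IH1-> /IH2->]; rewrite -size_cat.
Qed.

(** Trees have no constant leaves, so a simplified pattern is a tree or a constant; a constant has
    size 0, in agreement with [complexity]. *)
Definition rsize (r : bool + aotree) : nat := if r is inr A then tsize A else 0.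

Definition reval (r : bool + aotree) (a : assignment) : bool :=
  match r with inl b => b | inr A => eval A a end.

Definition rnode (c : connective) (r1 r2 : bool + aotree) : bool + aotree :=
  let neutral := if c is And then true else false in
  match r1, r2 with
  | inl b, r => if b == neutral then r else inl b
  | r, inl b => if b == neutral then r else inl b
  | inr A1, inr A2 => inr (Node c A1 A2)
  end.

Lemma rsize_rnode c r1 r2 : rsize (rnode c r1 r2) <= rsize r1 + rsize r2.
Proof.
case: r1 r2 => [b1|A1] [b2|A2] //=; try by case: ifP => _ /=; rewrite ?addn0 ?leqnn.
by rewrite /tsize /= size_cat.
Qed.

Lemma can_rnode c r1 r2 P1 P2 a a' :
  can (reval r1 a) P1 a' -> can (reval r2 a) P2 a' ->
  can (reval (rnode c r1 r2) a) (Node c P1 P2) a'.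
Proof.
have E : reval (rnode c r1 r2) a =
    (if c is And then reval r1 a && reval r2 a else reval r1 a || reval r2 a).
  case: r1 r2 => [b1|A1] [b2|A2] //=; case: c => //=; try case: b1 => //=; try case: b2 => //=;
  by rewrite ?andbT ?andbF ?orbT ?orbF.
rewrite E can_node; case: c {E}; case: (reval r1 a); case: (reval r2 a) => /= H1 H2;
  by rewrite ?H1 ?H2 ?orbT.
Qed.

Lemma can_all_holes P v a : ~~ has isSome (leaves P) -> can v P a.
Proof.
elim: P v => [[l|]|c P1 IH1 P2 IH2] v //=.
rewrite has_cat negb_or => /andP[/IH1 H1 /IH2 H2].
by rewrite -[match c with And => _ | Or => _ end]/(can v (Node c P1 P2) a) can_node H1 H2; case: ifP.
Qed.

(* A hole next to a subtree with leaves may be given the value that erases them. *)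
Lemma simplify_holes P : exists2 r,
  rsize r + (has (predC isSome) (leaves P) && has isSome (leaves P)) <= count isSome (leaves P)
  & forall a, can (reval r a) P a.
Proof.
elim: P => [[l|]|c P1 [r1 S1 C1] P2 [r2 S2 C2]].
- by exists (inr (Leaf l)) => //= a.
- by exists (inl true).
(* A child made only of holes may take the absorbing value, which erases its sibling. *)
pose killer := if c is And then false else true.
have kill a : (~~ has isSome (leaves P1)) || (~~ has isSome (leaves P2)) ->
    can (reval (inl killer) a) (Node c P1 P2) a.
  by rewrite can_node /killer; case: (c) => /= /orP[] /can_all_holes->; rewrite ?orbT.
have [h1|n1] := boolP (has isSome (leaves P1)); last first.
  exists (inl killer); last by move=> a; rewrite kill // n1.
  rewrite /= !has_cat count_cat add0n (negPf n1) /=.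
  by case: (boolP (has isSome (leaves P2))); rewrite ?andbF // has_count => h; lia.
have [h2|n2] := boolP (has isSome (leaves P2)); last first.
  exists (inl killer); last by move=> a; rewrite kill // n2 orbT.
  rewrite /= !has_cat count_cat add0n (negPf n2) h1 /=.
  by move: h1; rewrite has_count; lia.
exists (rnode c r1 r2); last by move=> a; apply: can_rnode.
rewrite /= !has_cat count_cat h1 /= andbT; move: S1 S2; rewrite h1 h2 !andbT.
have := rsize_rnode c r1 r2.
by case: (has _ (leaves P1)); case: (has _ (leaves P2)); lia.
Qed.

(** With the variables outside [V] set to false and the holes to constants, only leaves on [V] can
    survive. *)
Lemma simplify_inessential (V : pred nat) P : exists2 r,
  rsize r <= count (oapp (fun l : literal => V l.1) false) (leaves P)
  & forall a, can (reval r a) P (fun x => V x && a x).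
Proof.
elim: P => [[l|]|c P1 [r1 S1 C1] P2 [r2 S2 C2]].
- case: (boolP (V l.1)) => Vl.
    by exists (inr (Leaf l)); rewrite /= ?Vl // => a; rewrite /eval_literal Vl.
  by exists (inl l.2) => // a; rewrite /= /eval_literal (negPf Vl).
- by exists (inl true).
exists (rnode c r1 r2); last by move=> a; apply: can_rnode.
by rewrite /= count_cat; apply: leq_trans (rsize_rnode _ _ _) (leq_add S1 S2).
Qed.

(** Every occurrence of a variable of [V] counts, and for the other variables every occurrence after
    the first. *)
Definition restrictions (V : pred nat) (s : seq literal) : nat :=
  size s - size (undup [seq x <- map fst s | ~~ V x]).

Definition fresh_after (V : pred nat) (s f : seq literal) : bool :=
  [&& uniq (map fst f), all (fun l => ~~ V l.1) f & ~~ has (mem (map fst s)) (map fst f)].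

Lemma size_undup_cat (T : eqType) (u w : seq T) : size (undup (u ++ w)) <= size (undup u) + size w.
Proof.
rewrite -size_cat; apply: uniq_leq_size; first exact: undup_uniq.
by move=> x; rewrite mem_undup !mem_cat mem_undup.
Qed.

Lemma restrictions_le_cat V s f : restrictions V s <= restrictions V (s ++ f).
Proof.
rewrite /restrictions map_cat filter_cat size_cat.
set U := [seq x <- map fst s | _]; set W := [seq x <- map fst f | _].
have leW : size W <= size f by rewrite size_filter -(size_map fst) count_size.
have leUW := size_undup_cat U W.
have arith (a u n w m : nat) : w <= m -> n <= u + w -> a - u <= a + m - n by lia.
exact: arith leW leUW.
Qed.

(** If appending [f] adds no restriction, all the inequalities used to compare the counts are
    equalities. *)
Lemma fresh_afterP V s f : restrictions V (s ++ f) <= restrictions V s -> fresh_after V s f.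
Proof.
rewrite /restrictions map_cat filter_cat size_cat.
set U := [seq x <- map fst s | _]; set W := [seq x <- map fst f | _].
have leU : size (undup U) <= size s.
  by rewrite (leq_trans (size_undup _)) // size_filter -(size_map fst) count_size.
have leW : size W <= size f by rewrite size_filter -(size_map fst) count_size.
have leUW := size_undup_cat U W.
have arith (a u n w m : nat) : u <= a -> w <= m -> n <= u + w -> a + m - n <= a - u ->
  w = m /\ u + w <= n by lia.
case/(arith _ _ _ _ _ leU leW leUW) => eqW; rewrite -size_cat => geUW.
have sub : {subset undup (U ++ W) <= undup U ++ W}.
  by move=> x; rewrite mem_undup !mem_cat mem_undup.
have := leq_size_uniq (undup_uniq _) sub geUW.
have allf : all (fun x => ~~ V x) (map fst f).
  by rewrite all_count -size_filter -/W eqW size_map.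
have allf' : all (fun l : literal => ~~ V l.1) f by move: allf; rewrite all_map.
have WE : W = map fst f by apply/all_filterP.
rewrite cat_uniq WE => /and3P[_ /hasPn dis uf]; rewrite /fresh_after uf allf' /=.
apply/hasPn => x xf; have := dis x xf; rewrite mem_undup /U mem_filter.
by rewrite (allP allf x xf).
Qed.

Lemma perm_restrictions V s s' : perm_eq s s' -> restrictions V s = restrictions V s'.
Proof.
move=> ss'; rewrite /restrictions (perm_size ss'); congr (_ - _).
by apply/perm_size/perm_undup/perm_mem/perm_filter/perm_map.
Qed.

Definition visible (d : nat) (A : aotree) : seq literal :=
  [seq x.2 | x <- level_leaves 0 A & x.1 < d].

Definition window (d : nat) (A : aotree) : seq literal :=
  [seq x.2 | x <- level_leaves 0 A & d <= x.1 < d.+2].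

Lemma perm_filter_disjoint (T : eqType) (p p1 p2 : pred T) (s : seq T) :
  (forall x, p x = p1 x || p2 x) -> (forall x, ~~ (p1 x && p2 x)) ->
  perm_eq (seq.filter p s) (seq.filter p1 s ++ seq.filter p2 s).
Proof.
move=> pE dis; apply/seq.permP => a; rewrite count_cat !count_filter.
elim: s => //= x s ->; have := pE x; have := dis x.
by case: (p1 x); case: (p2 x) => //= _ ->; rewrite ?andbT ?andbF /=; lia.
Qed.

Lemma perm_visible d A : perm_eq (visible d.+2 A) (visible d A ++ window d A).
Proof.
rewrite /visible /window -map_cat; apply/perm_map/perm_filter_disjoint => x; lia.
Qed.

Lemma restrictions_visible_le V d d' A : d <= d' ->
  restrictions V (visible d A) <= restrictions V (visible d' A).
Proof.
move=> ledd'; pose f := [seq x.2 | x <- level_leaves 0 A & d <= x.1 < d'].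
have : perm_eq (visible d' A) (visible d A ++ f).
  rewrite /visible /f -map_cat; apply/perm_map/perm_filter_disjoint => x; lia.
by move/(perm_restrictions V) ->; apply: restrictions_le_cat.
Qed.

(** Pigeonhole: each window of two levels that is not fresh adds a restriction. Taking the first
    fresh one shows that the [w] windows above it added at least [w] restrictions. *)
Lemma find_fresh_window V A W : restrictions V (visible W.*2 A) < W ->
  exists w, [/\ w < W, fresh_after V (visible w.*2 A) (window w.*2 A)
    & w <= restrictions V (visible w.*2 A)].
Proof.
pose fr w := fresh_after V (visible w.*2 A) (window w.*2 A) => ltW.
have step w : ~~ fr w -> restrictions V (visible w.*2 A) < restrictions V (visible w.+1.*2 A).
  rewrite doubleS (perm_restrictions V (perm_visible _ _)) ltnNge; apply: contra.
  exact: fresh_afterP.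
have low m : (forall w, w < m -> ~~ fr w) -> m <= restrictions V (visible m.*2 A).
  elim: m => [//|m IHm] H; apply: leq_ltn_trans (step m (H m _)) => //.
  by apply: IHm => w ltwm; apply: H; apply: ltnW.
have ex : exists w, fr w.
  apply: contrapT => nex; move: ltW; rewrite ltnNge low // => w _.
  by apply/negP => frw; apply: nex; exists w.
have [w frw min] := ex_minnP ex; exists w.
have minN w' : w' < w -> ~~ fr w'.
  by move=> ltw; apply/negP => /min; rewrite leqNgt ltw.
split=> //; last exact: low.
rewrite ltnNge; apply/negP => leWw; move: ltW; rewrite ltnNge low // => w' ltw.
by apply: minN; apply: leq_trans leWw.
Qed.

(** When [K] keeps everything but the variables of the window, no leaf above the window is free, as
    freshness excludes these variables there. *)
Lemma free_leaves_window V A d : fresh_after V (visible d A) (window d A) ->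
  free_leaves (fun x => x \notin map fst (window d A)) d 0 A = window d A.
Proof.
case/and3P => _ _ /hasPn dis; rewrite /free_leaves {2}/window; congr map.
apply: eq_in_filter => x xA /=; case: ltnP => // ltxd.
apply/negbTE; rewrite negbK; apply/negP => /dis /negP; apply.
by rewrite inE; apply/map_f/map_f; rewrite mem_filter ltxd.
Qed.

Lemma window_robust (V : pred nat) A g d : finitary g -> computes A g ->
  (forall x, essential g x -> V x) -> fresh_after V (visible d A) (window d A) ->
  forall v a, can v (prune (fun l : literal => l.1 \notin map fst (window d A)) d 0 A) a -> v = g a.
Proof.
move=> fin Ag VK fr v a.
apply: (@fresh_robust (fun x => x \notin map fst (window d A))) => //.
- move=> x /VK Vx; apply/negP => /mapP[l lw xl].
  by case/and3P: fr => _ /allP/(_ l lw); rewrite -xl Vx.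
- by rewrite (free_leaves_window fr); case/and3P: fr.
- by rewrite (free_leaves_window fr); apply/allP => l lw; rewrite negbK map_f.
Qed.

(** The depth of the fresh window varies with [A]; passing to the larger pattern of depth [W.*2],
    which allows fewer values, gives a depth independent of [A]. *)
Lemma few_restrictions_robust (V : pred nat) A g W : finitary g -> computes A g ->
  (forall x, essential g x -> V x) -> restrictions V (visible W.*2 A) < W ->
  forall v a, can v (prune xpredT W.*2 0 A) a -> v = g a.
Proof.
move=> fin Ag VK /find_fresh_window[w [ltwW fr _]] v a cv.
apply: (window_robust fin Ag VK fr); apply: can_prune_mono cv.
by rewrite leq_double ltnW.
Qed.

(** Otherwise cut at a fresh window. With fewer than [L] leaves on [V] above it, keeping only those
    gives a result too small for [g]. With [L] of them there is no room for repetitions, so the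
    other leaves above are free as well and become holes; as [A] has more than [L] leaves there is
    some hole, and removing it erases one of the [L] leaves. *)
Lemma restrictions_gt (V : pred nat) A g W L : finitary g -> computes A g ->
  (forall x, essential g x -> V x) ->
  (forall B, computes B g -> L <= tsize B) -> (0 < L -> ~ is_constant g) ->
  L < tsize A -> L < W -> L < restrictions V (visible W.*2 A).
Proof.
move=> fin Ag VK minL ncst ltLA ltLW; rewrite ltnNge; apply/negP => leR.
have [w [ltwW fr lew]] := find_fresh_window (leq_ltn_trans leR ltLW).
have rob := window_robust fin Ag VK fr.
(* A cut at depth 0 leaves a single hole, which allows both values. *)
have w_gt0 : 0 < w.
  rewrite lt0n; apply/negP => /eqP w0; rewrite w0 in rob.
  have rob0 v : v = g (fun=> false) by apply: rob; rewrite prune_hole.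
  by have := rob0 true; rewrite -(rob0 false).
set d := w.*2 in fr lew rob.
have ltdW : d <= W.*2 by rewrite leq_double ltnW.
have leRd : restrictions V (visible d A) <= L := leq_trans (restrictions_visible_le V A ltdW) leR.
have L_gt0 : 0 < L by apply: leq_trans w_gt0 (leq_trans lew leRd).
have small r : rsize r < L -> ~ (forall a, reval r a = g a).
  case: r => [b|B] /= ltL H; first by apply: (ncst L_gt0); exists b.
  by have := minL B H; rewrite leqNgt ltL.
set nV := count (fun l : literal => V l.1) (visible d A).
have nVE : nV = count (fun x : nat * literal => (x.1 < d) && V x.2.1) (level_leaves 0 A).
  by rewrite /nV count_map count_filter; apply: eq_count => x /=; rewrite andbC.
have [ltnV|genV] := ltnP nV L.
  set P := prune _ _ _ _ in rob.
  have [r Sr Cr] := simplify_inessential V P.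
  apply: (small r).
    apply: leq_ltn_trans Sr (leq_ltn_trans _ ltnV).
    rewrite count_leaves_prune nVE; apply: sub_count => x /=.
    by case/and3P=> -> _ ->.
  move=> a; rewrite (rob _ _ (Cr a)); apply: essential_agree => // x /VK Vx.
  by rewrite Vx.
pose N := [seq l <- visible d A | ~~ V l.1].
have sizeN : size (visible d A) = nV + size N.
  by rewrite size_filter /nV count_predC.
have NE : [seq x <- map fst (visible d A) | ~~ V x] = map fst N by rewrite filter_map.
move: leRd; rewrite /restrictions NE sizeN => leRd.
have leN : size (undup (map fst N)) <= size N by rewrite (leq_trans (size_undup _)) ?size_map.
have nVL : nV = L by lia.
(* The leaves on [V] already account for all [L] restrictions, so no variable repeats in [N]. *)
have uN : uniq (map fst N).
  by rewrite -[uniq _]negbK -ltn_size_undup size_map -leqNgt; lia.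
have permF : perm_eq (free_leaves V d 0 A) (N ++ window d A).
  have -> : N = [seq x.2 | x <- level_leaves 0 A & (x.1 < d) && ~~ V x.2.1].
    rewrite /N /visible filter_map -filter_predI; congr map.
    by apply: eq_filter => x /=; rewrite andbC.
  rewrite /free_leaves /window -map_cat; apply/perm_map/perm_filter_disjoint => x.
    by case: (ltnP x.1 d) => H //=; rewrite ?orbF //; lia.
  by case: (ltnP x.1 d) => //= H; rewrite andbF.
have [uf nf /hasPn dis] := and3P fr.
have robV v a : can v (prune (fun l : literal => V l.1) d 0 A) a -> v = g a.
  apply: fresh_robust => //.
    rewrite (perm_uniq (perm_map fst permF)) map_cat cat_uniq uN uf andbT /=.
    apply/hasPn => x xf; apply: contra (dis x xf) => /mapP[l]; rewrite mem_filter => /andP[_ lv] ->.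
    by rewrite inE map_f.
  rewrite (perm_all _ permF) all_cat nf andbT.
  by apply/allP => l; rewrite mem_filter => /andP[].
set P := prune _ _ _ _ in robV.
have [r Sr Cr] := simplify_holes P.
have countP : count isSome (leaves P) = L.
  rewrite -nVL nVE; have := @count_leaves_prune literal (fun l => V l.1) xpredT d 0 A.
  move=> H; transitivity (count (oapp xpredT false) (leaves P)); first by apply: eq_count => -[].
  by rewrite /P H; apply: eq_count => x; rewrite /= andbT.
have hS : has isSome (leaves P) by rewrite has_count countP.
apply: (small r); last by move=> a; apply/robV/Cr.
move: Sr; rewrite countP hS andbT; case: (boolP (has _ _)) => [_|]; first by rewrite addn1.
rewrite has_predC negbK => allP.
have sP := size_prune_no_hole allP.
move: allP; rewrite all_count countP -/P sP => /eqP LA.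
by move: ltLA; rewrite LA ltnn.
Qed.

End Patterns.

(** * Repetitions in a tree computing a given function *)

Section Repetitions.

Local Open Scope classical_set_scope.

Fixpoint tree_map (L M : Type) (h : L -> M) (A : tree L) : tree M :=
  match A with
  | Leaf l => Leaf (h l)
  | Node c A1 A2 => Node c (tree_map h A1) (tree_map h A2)
  end.

Lemma leaves_tree_map (L M : Type) (h : L -> M) A : leaves (tree_map h A) = map h (leaves A).
Proof. by elim: A => [//|c A1 IH1 A2 IH2] /=; rewrite map_cat IH1 IH2. Qed.

Lemma skeleton_tree_map (L M : Type) (h : L -> M) A : skeleton (tree_map h A) = skeleton A.
Proof. by elim: A => [//|c A1 IH1 A2 IH2] /=; rewrite IH1 IH2. Qed.

Lemma tsize_tree_map (L M : Type) (h : L -> M) A : tsize (tree_map h A) = tsize A.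
Proof. by rewrite /tsize leaves_tree_map size_map. Qed.

Definition rename_assignment (sigma : nat -> nat) (eps : nat -> bool) (a : assignment) : assignment :=
  fun i => a (sigma i) (+) eps i.

Lemma eval_rename_lit sigma eps l a :
  eval_literal (rename_lit sigma eps l) a = eval_literal l (rename_assignment sigma eps a).
Proof. by rewrite /eval_literal /rename_assignment /= addbA addbAC. Qed.

Lemma eval_rename sigma eps A a :
  eval (tree_map (rename_lit sigma eps) A) a = eval A (rename_assignment sigma eps a).
Proof.
elim: A => [l|c A1 IH1 A2 IH2]; first exact: eval_rename_lit.
by case: c => /=; rewrite IH1 IH2.
Qed.

Lemma can_rename sigma eps v P a :
  can v (tree_map (omap (rename_lit sigma eps)) P) a = can v P (rename_assignment sigma eps a).
Proof.
elim: P v => [[l|]|c P1 IH1 P2 IH2] v //; first by rewrite /= eval_rename_lit.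
by rewrite [tree_map _ _]/= !can_node IH1 IH2.
Qed.

Lemma fun_equiv_refl f : fun_equiv f f.
Proof.
exists id, (fun=> false); split=> // a; congr f.
by apply/funext => i; rewrite addbF.
Qed.

Lemma fun_equiv_trans f g h : fun_equiv f g -> fun_equiv g h -> fun_equiv f h.
Proof.
move=> [s [e [sinj fg]]] [s' [e' [s'inj gh]]].
exists (s' \o s), (fun i => e' (s i) (+) e i); split; first exact: inj_comp.
move=> a; rewrite gh fg; congr f; apply/funext => i /=; by rewrite addbA.
Qed.

Lemma mem_leq_sumn (s : seq nat) x : x \in s -> x <= sumn s.
Proof.
elim: s => //= y s IHs; rewrite inE => /predU1P[->|/IHs]; first exact: leq_addr.
by move/leq_trans; apply; apply: leq_addl.
Qed.

(** Extends the injection to all indices by shifting the other variables by [M], beyond all the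
    images. *)
Lemma word_equiv_rename u v : word_equiv u v ->
  exists sigma eps, injective sigma /\ v = map (rename_lit sigma eps) u.
Proof.
case/word_equivP => s [e [sinj vE]]; pose M := (sumn (map fst v)).+1.
exists (fun x => if x \in map fst u then s x else x + M), e; split.
  have sM x : x \in map fst u -> s x < M.
    by move=> xu; rewrite ltnS mem_leq_sumn // vE map_fst_rename map_f.
  move=> x y; case: ifPn => xu; case: ifPn => yu.
  - exact: sinj.
  - by move=> e1; have := sM x xu; rewrite e1 ltnNge leq_addl.
  - by move=> e1; have := sM y yu; rewrite -e1 ltnNge leq_addl.
  - by move/addIn.
rewrite vE; apply/eq_in_map => l lu; rewrite /rename_lit.
by rewrite (map_f fst lu).
Qed.

Lemma tree_equiv_rename A B : tree_equiv A B ->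
  exists sigma eps, injective sigma /\ B = tree_map (rename_lit sigma eps) A.
Proof.
case/tree_equivE => sk /word_equiv_rename[s [e [sinj lE]]]; exists s, e; split=> //.
rewrite -[LHS](relabel_leaves l0) -[RHS](relabel_leaves l0).
by rewrite skeleton_tree_map leaves_tree_map sk lE.
Qed.

Definition good (f : boolfun) (A : aotree) : bool :=
  `[< exists2 g, fun_equiv f g & computes A g >].

Lemma good_tree_equiv f A B : tree_equiv A B -> good f A -> good f B.
Proof.
case/tree_equiv_rename => s [e [sinj ->]] /asboolP[g fg Ag]; apply/asboolP.
exists (eval (tree_map (rename_lit s e) A)) => //; apply: fun_equiv_trans fg _.
by exists s, e; split=> // a; rewrite eval_rename Ag.
Qed.

(** [t] is a left inverse of the renaming, with value 0 off its image. It need not be injective, but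
    it expresses [f] through [g], which is enough to carry trees for [g] back to [f] with the same
    size. *)
Lemma fun_equiv_inverse f g : fun_equiv f g ->
  exists t d, forall b, f b = g (rename_assignment t d b).
Proof.
case=> s [e [sinj fg]].
pose t m := xget 0 [set i | s i = m]; exists t, (e \o t) => b.
rewrite fg; congr f; apply/funext => i; rewrite /rename_assignment /=.
have -> : t (s i) = i; last by rewrite addbK.
by apply: sinj; apply: (@xgetPex _ 0 [set k | s k = s i]); exists i.
Qed.

Lemma fun_equiv_computes f g A : fun_equiv f g -> computes A g ->
  exists2 B, computes B f & tsize B = tsize A.
Proof.
case/fun_equiv_inverse => t [d fg] Ag; exists (tree_map (rename_lit t d) A).
  by move=> b; rewrite eval_rename Ag fg.
exact: tsize_tree_map.
Qed.

Lemma fun_equiv_constant f g : fun_equiv f g -> is_constant g -> is_constant f.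
Proof. by case/fun_equiv_inverse => t [d fg] [c gc]; exists c => a; rewrite fg gc. Qed.

Lemma fun_equiv_finitary f g : fun_equiv f g -> finitary f -> finitary g.
Proof.
case=> s [e [_ fg]] [m fm]; exists (\sum_(i < m) s i).+1 => a b ab.
rewrite !fg; apply: fm => i ltim; rewrite ab // ltnS.
by rewrite (bigD1 (Ordinal ltim)) //= leq_addr.
Qed.

Lemma fun_equiv_essential f g s e : injective s ->
  (forall a, g a = f (fun i => a (s i) (+) e i)) ->
  forall x, essential g x -> exists2 i, essential f i & x = s i.
Proof.
move=> sinj fg x [a]; rewrite !fg => neq.
have [[i xi]|nx] := pselect (exists i, x = s i); last first.
  case: neq; congr f; apply/funext => i; rewrite /set_var.
  by case: eqP => // eqx; case: nx; exists i.
exists i => //; exists (fun k => a (s k) (+) e k).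
have E b : (fun k => set_var a x b (s k) (+) e k) =
    set_var (fun k => a (s k) (+) e k) i (b (+) e i).
  apply/funext => k; rewrite /set_var xi (inj_eq sinj).
  by case: eqP => // ->.
by move: neq; rewrite !E /=; case: (e i) => //= H1 H2; apply: H1.
Qed.

Definition essential_seq (f : boolfun) : seq nat := enum_fset (fset_set [set i | essential f i]).

Lemma size_essential_seq f : size (essential_seq f) = num_essential f.
Proof. by []. Qed.

Lemma mem_essential_seq f i : finitary f -> i \in essential_seq f <-> essential f i.
Proof.
move=> [m fm]; have fin : finite_set [set i | essential f i].
  apply: (@sub_finite_set _ _ `I_m); last exact: finite_II.
  move=> x /= [a]; rewrite /= => neq; rewrite ltnNge; apply/negP => lemx; apply: neq.
  apply: fm => y ltym; rewrite /set_var; case: eqP => // eqyx.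
  by move: ltym; rewrite eqyx ltnNge lemx.
by rewrite /essential_seq in_fset_set // inE.
Qed.

Lemma eval_agree A a b : (forall x, x \in map fst (leaves A) -> a x = b x) -> eval A a = eval A b.
Proof.
elim: A => [l|c A1 IH1 A2 IH2] ab /=; first by rewrite /eval_literal ab //= inE.
by rewrite IH1 ?IH2 // => x xA; apply: ab; rewrite /= map_cat mem_cat xA ?orbT.
Qed.

Lemma num_essential_nvars f A : finitary f -> computes A f -> num_essential f <= nvars A.
Proof.
move=> fin Af; rewrite -size_essential_seq; apply: uniq_leq_size; first exact: fset_uniq.
move=> i /(mem_essential_seq i fin)[a neq]; rewrite mem_undup.
apply: contrapT => /negP ni; apply: neq; rewrite -!Af; apply: eval_agree => x xA.
by rewrite /set_var; case: eqP => // eqx; move: ni; rewrite -eqx xA.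
Qed.

(** Shannon expansion on the last relevant variable; at the bottom a constant is written with both
    literals of the variable 0. *)
Lemma computes_exists f : finitary f -> exists A, computes A f.
Proof.
case=> m; elim: m f => [|m IHm] f fm.
  pose x : aotree := Leaf (0, false); pose nx : aotree := Leaf (0, true).
  exists (if f (fun=> false) then Node Or x nx else Node And x nx) => a.
  rewrite (fm a (fun=> false)) //; case: (f _) => /=; rewrite /eval_literal /=;
  by case: (a 0).
have half v : exists A, computes A (fun a => f (set_var a m v)).
  apply: IHm => a b ab; apply: fm => i; rewrite ltnS leq_eqVlt /set_var.
  by case: eqP => //= _ /ab.
have [[A1 C1] [A0 C0]] := (half true, half false).
exists (Node Or (Node And (Leaf (m, false)) A1) (Node And (Leaf (m, true)) A0)) => a.
rewrite /= C1 C0 /eval_literal /= addbF addbT.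
have -> : f a = f (set_var a m (a m)).
  by congr f; apply/funext => i; rewrite /set_var; case: eqP => // ->.
by case: (a m) => /=; rewrite ?orbF.
Qed.

Lemma complexity_constant f : is_constant f -> complexity f = 0.
Proof. by rewrite /complexity => /asboolP->. Qed.

Lemma complexity_min f : finitary f -> ~ is_constant f -> min_tree_size f (complexity f).
Proof.
move=> fin ncst; rewrite /complexity (asboolF ncst).
apply: (@xgetPex _ 0 [set m | min_tree_size f m]).
have [A Af] := computes_exists fin.
have ex : exists m, `[< exists2 A, computes A f & tsize A = m >].
  by exists (tsize A); apply/asboolP; exists A.
have [m /asboolP Hm min] := ex_minnP ex; exists m; split=> // B Bf.
by apply: min; apply/asboolP; exists B.
Qed.

Lemma num_essential_constant f : finitary f -> is_constant f -> num_essential f = 0.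
Proof.
move=> fin [c fc]; apply/eqP; rewrite -size_essential_seq size_eq0.
case E: (essential_seq f) => [//|i s]; have : i \in essential_seq f by rewrite E inE eqxx.
by case/(mem_essential_seq i fin) => a; rewrite !fc.
Qed.

Lemma mult_complexity f : finitary f -> mult f + num_essential f = complexity f.
Proof.
move=> fin; rewrite /mult; have [cst|ncst] := pselect (is_constant f).
  by rewrite complexity_constant // num_essential_constant.
have [[A Af sA] _] := complexity_min fin ncst; rewrite subnK // -sA.
apply: leq_trans (num_essential_nvars fin Af) _.
by rewrite /nvars (leq_trans (size_undup _)) // size_map.
Qed.

(** Discarding [Vs] loses at most [size Vs] distinct variables. This turns the bound [L(f)] on
    restrictions into the bound [R(f)] on repetitions. *)
Lemma restrictions_rep (Vs : seq nat) w :
  restrictions (fun x => x \in Vs) w <= word_rep w + size Vs.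
Proof.
have : word_nvars w <= size (undup [seq x <- map fst w | x \notin Vs]) + size Vs.
  rewrite /word_nvars -size_cat; apply: uniq_leq_size; first exact: undup_uniq.
  move=> x; rewrite mem_undup mem_cat mem_undup mem_filter => ->.
  by case: (x \in Vs); rewrite // orbT.
rewrite /restrictions /word_rep.
have arith (a b c d : nat) : b <= c + d -> a - c <= a - b + d by lia.
exact: arith.
Qed.

(** Room for [L(f) + 2] windows: with [R(f) + 1] repetitions there are at most [L(f) + 1]
    restrictions, so some window is still fresh. *)
Definition pattern_depth (f : boolfun) : nat := (complexity f).+2.*2.

Definition solid (f : boolfun) (P : tree (option literal)) : bool :=
  `[< exists2 g, fun_equiv f g & forall v a, can v P a -> v = g a >].

Lemma good_essential f g : finitary f -> fun_equiv f g ->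
  exists Vs, [/\ size Vs = num_essential f, finitary g &
    forall x, essential g x -> x \in Vs].
Proof.
move=> fin fg; have fing := fun_equiv_finitary fg fin.
case: fg => s [e [sinj fg]]; exists (map s (essential_seq f)); split=> //.
  by rewrite size_map size_essential_seq.
move=> x /(fun_equiv_essential sinj fg)[i ei ->]; apply: map_f.
exact/mem_essential_seq.
Qed.

Lemma good_rep_ge f A : finitary f -> good f A -> complexity f < tsize A ->
  (mult f).+1 <= word_rep (visible (pattern_depth f) A).
Proof.
move=> fin /asboolP[g fg Ag] ltA; have [Vs [sVs fing gV]] := good_essential fin fg.
have := restrictions_rep Vs (visible (pattern_depth f) A).
have : complexity f < restrictions (fun x => x \in Vs) (visible (pattern_depth f) A).
  apply: (restrictions_gt fing Ag gV) => //.
    move=> B Bg; have [cst|ncst] := pselect (is_constant f).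
      by rewrite complexity_constant.
    have [_ min] := complexity_min fin ncst.
    by have [C /min leC <-] := fun_equiv_computes fg Bg.
  move=> L0 gc; move: L0; rewrite complexity_constant //; exact: fun_equiv_constant gc.
by rewrite -(mult_complexity fin) sVs; lia.
Qed.

Lemma good_solid f A : finitary f -> good f A ->
  word_rep (visible (pattern_depth f) A) <= (mult f).+1 ->
  solid f (prune xpredT (pattern_depth f) 0 A).
Proof.
move=> fin /asboolP[g fg Ag] leR; have [Vs [sVs fing gV]] := good_essential fin fg.
apply/asboolP; exists g => //; apply: (few_restrictions_robust fing Ag gV).
have := restrictions_rep Vs (visible (pattern_depth f) A).
by rewrite -/(pattern_depth f) sVs -(mult_complexity fin); lia.
Qed.

Lemma solid_good f d A : solid f (prune xpredT d 0 A) -> good f A.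
Proof.
case/asboolP => g fg H; apply/asboolP; exists g => // a.
by apply: H; apply: can_eval.
Qed.

Lemma solid_rename f sigma eps P : injective sigma ->
  solid f P -> solid f (tree_map (omap (rename_lit sigma eps)) P).
Proof.
move=> sinj /asboolP[g fg H]; apply/asboolP.
exists (fun a => g (rename_assignment sigma eps a)).
  by apply: fun_equiv_trans fg _; exists sigma, eps.
by move=> v a; rewrite can_rename => /H.
Qed.

End Repetitions.

(** * The weight of a pattern and its limit mean *)

Section Limits.

Local Open Scope classical_set_scope.
Local Open Scope ring_scope.

(** * Moments of the size of a pattern *)

Definition nshapes (R : realType) (n : nat) : R := (size (shapes n))%:R.

Definition shape_pattern (d q : nat) (t : tree unit) : tree (option unit) := prune xpredT d q t.

Definition pattern_moment (R : realType) (d q k n : nat) : R :=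
  \sum_(t <- shapes n) (tsize (shape_pattern d q t))%:R ^+ k.

Lemma nshapesE (R : realType) n : nshapes R n = \sum_(t <- shapes n) 1.
Proof. by rewrite big_const_seq count_predT iter_addr_0. Qed.

Lemma nshapes_seq (R : realType) : shape_seq (nshapes R).
Proof. exact: shape_seq_shapes. Qed.

Lemma pattern_moment_ge0 (R : realType) d q k n : 0 <= pattern_moment R d q k n.
Proof. by apply: sumr_ge0 => t _; rewrite exprn_ge0. Qed.

Lemma pattern_moment_hole (R : realType) d q k n : (d <= q)%N ->
  pattern_moment R d q k n = nshapes R n.
Proof.
move=> ledq; rewrite nshapesE; apply: eq_bigr => t _.
by rewrite /shape_pattern prune_hole // expr1n.
Qed.

Lemma sum_shapes_node (R : realType) (F : tree unit -> R) n q :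
  \sum_(t <- shapes n.+2) F t =
  \sum_(i < n.+3) \sum_(t1 <- shapes i) \sum_(t2 <- shapes (n.+2 - i))
    (F (Node (if odd q then And else Or) t1 t2) + F (Node (if odd q then Or else And) t1 t2)).
Proof.
rewrite sum_shapesS; apply: eq_bigr => i _; apply: eq_bigr => t1 _; apply: eq_bigr => t2 _.
by case: (odd q) => //; rewrite addrC.
Qed.

Lemma shape_pattern_node d q c t1 t2 : (q < d)%N ->
  shape_pattern d q (Node c t1 t2) = Node c (shape_pattern d q t1) (shape_pattern d (next_level c q) t2).
Proof. exact: prune_node. Qed.

Lemma pattern_momentS (R : realType) d q k n : (q < d)%N ->
  pattern_moment R d q k n.+2 =
  \sum_(i < k.+1) (convol (pattern_moment R d q (k - i)) (pattern_moment R d q i) n.+2 +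
    convol (pattern_moment R d q (k - i)) (pattern_moment R d q.+1 i) n.+2) *+ 'C(k, i).
Proof.
move=> ltqd; rewrite /pattern_moment (sum_shapes_node _ _ q).
pose x p t : R := (tsize (shape_pattern d p t))%:R.
transitivity (\sum_(i < n.+3) \sum_(t1 <- shapes i) \sum_(t2 <- shapes (n.+2 - i))
   \sum_(j < k.+1) (x q t1 ^+ (k - j) * x q t2 ^+ j + x q t1 ^+ (k - j) * x q.+1 t2 ^+ j) *+ 'C(k, j)).
  apply: eq_bigr => i _; apply: eq_bigr => t1 _; apply: eq_bigr => t2 _.
  have xnode c : (tsize (shape_pattern d q (Node c t1 t2)))%:R = x q t1 + x (next_level c q) t2.
    by rewrite shape_pattern_node // tsizeE natrD.
  under [RHS]eq_bigr do rewrite mulrnDl.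
  rewrite big_split /= -!exprDn !xnode /next_level /stays.
  by case: (odd q).
under eq_bigr => i _ do under eq_bigr => t1 _ do rewrite exchange_big /=.
under eq_bigr => i _ do rewrite exchange_big /=.
rewrite exchange_big /=; apply: eq_bigr => j _.
rewrite /convol -big_split -sumrMnl; apply: eq_bigr => i _ /=.
rewrite !mulr_suml -big_split -sumrMnl; apply: eq_bigr => t1 _ /=.
by rewrite !mulr_sumr -big_split -sumrMnl.
Qed.

(** Induction on the order [k], then on the number [d - q] of levels left. In the binomial expansion
    the same moment comes back only when one child at level [q] takes the whole exponent: the left
    child for both connectives, the right child for one. Hence the coefficient 3 of
    [subcritical_bound]. *)
Lemma pattern_moment_bound (R : realType) d k q :
  exists C, forall n, pattern_moment R d q k n <= C * nshapes R n.
Proof.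
have hs := nshapes_seq R; have s_ge0 := shape_seq_ge0 hs.
elim/ltn_ind: k q => k IHk q.
have [m] := ubnP (d - q)%N; elim: m q => [//|m IHm] q ltm.
have [ledq|ltqd] := leqP d q.
  by exists 1 => n; rewrite pattern_moment_hole // mul1r.
have [->|k_gt0] := posnP k.
  by exists 1 => n; rewrite mul1r nshapesE; apply: ler_sum => t _; rewrite expr0.
have [C' HC'] : exists C, forall n, pattern_moment R d q.+1 k n <= C * nshapes R n.
  by apply: IHm; lia.
pose s := nshapes R; pose F := pattern_moment R d q k; pose c n := convol s F n.
have m0 p : pattern_moment R d p 0 = s.
  by apply/funext => l; rewrite /s nshapesE; apply: eq_bigr => t _; rewrite expr0.
have conv_bound p p' i j A B : (forall n, pattern_moment R d p i n <= A * s n) ->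
    (forall n, pattern_moment R d p' j n <= B * s n) ->
    forall n, convol (pattern_moment R d p i) (pattern_moment R d p' j) n <= A * B * s n.
  move=> hA hB n; have hA' l : 0 <= pattern_moment R d p i l <= A * s l.
    by rewrite pattern_moment_ge0 hA.
  have hB' l : 0 <= pattern_moment R d p' j l <= B * s l by rewrite pattern_moment_ge0 hB.
  by have /andP[] := convol_le hs hA' hB' n.
have ex i : exists K, (i <= k)%N -> forall n,
  (convol (pattern_moment R d q (k - i)) (pattern_moment R d q i) n +
   convol (pattern_moment R d q (k - i)) (pattern_moment R d q.+1 i) n) *+ 'C(k, i) <=
  (if i == 0%N then 2 * c n else 0) + (if i == k then c n else 0) + K * s n.
  have [->|i_gt0] := posnP i.
    exists 0 => _ n; rewrite subn0 bin0 mulr1n !m0 -/F [convol F s n]convolC -/(c n).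
    by rewrite eq_sym (gtn_eqF k_gt0); lra.
  have [->|neik] := eqVneq i k.
    exists C' => _ n; rewrite subnn binn mulr1n !m0 -/F -/(c n).
    have m0' : forall n, pattern_moment R d q 0 n <= 1 * s n by move=> l; rewrite m0 mul1r.
    by have := conv_bound q q.+1 0%N k 1 C' m0' HC' n; rewrite m0 mul1r; lra.
  have [leik|] := leqP i k; last by exists 0; lia.
  have [A HA] := IHk (k - i)%N (ltac:(lia)) q.
  have [B HB] := IHk i (ltac:(lia)) q.
  have [B' HB'] := IHk i (ltac:(lia)) q.+1.
  exists ((A * B + A * B') *+ 'C(k, i)) => _ n; rewrite !add0r.
  rewrite mulrnAl lerMn2r mulrDl lerD ?orbT //; exact: conv_bound.
have [K HK] := choice ex.
pose H n := F n - 3 * convol s F n.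
have F0 n : 0 <= F n by apply: pattern_moment_ge0.
have SK_ge0 : 0 <= \sum_(i < k.+1) `|K i| by apply: sumr_ge0.
apply: (@subcritical_bound R s F H (\sum_(i < k.+1) `|K i| + 1) hs) => //.
- by rewrite /F /pattern_moment big_nil.
- case=> [|[|n]].
  + by rewrite /H /F /pattern_moment big_nil /convol big_ord_recl big_ord0 /s /nshapes /= !mul0r addr0 mulr0 subr0 mulr0.
  + have -> : H 1%N = 1.
      rewrite /H /convol !big_ord_recl big_ord0 /= /F /pattern_moment big_nil shapes1 big_seq1.
      by rewrite /shape_pattern prune_leaf // expr1n /s /nshapes /= mul0r mulr0 !addr0 mulr0 subr0.
    by rewrite /s /nshapes /= mulr1; lra.
  rewrite /H lerBlDr /F pattern_momentS //.
  apply: (@le_trans _ _ (\sum_(i < k.+1) ((if (i : nat) == 0%N then 2 * c n.+2 else 0) +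
     (if (i : nat) == k then c n.+2 else 0) + K i * s n.+2))).
    by apply: ler_sum => i _; apply: HK; rewrite -ltnS.
  rewrite !big_split /= [X in X + _ + _]big_ord_recl [X in _ + X + _]big_ord_recr /= eqxx.
  rewrite big1 ?addr0 // [X in _ + (X + _) + _]big1; last first.
    by move=> i _; rewrite ltn_eqF.
  rewrite add0r -mulr_suml -/F -/(c n.+2).
  have : (\sum_(i < k.+1) K i) * s n.+2 <= (\sum_(i < k.+1) `|K i|) * s n.+2.
    by rewrite ler_wpM2r ?s_ge0 // ler_sum // => i _; rewrite ler_norm.
  have := s_ge0 n.+2; rewrite -/s mulrDl mul1r; lra.
- by move=> n; rewrite /H subrK.
Qed.

(** * Limiting frequencies of patterns *)

Definition pattern_count (R : realType) (d q : nat) (p : tree (option unit)) (n : nat) : R :=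
  \sum_(t <- shapes n) (shape_pattern d q t == p)%:R.

Lemma pattern_count_bounds (R : realType) d q p n :
  0 <= pattern_count R d q p n <= 1 * nshapes R n.
Proof.
rewrite mul1r nshapesE; apply/andP; split; first by apply: sumr_ge0.
by apply: ler_sum => t _; case: eqP.
Qed.

Lemma eventually_zero_cvg (R : realType) (u : nat -> R) : (forall n, u n.+2 = 0) -> cvgn u.
Proof.
move=> u0; apply/cvg_ex; exists 0; apply: cvg_near_cst.
by exists 2%N => // -[|[|n]].
Qed.

(** Above depth [d], the count for a node is the convolution of the counts for its two children. *)
Lemma pattern_count_cvg (R : realType) d q p :
  cvgn (fun n => pattern_count R d q p n / nshapes R n).
Proof.
have hs := nshapes_seq R.
elim: p q => [x|c p1 IH1 p2 IH2] q; have [ledq|ltqd] := leqP d q.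
- have E n : pattern_count R d q (Leaf x) n = (Leaf None == Leaf x)%:R * nshapes R n.
    rewrite nshapesE mulr_sumr; apply: eq_bigr => t _.
    by rewrite mulr1 /shape_pattern prune_hole.
  apply/cvg_ex; exists (Leaf None == Leaf x)%:R; apply: cvg_near_cst.
  exists 1%N => // -[//|n] _; rewrite E mulfK // gt_eqF //.
  by case: (shape_seq_ge hs n).
- apply: eventually_zero_cvg => n; rewrite /pattern_count (sum_shapes_node _ _ q).
  rewrite big1 ?mul0r // => i _; rewrite big1 // => t1 _; rewrite big1 // => t2 _.
  by rewrite !shape_pattern_node //; case: eqP => // _; case: eqP => // _; rewrite addr0.
- have E n : pattern_count R d q (Node c p1 p2) n = 0.
    by apply: big1 => t _; rewrite /shape_pattern prune_hole //; case: eqP.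
  by apply: eventually_zero_cvg => n; rewrite E mul0r.
have E n : pattern_count R d q (Node c p1 p2) n.+2 =
    convol (pattern_count R d q p1) (pattern_count R d (next_level c q) p2) n.+2.
  rewrite /pattern_count sum_shapesS; apply: eq_bigr => i _.
  rewrite mulr_suml; apply: eq_bigr => t1 _; rewrite mulr_sumr; apply: eq_bigr => t2 _.
  rewrite !shape_pattern_node //.
  have nodeE c' : (Node c' (shape_pattern d q t1) (shape_pattern d (next_level c' q) t2) == Node c p1 p2)%:R =
     `[< c' = c >]%:R * ((shape_pattern d q t1 == p1)%:R * (shape_pattern d (next_level c q) t2 == p2)%:R) :> R.
    case: asboolP => [->|nc]; last by rewrite mul0r; case: eqP => // -[].
    rewrite mul1r -natrM mulnb; congr (nat_of_bool _)%:R.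
    by apply/eqP/andP => [[-> ->]|[/eqP-> /eqP->]].
  rewrite !nodeE -mulrDl; case: (c); do ![case: asboolP => //= _]; by rewrite ?addr0 ?add0r mul1r.
have := convol_ratio_cvg hs (@pattern_count_bounds R d q p1)
  (@pattern_count_bounds R d (next_level c q) p2) (IH1 q) (IH2 (next_level c q)).
case/cvg_ex => l Hl; apply/cvg_ex; exists l; apply: cvg_trans Hl; apply: near_eq_cvg.
by exists 2%N => // -[|[|n]] // _; rewrite E.
Qed.

Definition patterns_upto (M : nat) : seq (tree (option unit)) :=
  undup (flatten [seq [seq relabel None t w | t <- shapes n, w <- words [:: None; Some tt] n]
    | n <- iota 0 M.+1]).

Lemma mem_patterns_upto M p : (tsize p <= M)%N -> p \in patterns_upto M.
Proof.
move=> leM; rewrite mem_undup; apply/flattenP.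
exists [seq relabel None t w | t <- shapes (tsize p), w <- words [:: None; Some tt] (tsize p)].
  by apply/mapP; exists (tsize p) => //; rewrite mem_iota.
apply/allpairsP; exists (skeleton p, leaves p) => /=; split; last by rewrite relabel_leaves.
  by rewrite mem_shapes tsize_skeleton.
by rewrite mem_words eqxx /=; apply/allP => -[[]|] _.
Qed.

Lemma cvg_sum_seq (R : realType) (T : Type) (u : T -> nat -> R) (s : seq T) :
  (forall x, cvgn (u x)) -> cvgn (fun n => \sum_(x <- s) u x n).
Proof.
move=> ucvg; elim: s => [|x s IHs].
  by under eq_fun do rewrite big_nil; apply: is_cvg_cst.
under eq_fun do rewrite big_cons; exact: is_cvgD.
Qed.

(** Patterns with more than [M] leaves contribute little, by Markov's inequality with the moment of
    order [k.+1]; the finitely many others have limiting frequencies. *)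
Lemma pattern_mean_cvg (R : realType) d (phi : tree (option unit) -> R) K k :
  (forall p, 0 <= phi p <= K * (tsize p)%:R ^+ k) ->
  cvgn (fun n => (\sum_(t <- shapes n) phi (shape_pattern d 0 t)) / nshapes R n).
Proof.
move=> hphi; have hs := nshapes_seq R; have s_ge0 := shape_seq_ge0 hs.
have K_ge0 : 0 <= K.
  by have /andP[] := hphi (Leaf None); rewrite expr1n mulr1; apply: le_trans.
have [C HC] := pattern_moment_bound R d k.+1 0.
have C_ge0 : 0 <= C.
  have := HC 1%N; rewrite /nshapes /= mulr1; apply: le_trans; exact: pattern_moment_ge0.
apply: approx_cvg => e e_gt0; pose M := (Num.bound (K * C / e)).+1.
have HM : K * C <= e * M%:R.
  rewrite [leRHS]mulrC -ler_pdivrMr //; apply: (@le_trans _ _ (Num.bound (K * C / e))%:R).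
    by apply/ltW/archi_boundP; rewrite divr_ge0 ?mulr_ge0 // ltW.
  by rewrite ler_nat.
pose small (p : tree (option unit)) : R := if (tsize p <= M)%N then phi p else 0.
exists (fun n => \sum_(p <- patterns_upto M) small p * (pattern_count R d 0 p n / nshapes R n)).
  by apply: cvg_sum_seq => p; apply: is_cvgM; [exact: is_cvg_cst|exact: pattern_count_cvg].
exists 1%N => -[//|n] _; set N := n.+1; have sN_gt0 : 0 < nshapes R N by case: (shape_seq_ge hs n).
have -> : \sum_(p <- patterns_upto M) small p * (pattern_count R d 0 p N / nshapes R N) =
   (\sum_(t <- shapes N) small (shape_pattern d 0 t)) / nshapes R N.
  rewrite mulr_suml; under eq_bigr do rewrite mulrA mulr_sumr mulr_suml.
  rewrite exchange_big /=; apply: eq_bigr => t _; rewrite -mulr_suml; congr (_ / _).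
  rewrite /small; case: (leqP (tsize (shape_pattern d 0 t)) M) => [leM|ltM].
    rewrite (bigD1_seq (shape_pattern d 0 t)) ?mem_patterns_upto ?undup_uniq //=.
    rewrite eqxx leM mulr1 big1 ?addr0 // => p /negPf; rewrite eq_sym => ->.
    by rewrite mulr0.
  rewrite big1 // => p _; case: eqP => [<-|]; last by rewrite mulr0.
  by rewrite leqNgt ltM mul0r.
rewrite -mulrBl -sumrB normrM [X in _ * X]gtr0_norm ?invr_gt0 // ler_pdivrMr //.
have phiS t : 0 <= phi (shape_pattern d 0 t) - small (shape_pattern d 0 t) <=
    K * (tsize (shape_pattern d 0 t))%:R ^+ k.+1 / M%:R.
  set p := shape_pattern d 0 t; have /andP[p0 pK] := hphi p; rewrite /small.
  case: leqP => [leM|ltM]; first by rewrite subrr lexx divr_ge0 ?mulr_ge0 ?exprn_ge0.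
  by rewrite subr0 p0 /= ler_pdivlMr ?ltr0n // exprSr mulrA ler_pM // ler_nat ltnW.
rewrite ger0_norm; last by apply: sumr_ge0 => t _; case/andP: (phiS t).
apply: (@le_trans _ _ (K * pattern_moment R d 0 k.+1 N / M%:R)).
  rewrite /pattern_moment mulr_sumr mulr_suml; apply: ler_sum => t _.
  by case/andP: (phiS t).
rewrite ler_pdivrMr ?ltr0n //; apply: (@le_trans _ _ (K * (C * nshapes R N))).
  by rewrite ler_wpM2l.
by rewrite mulrA [leRHS]mulrAC ler_wpM2r // ltW.
Qed.

(** * Words of literals on a pattern *)

Definition visible_bits (d q : nat) (t : tree unit) : bitseq :=
  [seq (x.1 < d)%N | x <- level_leaves q t].

Lemma size_visible_bits d q t : size (visible_bits d q t) = tsize t.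
Proof. by rewrite size_map -(size_map snd) snd_level_leaves. Qed.

Definition nslots (P : tree (option unit)) : nat := count isSome (leaves P).

Lemma count_visible_bits d q t : count id (visible_bits d q t) = nslots (shape_pattern d q t).
Proof.
have := @count_leaves_prune unit xpredT xpredT d q t.
rewrite /nslots /shape_pattern => H.
transitivity (count (oapp xpredT false) (leaves (prune xpredT d q t))).
  by rewrite H count_map; apply: eq_count => x; rewrite /= andbT.
by apply: eq_count => -[].
Qed.

Fixpoint refill (P : tree (option unit)) (v : seq literal) : tree (option literal) :=
  match P with
  | Leaf None => Leaf None
  | Leaf (Some _) => Leaf (Some (head l0 v))
  | Node c P1 P2 => Node c (refill P1 (take (nslots P1) v)) (refill P2 (drop (nslots P1) v))
  end.

(** The pattern of a labelled tree depends only on its shape pattern and on the visible letters,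
    which separates the counting of words from that of shapes. *)
Lemma prune_relabel d q t w : size w = tsize t ->
  prune xpredT d q (relabel l0 t w) = refill (shape_pattern d q t) (mask (visible_bits d q t) w).
Proof.
rewrite /shape_pattern; elim: t q w => [u|c t1 IH1 t2 IH2] q w sw; have [ledq|ltqd] := leqP d q.
- by rewrite !prune_hole.
- rewrite [relabel _ _ _]/= !prune_leaf // /visible_bits /= ltqd.
  by case: w sw => [|x [|]].
- by rewrite !prune_hole.
rewrite [relabel _ _ _]/= !prune_node //=.
have s1 : size (take (tsize t1) w) = tsize t1 by rewrite size_takel // sw tsizeE leq_addr.
have s2 : size (drop (tsize t1) w) = tsize t2 by rewrite size_drop sw tsizeE addKn.
have -> : visible_bits d q (Node c t1 t2) = visible_bits d q t1 ++ visible_bits d (next_level c q) t2.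
  by rewrite /visible_bits /= map_cat.
rewrite -[X in mask _ X](cat_take_drop (tsize t1)) mask_cat ?size_visible_bits //.
have s3 : size (mask (visible_bits d q t1) (take (tsize t1) w)) = nslots (prune xpredT d q t1).
  by rewrite size_mask ?size_visible_bits // count_visible_bits.
by rewrite take_size_cat // drop_size_cat // IH1 // IH2.
Qed.

Lemma level_leaves_relabel q t w : size w = tsize t ->
  level_leaves q (relabel l0 t w) = zip (map fst (level_leaves q t)) w.
Proof.
elim: t q w => [u|c t1 IH1 t2 IH2] q w sw; first by case: w sw => [|x [|]].
have s1 : size (take (tsize t1) w) = tsize t1 by rewrite size_takel // sw tsizeE leq_addr.
have s2 : size (drop (tsize t1) w) = tsize t2 by rewrite size_drop sw tsizeE addKn.
rewrite /= IH1 // IH2 // map_cat -[in RHS](cat_take_drop (tsize t1) w) zip_cat //.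
by rewrite s1 size_map -(size_map snd) snd_level_leaves.
Qed.

Lemma visible_relabel d t w : size w = tsize t ->
  visible d (relabel l0 t w) = mask (visible_bits d 0 t) w.
Proof.
move=> sw; rewrite /visible level_leaves_relabel // /visible_bits (map_comp (fun l => l < d)%N fst).
move: (map fst _) => ls; elim: ls w {sw} => [|l ls IHls] [|x w] //=.
by case: ifP => _ /=; rewrite IHls.
Qed.

Lemma refill_map (h : literal -> literal) P v : size v = nslots P ->
  refill P (map h v) = tree_map (omap h) (refill P v).
Proof.
rewrite /nslots; elim: P v => [[u|]|c P1 IH1 P2 IH2] v //=; first by case: v.
rewrite count_cat => sv; rewrite -map_take -map_drop IH1 ?IH2 //.
  by rewrite size_drop sv /nslots addKn.
by rewrite size_takel // sv leq_addr.
Qed.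

Definition solid_word (f : boolfun) (P : tree (option unit)) (v : seq literal) : bool :=
  (word_rep v == (mult f).+1) && solid f (refill P v).

Lemma solid_word_equiv f P u v : size u = nslots P -> word_equiv u v ->
  solid_word f P u -> solid_word f P v.
Proof.
move=> su uv /andP[ru solu]; apply/andP; split.
  by case: (uv) => suv _ _; rewrite /word_rep -suv -(word_equiv_nvars uv).
have [s [e [sinj ->]]] := word_equiv_rename uv.
by rewrite refill_map //; apply: solid_rename.
Qed.

Definition word_class (u : seq literal) : set (seq literal) := [set v | word_equiv u v].

Lemma word_class_eq u v : word_class u = word_class v <-> word_equiv u v.
Proof.
split=> [/seteqP[_ sub]|uv]; first by apply: sub; apply: word_equiv_refl.
apply/seteqP; split=> w /= H; last exact: word_equiv_trans H.
by apply: word_equiv_trans H; apply: word_equiv_sym.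
Qed.

(** Words over [nslots P] variables represent all classes, since a word of this length has no more
    variables. *)
Definition solid_classes (f : boolfun) (P : tree (option unit)) : seq (set (seq literal)) :=
  undup [seq word_class v | v <- words (lits (nslots P)) (nslots P) & solid_word f P v].

Lemma count_solid_word f P j :
  count (solid_word f P) (words (lits j) (nslots P)) =
  (size (solid_classes f P) *
    (2 ^ (nslots P - (mult f).+1) * j ^_ (nslots P - (mult f).+1)))%N.
Proof.
set m := nslots P; set C := solid_classes f P.
have CP K : K \in C -> exists v, [/\ size v = m, solid_word f P v & word_class v = K].
  rewrite mem_undup => /mapP[v]; rewrite mem_filter mem_words => /andP[sol /andP[/eqP sv _]] ->.
  by exists v.
rewrite (count_by_class (cl := word_class) (C := C)) ?undup_uniq //; last first.
  move=> v; rewrite mem_words => /andP[/eqP sv _]; apply/idP/idP => [sol|/CP[u [su sol /word_class_eq uv]]].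
    have : (0 < count (fun u => `[< word_equiv v u >]) (words (lits m) (size v)))%N.
      rewrite count_word_equiv muln_gt0 expn_gt0 ffact_gt0 /=.
      by rewrite -sv word_nvars_size.
    rewrite -has_count sv => /hasP[u um /asboolP vu].
    rewrite (_ : word_class v = word_class u); last by apply/word_class_eq.
    rewrite mem_undup; apply: map_f; rewrite mem_filter um andbT.
    exact: solid_word_equiv vu sol.
  exact: solid_word_equiv uv sol.
transitivity (\sum_(K <- C) (2 ^ (m - (mult f).+1) * j ^_ (m - (mult f).+1)))%N; last first.
  by rewrite big_const_seq count_predT iter_addn_0 mulnC.
rewrite big_seq [RHS]big_seq; apply: eq_bigr => K /CP[v [sv /andP[/eqP rv _] <-]].
have <- : word_nvars v = (m - (mult f).+1)%N.
  by rewrite -rv /word_rep sv subKn // -sv word_nvars_size.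
rewrite -count_word_equiv sv; apply: eq_count => u.
apply/eqP/asboolP => [/word_class_eq|/word_equiv_sym uv]; first exact: word_equiv_sym.
by apply/word_class_eq.
Qed.

(** Limit, as [j] grows, of [j ^ r] times the proportion of solid words among all words on the
    slots, where [r = (mult f).+1]: a class contains [2 ^ (m - r) * j ^_ (m - r)] of the
    [(2 * j) ^ m] words. *)
Definition pattern_weight (R : realType) (f : boolfun) (P : tree (option unit)) : R :=
  (size (solid_classes f P))%:R / 2 ^+ (mult f).+1.

Lemma ffact_ratio (R : realType) j p : (0 < j)%N ->
  1 - (p ^ 2)%:R / j%:R <= ((j ^_ p)%:R / j%:R ^+ p : R) <= 1.
Proof.
move=> j_gt0; have J0 : 0 < j%:R :> R by rewrite ltr0n.
elim: p => [|p /andP[IH1 IH2]]; first by rewrite ffactn0 expr0 divr1 mul0r subr0 lexx.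
have step : (j ^_ p.+1)%:R / j%:R ^+ p.+1 = (j ^_ p)%:R / j%:R ^+ p * ((j - p)%N%:R / j%:R) :> R.
  by rewrite ffactnSr natrM exprSr invfM mulrACA.
have q0 : 0 <= (j - p)%N%:R / j%:R :> R by rewrite divr_ge0.
have q1 : (j - p)%N%:R / j%:R <= 1 :> R by rewrite ler_pdivrMr // mul1r ler_nat leq_subr.
have r0 : 0 <= (j ^_ p)%:R / j%:R ^+ p :> R by rewrite divr_ge0 ?exprn_ge0.
apply/andP; split; last by rewrite step mulr_ile1.
have [lepj|ltjp] := leqP p j; last first.
  apply: (@le_trans _ _ 0); last by rewrite divr_ge0 ?exprn_ge0.
  rewrite subr_le0 ler_pdivlMr // mul1r ler_nat; nia.
rewrite step natrB // mulrBl divff ?gt_eqF //.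
have qE : (p.+1 ^ 2)%:R / j%:R = (p ^ 2)%:R / j%:R + 2 * (p%:R / j%:R) + j%:R^-1 :> R.
  rewrite -addn1 sqrnD muln1 !natrD natrM; field; exact: lt0r_neq0.
have pj : 0 <= p%:R / j%:R :> R by rewrite divr_ge0.
have pj1 : p%:R / j%:R <= 1 :> R by rewrite ler_pdivrMr // mul1r ler_nat.
have jv : 0 < j%:R^-1 :> R by rewrite invr_gt0.
have p2 : 0 <= (p ^ 2)%:R / j%:R :> R by rewrite divr_ge0.
rewrite qE; move: IH1 IH2 r0 pj pj1 jv p2.
set a := (j ^_ p)%:R / _; set b := p%:R / _; set c := (p ^ 2)%:R / _; set d := _^-1.
move=> IH1 IH2 r0 pj pj1 jv p2.
have : 0 <= (1 - a) * b by rewrite mulr_ge0 // subr_ge0.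
by rewrite mulrBr mulr1 mulrBl mul1r; lra.
Qed.

Lemma no_solid_class f P : (nslots P < (mult f).+1)%N -> size (solid_classes f P) = 0%N.
Proof.
move=> ltm; rewrite /solid_classes (eq_in_filter (a2 := pred0)) ?filter_pred0 //.
move=> v; rewrite mem_words => /andP[/eqP sv _]; apply/negbTE; rewrite /solid_word negb_and.
by rewrite neq_ltn /word_rep sv (leq_ltn_trans (leq_subr _ _) ltm).
Qed.

Lemma solid_word_ratio (R : realType) f P j : (0 < j)%N -> exists2 rho : R,
  1 - (nslots P ^ 2)%:R / j%:R <= rho <= 1 &
  (count (solid_word f P) (words (lits j) (nslots P)))%:R =
    (2 * j)%:R ^+ nslots P / j%:R ^+ (mult f).+1 * (pattern_weight R f P * rho).
Proof.
move=> j_gt0; have J0 : 0 < j%:R :> R by rewrite ltr0n.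
rewrite count_solid_word /pattern_weight; set m := nslots P; set r := (mult f).+1.
have [lerm|ltmr] := leqP r m; last first.
  exists 1; first by rewrite lexx andbT gerBl divr_ge0.
  by rewrite no_solid_class // mul0n mul0r mul0r mulr0.
exists ((j ^_ (m - r))%:R / j%:R ^+ (m - r)).
  have /andP[H1 ->] := ffact_ratio R (m - r) j_gt0; rewrite andbT.
  apply: le_trans H1; rewrite lerD2l lerN2 ler_wpM2r ?invr_ge0 // ler_nat leq_exp2r //.
  exact: leq_subr.
rewrite !natrM natrX -[in (2 * _) ^+ m](subnK lerm) exprD !exprMn.
field; rewrite !expf_neq0 ?gt_eqF //.
Qed.

(** Solid words have [(mult f).+1] repetitions, so [count_word_rep_ge] bounds their number. At
    [j = 2 m^2 + 1] the factor [rho] is at least 1/2, and this single [j] controls the weight. *)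
Lemma pattern_weight_bounds (R : realType) f P :
  0 <= pattern_weight R f P <= 2 * (tsize P)%:R ^+ (2 * (mult f).+1).
Proof.
have w0 : 0 <= pattern_weight R f P by rewrite divr_ge0 ?exprn_ge0.
rewrite w0 /=; set m := nslots P; set r := (mult f).+1; pose j := (2 * m ^ 2).+1.
have J0 : 0 < j%:R :> R by rewrite ltr0n.
have [rho /andP[rho1 _] cE] := @solid_word_ratio R f P j isT.
have := @count_word_rep_ge R j m r isT; set cnt := count _ _ => Hc.
have : (count (solid_word f P) (words (lits j) m))%:R <= cnt%:R :> R.
  by rewrite ler_nat; apply: sub_count => v /andP[/eqP-> _].
rewrite cE -/m -/r => /le_trans/(_ Hc).
rewrite mulrAC -mulrA -[X in _ <= X]mulrA -mulrA ler_pM2l ?exprn_gt0 ?ltr0n ?muln_gt0 //.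
rewrite mulrA ler_pM2r ?invr_gt0 ?exprn_gt0 // => Hw.
have half : 2^-1 <= rho.
  apply: le_trans rho1; rewrite -/m lerBrDr -lerBrDl.
  rewrite ler_pdivrMr //; have : (2 * m ^ 2)%:R <= j%:R :> R by rewrite ler_nat leqnSn.
  by rewrite natrM; lra.
have le_mx : m%:R ^+ (2 * r) <= (tsize P)%:R ^+ (2 * r) :> R.
  by rewrite lerXn2r ?nnegrE // ler_nat; apply: count_size.
have : pattern_weight R f P * 2^-1 <= pattern_weight R f P * rho by rewrite ler_wpM2l.
by lra.
Qed.

Lemma sub_count_in (T : eqType) (a b : pred T) (s : seq T) :
  {in s, forall x, a x -> b x} -> (count a s <= count b s)%N.
Proof.
move=> ab; rewrite (@eq_in_count _ a (predI a b)); first by apply: sub_count => x /andP[].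
by move=> x xs /=; case ax: (a x) => //=; rewrite ab.
Qed.

(** Solid words give good trees, and a good tree whose word is not solid has more than [r] visible
    repetitions, which costs a further [1 / j]. In the constant 3, replacing [rho] by 1 accounts for
    2 and the extra repetitions for 1. *)
Lemma shape_good_count (R : realType) f t n j : finitary f -> (complexity f < n)%N ->
  tsize t = n -> (0 < j)%N ->
  `|(count (fun w => good f (relabel l0 t w)) (words (lits j) n))%:R -
    (2 * j)%:R ^+ n / j%:R ^+ (mult f).+1 * pattern_weight R f (shape_pattern (pattern_depth f) 0 t)|
  <= (2 * j)%:R ^+ n / j%:R ^+ (mult f).+1 *
     (3 * (tsize (shape_pattern (pattern_depth f) 0 t))%:R ^+ (2 * (mult f).+2) / j%:R).
Proof.
move=> fin ltn st j_gt0; have J0 : 0 < j%:R :> R by rewrite ltr0n.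
set d := pattern_depth f; set P := shape_pattern d 0 t; set r := (mult f).+1.
set bs := visible_bits d 0 t; set m := nslots P.
have sbs : size bs = n by rewrite size_visible_bits.
have cbs : count id bs = m by exact: count_visible_bits.
have nbs : (count negb bs + m = n)%N by rewrite -cbs addnC -sbs -(count_predC id bs).
pose V := count (fun w => good f (relabel l0 t w)) (words (lits j) n).
pose V1 := count (fun w => solid_word f P (mask bs w)) (words (lits j) n).
pose V2 := count (fun w => r < word_rep (mask bs w))%N (words (lits j) n).
have word_cases w : w \in words (lits j) n ->
   (solid_word f P (mask bs w) -> good f (relabel l0 t w)) /\
   (good f (relabel l0 t w) -> solid_word f P (mask bs w) || (r < word_rep (mask bs w))%N).
  rewrite mem_words => /andP[/eqP sw _].
  have swt : size w = tsize t by rewrite sw st.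
  have visE : visible d (relabel l0 t w) = mask bs w by exact: visible_relabel.
  have prE : prune xpredT d 0 (relabel l0 t w) = refill P (mask bs w) by exact: prune_relabel.
  split=> [/andP[_ sol]|gw]; first by apply: (@solid_good f d); rewrite prE.
  have ts : tsize (relabel l0 t w) = n by rewrite -tsize_skeleton skeleton_relabel.
  have := @good_rep_ge f _ fin gw; rewrite ts -/d visE => /(_ ltn); rewrite -/r leq_eqVlt.
  case/predU1P => [er|->]; last by rewrite orbT.
  rewrite /solid_word -er eqxx /= -prE good_solid //.
  by rewrite -/d visE -er.
have V1V : (V1 <= V)%N by apply: sub_count_in => w /word_cases[].
have VV12 : (V <= V1 + V2)%N.
  rewrite /V1 /V2 -count_predUI (leq_trans _ (leq_addr _ _)) //.
  by apply: sub_count_in => w /word_cases[].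
set X : R := (2 * j)%:R; set J : R := j%:R; set x : R := (tsize P)%:R.
have X0 : 0 <= X by exact: ler0n.
have mask_count (Q : pred (seq literal)) : (count (fun w => Q (mask bs w)) (words (lits j) n))%:R =
    X ^+ count negb bs * (count Q (words (lits j) m))%:R :> R.
  by have := count_mask_words (lits j) bs Q; rewrite sbs cbs size_lits => ->; rewrite natrM natrX.
have XE : X ^+ count negb bs * X ^+ m = X ^+ n by rewrite -exprD nbs.
have [rho /andP[rho1 rho2] cE] := @solid_word_ratio R f P j j_gt0.
set pw := pattern_weight R f P; set Y := X ^+ n / J ^+ r.
have Y0 : 0 <= Y by rewrite divr_ge0 ?exprn_ge0.
have V1E : V1%:R = Y * (pw * rho).
  by rewrite /V1 mask_count cE -/m -/X -/J -/r -/pw /Y -XE; ring.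
have le_mx : m%:R <= x by rewrite ler_nat; apply: count_size.
have V2E : V2%:R <= Y * (x ^+ (2 * r.+1) / J).
  rewrite /V2 (mask_count (fun v => r < word_rep v)%N).
  apply: (@le_trans _ _ (X ^+ count negb bs * (X ^+ m * m%:R ^+ (2 * r.+1) / J ^+ r.+1))).
    by rewrite ler_wpM2l ?exprn_ge0 // count_word_rep_ge.
  have JS : J ^+ r.+1 = J ^+ r * J by rewrite exprSr.
  have -> : X ^+ count negb bs * (X ^+ m * m%:R ^+ (2 * r.+1) / J ^+ r.+1) =
      Y * (m%:R ^+ (2 * r.+1) / J).
    by rewrite /Y -XE JS invfM; move: (m%:R ^+ _) (J^-1) (J ^- r) => u1 u2 u3; ring.
  rewrite ler_wpM2l // ler_wpM2r ?invr_ge0 ?(ltW J0) //.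
  by rewrite lerXn2r // nnegrE ler0n.
have /andP[pw0 pwx] := pattern_weight_bounds R f P; rewrite -/pw -/x in pw0 pwx.
have xJ : 0 <= x ^+ (2 * r.+1) / J by rewrite divr_ge0 ?exprn_ge0 // ler0n.
have pwrho : pw * (1 - rho) <= 2 * (x ^+ (2 * r.+1) / J).
  apply: (@le_trans _ _ (2 * x ^+ (2 * r) * (x ^+ 2 / J))).
    apply: ler_pM => //; first by rewrite subr_ge0.
    apply: (@le_trans _ _ ((nslots P ^ 2)%:R / J)); first by move: rho1; rewrite -/J; lra.
    by rewrite ler_wpM2r ?invr_ge0 ?(ltW J0) // natrX lerXn2r ?nnegrE // ler0n.
  by rewrite mulnS addnC exprD; lra.
have V1R : V1%:R <= V%:R :> R by rewrite ler_nat.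
have VR : V%:R <= V1%:R + V2%:R :> R by rewrite -natrD ler_nat.
have E1 := ler_wpM2l Y0 pwrho.
have E2 : 0 <= Y * (pw * (1 - rho)).
  by apply: mulr_ge0 => //; apply: mulr_ge0; rewrite ?subr_ge0.
have E3 := mulr_ge0 Y0 xJ.
rewrite -/V -[3 * _ / J]mulrA ler_norml.
rewrite mulrBr mulr1 mulrBr -V1E in E1 E2.
by apply/andP; split; lra.
Qed.

Definition mean_weight (R : realType) (f : boolfun) (n : nat) : R :=
  (\sum_(t <- shapes n) pattern_weight R f (shape_pattern (pattern_depth f) 0 t)) / nshapes R n.

Lemma nshapes_gt0 (R : realType) n : (0 < n)%N -> 0 < nshapes R n.
Proof. by case: n => // n _; case: (shape_seq_ge (nshapes_seq R) n). Qed.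

(** The error at a shape is polynomial in the size of its pattern, so the bounded moments give a [K]
    independent of [n] and [j]. *)
Lemma labelled_good_count (R : realType) f : finitary f -> exists2 K : R, 0 <= K &
  forall n j, (complexity f < n)%N -> (0 < j)%N ->
  `|(count (good f) (labelled_trees j n))%:R -
     (2 * j)%:R ^+ n / j%:R ^+ (mult f).+1 * (nshapes R n * mean_weight R f n)|
  <= (2 * j)%:R ^+ n / j%:R ^+ (mult f).+1 * (nshapes R n * (K / j%:R)).
Proof.
move=> fin; have [C HC] := pattern_moment_bound R (pattern_depth f) (2 * (mult f).+2) 0.
have C0 : 0 <= C.
  have := HC 1%N; rewrite /nshapes /= mulr1; apply: le_trans; exact: pattern_moment_ge0.
exists (3 * C) => [|n j ltn j0]; first by rewrite mulr_ge0.
have sn : nshapes R n != 0 by rewrite gt_eqF // nshapes_gt0 // (leq_ltn_trans _ ltn).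
have smE : nshapes R n * mean_weight R f n =
    \sum_(t <- shapes n) pattern_weight R f (shape_pattern (pattern_depth f) 0 t).
  by rewrite /mean_weight mulrCA mulfV // mulr1.
rewrite smE mulr_sumr.
rewrite count_labelled_trees natr_sum -sumrB.
set Y := _ / _; have Y0 : 0 <= Y by rewrite divr_ge0 ?exprn_ge0.
apply: (le_trans (ler_norm_sum _ _ _)).
apply: (@le_trans _ _ (Y * (3 * pattern_moment R (pattern_depth f) 0 (2 * (mult f).+2) n / j%:R))).
  rewrite /pattern_moment mulr_sumr mulr_suml mulr_sumr big_seq [leRHS]big_seq.
  by apply: ler_sum => t; rewrite mem_shapes => /eqP nt; apply: shape_good_count.
rewrite ler_wpM2l // mulrA ler_wpM2r ?invr_ge0 // mulrCA ler_wpM2l //.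
by rewrite mulrC.
Qed.

Lemma mean_weight_cvg (R : realType) f : cvgn (mean_weight R f).
Proof.
exact: (pattern_mean_cvg (d := pattern_depth f) (pattern_weight_bounds R f)).
Qed.

(** * Positivity of the limit mean *)

Lemma count_words_cat (T : Type) (ls : seq T) a b (P : pred (seq T)) :
  count P (words ls (a + b)) =
  (\sum_(u <- words ls a) count (fun w => P (u ++ w)) (words ls b))%N.
Proof.
elim: a P => [|a IHa] P; first by rewrite big_seq1.
rewrite addSn count_wordsS big_allpairs_dep /=; apply: eq_bigr => x _.
exact: IHa.
Qed.

(** The prefix may be any word equivalent to [u0] and the rest any word; injectivity of [h] keeps
    the shapes apart. *)
Lemma family_count (R : realType) f (h : tree unit -> tree unit) (u0 : seq literal) n j :
  injective h -> (forall t, tsize (h t) = (size u0 + tsize t)%N) ->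
  (forall t u w, size w = tsize t -> word_equiv u0 u -> good f (relabel l0 (h t) (u ++ w))) ->
  nshapes R n * ((2 ^ word_nvars u0 * j ^_ (word_nvars u0))%:R * (2 * j)%:R ^+ n) <=
  (count (good f) (labelled_trees j (size u0 + n)))%:R.
Proof.
move=> hinj hsize hgood; rewrite count_labelled_trees natr_sum.
set N := (size u0 + n)%N; set c := (_ * _ ^+ n).
pose V t := (count (fun w => good f (relabel l0 t w)) (words (lits j) N))%:R : R.
have hV t : tsize t = n -> c <= V (h t).
  move=> st; rewrite /c -natrX -natrM /V ler_nat /N count_words_cat -count_word_equiv.
  rewrite -sum1_count big_distrl /= big_mkcond; apply: leq_sum => u _.
  case: asboolP => // eqv; rewrite mul1n -size_lits -size_words.
  rewrite -(count_predT (words _ _)); apply: sub_count_in => w; rewrite mem_words => /andP[/eqP sw _] _.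
  by apply: hgood => //; rewrite sw.
apply: (@le_trans _ _ (\sum_(t <- shapes n) V (h t))).
  rewrite nshapesE mulr_suml big_seq [leRHS]big_seq; apply: ler_sum => t.
  by rewrite mem_shapes mul1r => /eqP nt; apply: hV.
apply: (@le_trans _ _ (\sum_(t <- shapes n) \sum_(t' <- shapes N) (if t' == h t then V (h t) else 0))).
  rewrite big_seq [leRHS]big_seq; apply: ler_sum => t; rewrite mem_shapes => /eqP nt.
  by rewrite sum_shapes_pred1 hsize -nt eqxx.
rewrite exchange_big /=; apply: ler_sum => t' _.
have [[t0 ->]|nt] := pselect (exists t0, t' = h t0).
  under eq_bigr => t _ do rewrite (inj_eq hinj) eq_sym.
  rewrite (eq_bigr (fun t => if t == t0 then V (h t0) else 0)).
    by rewrite sum_shapes_pred1; case: eqP.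
  by move=> t _; case: eqP => [->|].
rewrite big1 // => t _; case: eqP => // eqt.
by case: nt; exists t.
Qed.

Lemma relabel_cat (L : Type) (x0 : L) c t1 t2 w1 w2 : size w1 = tsize t1 ->
  relabel x0 (Node c t1 t2) (w1 ++ w2) = Node c (relabel x0 t1 w1) (relabel x0 t2 w2).
Proof. by move=> s1; rewrite /= take_size_cat // drop_size_cat. Qed.

(* For a constant function the family is [(x or not x) or C] (or its dual); otherwise
   it is [A and ((x or not x) or C)] with [A] a minimal tree. *)
Lemma expansion_family f : finitary f -> exists (h : tree unit -> tree unit) (u0 : seq literal),
  [/\ injective h, forall t, tsize (h t) = (size u0 + tsize t)%N,
      forall t u w, size w = tsize t -> word_equiv u0 u -> good f (relabel l0 (h t) (u ++ w))
    & (size u0 <= word_nvars u0 + (mult f).+1)%N].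
Proof.
move=> fin; pose leaf : tree unit := Leaf tt.
have [[b fb]|ncst] := pselect (is_constant f).
  pose c := if b then Or else And.
  exists (fun t => Node c (Node c leaf leaf) t), [:: (0%N, false); (0%N, true)]; split.
  - by move=> t t' [].
  - by move=> t; rewrite !tsizeE.
  - move=> t u w sw /word_equiv_rename[s [e [_ ->]]]; apply/asboolP.
    exists f; first exact: fun_equiv_refl.
    move=> a; rewrite fb relabel_cat // /c.
    by case: b {c fb}; rewrite /= /eval_literal /=; case: (e 0%N); case: (a _).
  - by [].
have [[A Af sA] _] := complexity_min fin ncst.
pose p := (sumn (map fst (leaves A))).+1.
have pA : p \notin map fst (leaves A).
  by apply/negP => /mem_leq_sumn; rewrite ltnn.
exists (fun t => Node And (skeleton A) (Node Or (Node Or leaf leaf) t)).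
exists (leaves A ++ [:: (p, false); (p, true)]); split.
- by move=> t t' [].
- by move=> t; rewrite !tsizeE tsize_skeleton size_cat; rewrite -!addnA.
- move=> t u w sw /word_equiv_rename[s [e [sinj ->]]]; apply/asboolP.
  exists (fun a => f (rename_assignment s e a)); first by exists s, e.
  move=> a; rewrite map_cat -catA relabel_cat ?size_map ?tsize_skeleton //.
  have -> : relabel l0 (skeleton A) (map (rename_lit s e) (leaves A)) = tree_map (rename_lit s e) A.
    by rewrite -leaves_tree_map -[skeleton A](skeleton_tree_map (rename_lit s e)) relabel_leaves.
  rewrite relabel_cat // /= /eval_literal /= eval_rename Af.
  by case: (e p); case: (a (s p)); rewrite ?andbT.
- have -> : word_nvars (leaves A ++ [:: (p, false); (p, true)]) = (nvars A).+1.
    rewrite /word_nvars map_cat undup_cat size_cat /= inE eqxx /= addn1; congr _.+1.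
    rewrite size_filter (eq_in_count (a2 := predT)) ?count_predT // => x.
    rewrite mem_undup => xA; rewrite !inE /= orbb; apply/negP => /eqP xp.
    by move: pA; rewrite -xp xA.
  have := num_essential_nvars fin Af; have := mult_complexity fin.
  by rewrite size_cat -/(tsize A) sA /=; lia.
Qed.

(** [j] is fixed, large enough for the error [K / j] to be at most half of the proportion [c] that
    the family guarantees; only [n] varies. *)
Lemma mean_weight_limit_gt0 (R : realType) f : finitary f -> 0 < limn (mean_weight R f).
Proof.
move=> fin; have [h [u0 [hinj hsize hgood leu]]] := expansion_family fin.
have [K K0 HK] := labelled_good_count R fin.
set a := size u0 in hsize leu; set v := word_nvars u0 in leu; set r := (mult f).+1 in leu HK.
(* The factors come from [nshapes R (n - a)] being at least [8^-a / 2] times [nshapes R n], from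
   [j ^_ v >= j ^ v / 2], and from the [2 ^ a] in [(2 * j) ^ a]. *)
pose c : R := 8^-1 ^+ a / 2 * 2^-1 * 2^-1 ^+ a.
have c0 : 0 < c by rewrite !mulr_gt0 ?exprn_gt0 ?invr_gt0.
pose j := (Num.bound (2 * K / c) + 2 * v ^ 2).+1.
have j0 : (0 < j)%N by [].
have J0 : 0 < j%:R :> R by rewrite ltr0n.
have KJ : K / j%:R <= c / 2.
  have : 2 * K / c <= j%:R.
    apply: (@le_trans _ _ (Num.bound (2 * K / c))%:R).
      by apply/ltW/archi_boundP; rewrite divr_ge0 ?mulr_ge0 // ltW.
    by rewrite ler_nat /j; lia.
  by rewrite ler_pdivrMr // ler_pdivrMr //; lra.
have half : 2^-1 <= (j ^_ v)%:R / j%:R ^+ v :> R.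
  have /andP[H _] := ffact_ratio R v j0; apply: le_trans H.
  rewrite lerBrDr -lerBrDl ler_pdivrMr //.
  have : (2 * v ^ 2)%:R <= j%:R :> R by rewrite ler_nat /j; lia.
  rewrite natrM; lra.
have e0 : 0 < 8^-1 ^+ a / 2 :> R by rewrite divr_gt0 ?exprn_gt0 ?invr_gt0.
have /cvgrPdist_le /(_ _ e0) [N _ HN] := shape_seq_shift_cvg (i := a) (nshapes_seq R).
have low n : (N + a + complexity f < n)%N -> c / 2 <= mean_weight R f n.
  move=> ltn; have sn0 : 0 < nshapes R n by apply: nshapes_gt0; lia.
  have sr : 8^-1 ^+ a / 2 * nshapes R n <= nshapes R (n - a).
    rewrite -ler_pdivlMr //; have /HN : (N <= n)%N by lia.
    by rewrite ler_norml => /andP[_]; lra.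
  have := @family_count R f h u0 (n - a) j hinj hsize hgood; rewrite -/a -/v subnKC; last by lia.
  have := HK n j (ltac:(lia)) j0; rewrite ler_norml => /andP[_].
  set cnt := (count _ _)%:R; set Y := _ / _ => H1 H2.
  have Y0 : 0 < Y by rewrite divr_gt0 ?exprn_gt0 ?ltr0n ?muln_gt0.
  have H3 : Y * (nshapes R n * c) <= cnt.
    apply: le_trans H2; set Xa := (2 * j)%:R ^+ (n - a); set Q := 8^-1 ^+ a / 2 in sr.
    (* The prefix has at most [R(f) + 1] repetitions, that is [a <= v + r]. *)
    have A1 : j%:R ^+ a / j%:R ^+ r <= j%:R ^+ v :> R.
      by rewrite ler_pdivrMr ?exprn_gt0 // -exprD ler_weXn2l // ler1n.
    have A2 : 2^-1 * j%:R ^+ v <= (2 ^ v * j ^_ v)%:R :> R.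
      apply: (@le_trans _ _ (j ^_ v)%:R); last by rewrite ler_nat leq_pmull // expn_gt0.
      by rewrite -ler_pdivlMr ?exprn_gt0.
    have two : 2^-1 ^+ a * 2 ^+ a = 1 :> R by rewrite -exprMn mulVf ?expr1n // pnatr_eq0.
    have -> : Y * (nshapes R n * c) = Q * nshapes R n * (Xa * (2^-1 * (j%:R ^+ a / j%:R ^+ r))).
      have -> : Y = Xa * (2 ^+ a * j%:R ^+ a) / j%:R ^+ r.
        by rewrite /Y /Xa -exprMn -natrM -exprD subnK //; lia.
      rewrite /c -/Q.
      move: (2^-1 ^+ a) (2 ^+ a) two (j%:R ^+ a) (j%:R ^- r) (nshapes R n) => u1 u2 two u3 u4 u5.
      rewrite (_ : Xa * (u2 * u3) * u4 * (u5 * (Q / 2 * u1)) = u1 * u2 * (Q * u5 * (Xa * (2^-1 * (u3 * u4))))); last by ring.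
      by rewrite two mul1r.
    apply: ler_pM => //.
    - by rewrite mulr_ge0 // ltW.
    - by rewrite !mulr_ge0 ?exprn_ge0 ?invr_ge0 ?exprn_ge0.
    - rewrite mulrC ler_wpM2r ?exprn_ge0 //; apply: le_trans A2.
      by rewrite ler_wpM2l ?invr_ge0.
  have : Y * (nshapes R n * c) <= Y * (nshapes R n * (mean_weight R f n + K / j%:R)).
    by rewrite !mulrDr; lra.
  by rewrite ler_pM2l // ler_pM2l //; lra.
apply: (@lt_le_trans _ _ (c / 2)); first by rewrite divr_gt0.
apply: limr_ge; first exact: mean_weight_cvg.
by exists (N + a + complexity f).+1.
Qed.

(** * Asymptotics of shifted quotients of [B_] *)

Lemma B_quotient_cvg0 (R : realType) (k : nat -> nat) i : k n @[n --> \oo] --> \oo ->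
  B_ R (n - i.+1) (k n) / B_ R (n - i) (k n) @[n --> \oo] --> (0 : R).
Proof.
move=> koo; apply/cvgrPdist_le => e e0.
pose M := (Num.bound e^-1).+1.
have [N HN] := B_ratio_large R M.
have /cvgnyPgt/(_ N) := koo; case=> N' _ HN'; exists (N' + N + i + 2)%N => // n /= len.
have /= ltk := HN' n (ltac:(rewrite /=; lia)).
have -> : (n - i = (n - i.+1).+1)%N by lia.
have B0 : 0 < B_ R (n - i.+1) (k n) by apply: B_gt0; lia.
have B1 : 0 < B_ R (n - i.+1).+1 (k n) by apply: B_gt0; lia.
rewrite sub0r normrN ger0_norm; last by rewrite divr_ge0 // ltW.
rewrite ler_pdivrMr //.
have H := HN (n - i.+1)%N (k n) (ltac:(lia)) (ltnW ltk).
have M0 : 0 < M%:R :> R by rewrite ltr0n.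
rewrite -(ler_pM2l M0) (le_trans H) // mulrA ler_peMl ?ltW //.
rewrite -ltr_pdivrMr // mul1r; apply: (@lt_le_trans _ _ (Num.bound e^-1)%:R).
  by apply: archi_boundP; rewrite invr_ge0 ltW.
by rewrite ler_nat.
Qed.

Lemma B_quotient_ratio_cvg (R : realType) (k : nat -> nat) i : k n @[n --> \oo] --> \oo ->
  (B_ R (n - i.+1) (k n) / B_ R (n - i) (k n)) / (B_ R n.-1 (k n) / B_ R n (k n))
    @[n --> \oo] --> (1 : R).
Proof.
move=> koo; pose q i n := B_ R (n - i.+1) (k n) / B_ R (n - i) (k n).
have /cvgnyPgt/(_ 0%N) ev := koo.
have q0 i' : q i' n @[n --> \oo] --> (0 : R) by apply: B_quotient_cvg0.
have Bpos m : \forall n \near \oo, 0 < B_ R (n - m) (k n).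
  by case: ev => N _ HN; exists (N + m + 1)%N => // n /= len; apply: B_gt0; [lia|apply: HN => /=; lia].
have qE n : B_ R n.-1 (k n) / B_ R n (k n) = q 0%N n by rewrite /q subn0 subn1.
suff main i' : q i' n / q 0%N n @[n --> \oo] --> (1 : R).
  by under eq_fun do rewrite qE; exact: main.
elim: i' => [|{}i IHi].
  apply: cvg_near_cst; near=> n; rewrite divff // /q mulf_neq0 // ?invr_neq0 // gt_eqF //.
    by near: n; apply: Bpos.
  by near: n; apply: Bpos.
rewrite -[X in _ --> X]mulr1.
apply: (@cvg_trans _ ((q i.+1 n / q i n) * (q i n / q 0%N n) @[n --> \oo])).
  apply: near_eq_cvg; near=> n; rewrite mulrA divfK // /q mulf_neq0 // ?invr_neq0 // gt_eqF //.
    by near: n; apply: Bpos.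
  by near: n; apply: Bpos.
apply: cvgM => //.
(* This is [B_step] divided by the square of [B_ R (n - i.+1) (k n)]. *)
apply: (@squeeze_cvgr _ _ _ _ (fun n => 1 - 4 * q i.+1 n) (fun n => 1 + 4 * q i.+1 n)).
- have small : \forall n \near \oo, q i.+1 n <= 2^-1.
    have /cvgrPdist_le /(_ 2^-1 (ltac:(by rewrite invr_gt0))) := q0 i.+1.
    apply: filterS => n; rewrite sub0r normrN; exact: le_trans (ler_norm _).
  near=> n.
  have b0 : 0 < B_ R (n - i.+2) (k n) by near: n; apply: Bpos.
  have b1 : 0 < B_ R (n - i.+1) (k n) by near: n; apply: Bpos.
  have b2 : 0 < B_ R (n - i) (k n) by near: n; apply: Bpos.
  have ltn : (i.+3 <= n)%N by near: n; exists i.+3.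
  have k0 : (0 < k n)%N by near: n.
  have qs : q i.+1 n <= 2^-1 by near: n.
  have e1 : (n - i.+1 = (n - i.+2).+1)%N by lia.
  have e2 : (n - i = (n - i.+2).+2)%N by lia.
  have := @B_step R (n - i.+2) (k n) (ltac:(lia)) k0.
  rewrite -e2 -e1; move: qs b0 b1 b2; rewrite /q.
  set x0 := B_ R (n - i.+2) _; set x1 := B_ R (n - i.+1) _; set x2 := B_ R (n - i) _.
  move=> qs b0 b1 b2; rewrite ler_pdivrMr // in qs.
  have : 2 * x0 <= x1 by lra.
  move=> /[swap] /[apply] /andP[s1 s2].
  have E : x0 / x1 / (x1 / x2) = x2 * x0 / (x1 * x1) by field; rewrite !gt_eqF.
  have E1 : (1 - 4 * (x0 / x1)) * (x1 * x1) = x1 * (x1 - 4 * x0) by field; rewrite gt_eqF.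
  have E2 : (1 + 4 * (x0 / x1)) * (x1 * x1) = x1 * (x1 + 4 * x0) by field; rewrite gt_eqF.
  by rewrite E ler_pdivlMr ?mulr_gt0 // ler_pdivrMr ?mulr_gt0 // E1 E2 s1 s2.
- rewrite -[X in _ --> X]subr0 -[X in _ --> _ - X](mulr0 4).
  by apply: cvgB; [exact: cvg_cst|apply: cvgM; [exact: cvg_cst|exact: q0]].
- rewrite -[X in _ --> X]addr0 -[X in _ --> _ + X](mulr0 4).
  by apply: cvgD; [exact: cvg_cst|apply: cvgM; [exact: cvg_cst|exact: q0]].
Unshelve. all: by end_near. Qed.

Lemma B_shift_cvg (R : realType) (k : nat -> nat) i : k n @[n --> \oo] --> \oo ->
  (B_ R (n - i) (k n) / B_ R n (k n)) / (B_ R n.-1 (k n) / B_ R n (k n)) ^+ i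
    @[n --> \oo] --> (1 : R).
Proof.
move=> koo; have /cvgnyPgt/(_ 0%N) ev := koo.
have Bpos m : \forall n \near \oo, 0 < B_ R (n - m) (k n).
  by case: ev => N _ HN; exists (N + m + 1)%N => // n /= len; apply: B_gt0; [lia|apply: HN => /=; lia].
elim: i => [|i IHi].
  apply: cvg_near_cst; near=> n; rewrite subn0 expr0 divr1 divff // gt_eqF //.
  by rewrite -[n in B_ R n]subn0; near: n; apply: Bpos.
rewrite -[X in _ --> X]mulr1; apply: cvg_trans (cvgM IHi (@B_quotient_ratio_cvg R k i koo)).
 apply: near_eq_cvg; near=> n.
have b1 : 0 < B_ R (n - i) (k n) by near: n; apply: Bpos.
rewrite /GRing.mul_fun; set q := B_ R n.-1 (k n) / _.
have -> : q ^- i.+1 = q^-1 * q ^- i by rewrite exprS invfM.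
move: (q^-1) (q ^- i) ((B_ R n (k n))^-1) (B_ R (n - i.+1) (k n)) => u1 u2 u3 u4.
by field; rewrite gt_eqF.
Unshelve. all: by end_near. Qed.

(** * From labelled trees to probabilities *)

Lemma tree_count (R : realType) (k : nat -> nat) n : (0 < n)%N ->
  (T_ k n)%:R = nshapes R n * 2 ^+ n * B_ R n (k n) :> R.
Proof.
move=> n0; rewrite /T_ /tree_classes.
rewrite (@ncard_tree_classes R predT _ (k n) n) //; last by move=> A; split=> [[]|[]].
rewrite B_mixture // mulr_sumr; apply: eq_bigr => j _.
rewrite count_predT size_allpairs size_words size_lits natrM natrX natrM exprMn.
by rewrite /nshapes; ring.
Qed.

(** Summed over the mixture, [(2 * j) ^ n / j ^ r] gives [B_ R (n - r)] and the error, with one more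
    [1 / j], gives [B_ R (n - r.+1)]. *)
Lemma tree_count_of (R : realType) f : finitary f -> exists2 K : R, 0 <= K &
  forall k n, (complexity f + (mult f).+3 < n)%N ->
  `|(Tof k f n)%:R - nshapes R n * 2 ^+ n * (mean_weight R f n * B_ R (n - (mult f).+1) (k n))|
  <= nshapes R n * 2 ^+ n * (K * B_ R (n - (mult f).+2) (k n)).
Proof.
move=> fin; have [K K0 HK] := labelled_good_count R fin; exists K => // k n ltn.
set r := (mult f).+1 in HK *; have s0 : 0 <= nshapes R n * 2 ^+ n.
  by rewrite mulr_ge0 ?exprn_ge0 // ler0n.
rewrite /Tof /tree_classes_of.
rewrite (@ncard_tree_classes R (good f) _ (k n) n); first last.
- by move=> A; split=> [[sA nA gA]|[sA nA /asboolP gA]]; split=> //; apply/asboolP.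
- exact: good_tree_equiv.
rewrite !B_mixture; [|lia|lia]; rewrite !mulr_sumr -sumrB.
apply: (le_trans (ler_norm_sum _ _ _)); apply: ler_sum => j _; move: (nat_of_ord j) => {}j.
have w0 := mix_weight_gt0 R (k n) j.
(* The estimate does not cover [j = 0], where the count and the powers of 0 all vanish, the
   exponents being positive. *)
have [->|j0] := posnP j.
  have -> : count (good f) (labelled_trees 0 n) = 0%N.
    rewrite count_labelled_trees big1 // => t _; have -> : n = n.-1.+1 by lia.
    by rewrite count_wordsS big_nil.
  rewrite !expr0n !gtn_eqF; [|lia|lia].
  by rewrite !mulr0 subrr normr0.
have J0 : 0 < j%:R :> R by rewrite ltr0n.
have := HK n j (ltac:(lia)) j0; rewrite -/r.
have -> : (2 * j)%:R ^+ n / j%:R ^+ r = 2 ^+ n * j%:R ^+ (n - r) :> R.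
  rewrite natrM exprMn -[in j%:R ^+ n](@subnK r n); last by lia.
  by rewrite exprD mulrA mulfK // expf_neq0 // gt_eqF.
have -> : j%:R ^+ (n - r) = j%:R ^+ (n - r.+1) * j%:R :> R.
  by rewrite -exprSr; congr (_ ^+ _); lia.
set c := (count _ _)%:R; set p := j%:R ^+ (n - r.+1); set w := mix_weight _ _ _ in w0 *.
set m := mean_weight R f n; set s := nshapes R n; set t := 2 ^+ n.
move=> H.
have -> : w * c - s * t * (m * (w * (p * j%:R))) = w * (c - t * (p * j%:R) * (s * m)) by ring.
rewrite normrM gtr0_norm //.
have -> : s * t * (K * (w * p)) = w * (t * (p * j%:R) * (s * (K / j%:R))).
  by field; rewrite gt_eqF.
by rewrite ler_pM2l.
Qed.

Lemma prob_estimate (R : realType) f : finitary f -> exists2 K : R, 0 <= K &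
  forall k n, (complexity f + (mult f).+3 < n)%N -> (0 < k n)%N ->
  `|prob R k f n - mean_weight R f n * (B_ R (n - (mult f).+1) (k n) / B_ R n (k n))|
  <= K * (B_ R (n - (mult f).+2) (k n) / B_ R n (k n)).
Proof.
move=> fin; have [K K0 HK] := tree_count_of R fin; exists K => // k n ltn k0.
have n0 : (0 < n)%N by lia.
have B0 := B_gt0 R n0 k0.
have S0 : 0 < nshapes R n * 2 ^+ n by rewrite mulr_gt0 ?nshapes_gt0 ?exprn_gt0.
have := HK k n ltn; rewrite /prob tree_count //.
move: (Tof k f n)%:R (B_ R (n - (mult f).+1) _) (B_ R (n - (mult f).+2) _) (mean_weight _ _ _).
move: (B_ R n (k n)) (nshapes R n * 2 ^+ n) B0 S0 => b s b0 s0 c b1 b2 m H.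
have sb0 : 0 < s * b by rewrite mulr_gt0.
have -> : c / (s * b) - m * (b1 / b) = (c - s * (m * b1)) / (s * b).
  by field; rewrite !gt_eqF.
rewrite normrM [X in _ * X]gtr0_norm ?invr_gt0 // ler_pdivrMr //; apply: le_trans H _.
by rewrite le_eqVlt; apply/orP; left; apply/eqP; field; rewrite gt_eqF.
Qed.

End Limits.

Local Open Scope classical_set_scope.
Local Open Scope ring_scope.

Theorem theorem3 (R : realType) (f : boolfun) (hf : finitary f) :
  exists lambda : R, 0 < lambda /\
    forall k : nat -> nat,
      (forall m n, (1 <= m)%N -> (m <= n)%N -> (k m <= k n)%N) ->
      k n @[n --> \oo] --> \oo ->
      prob R k f ~_\oo (fun n => lambda * rat_ R k n ^+ (mult f).+1).
Proof.
(* The limit mean is taken over shapes only, so [lambda] can be chosen before [k]. *)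
have l_gt0 := mean_weight_limit_gt0 R hf; set l := limn _ in l_gt0.
exists l; split=> // k _ koo; set r := (mult f).+1.
have [K K0 HK] := prob_estimate R hf.
pose rat n := B_ R n.-1 (k n) / B_ R n (k n).
(* Dividing [prob_estimate] by [rat n ^ r] leaves the main term [mean_weight R f n * beta r n] and
   the error [K * (beta r.+1 n * rat n)], where both [beta] tend to 1. *)
pose beta i n := (B_ R (n - i) (k n) / B_ R n (k n)) / rat n ^+ i.
have betaE i : beta i n @[n --> \oo] --> (1 : R) by apply: B_shift_cvg.
have rat0 : rat n @[n --> \oo] --> (0 : R).
  by have := @B_quotient_cvg0 R k 0 koo; apply: cvg_trans; apply: near_eq_cvg; near=> n; rewrite subn0 subn1.
have main : mean_weight R f n * beta r n @[n --> \oo] --> l.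
  by rewrite -[X in _ --> X]mulr1; apply: cvgM => //; apply: mean_weight_cvg.
have err : K * (beta r.+1 n * rat n) @[n --> \oo] --> (0 : R).
  rewrite -[X in _ --> X](mulr0 K) -[X in _ --> K * X](mulr0 1).
  by apply: cvgM; [exact: cvg_cst|apply: cvgM].
have /cvgnyPgt/(_ 0%N) ev := koo.
apply/eqaddoP => e e0.
have e2 : 0 < e * l / 2 by rewrite divr_gt0 ?mulr_gt0.
have /cvgrPdist_le /(_ _ e2) Hmain := main.
have /cvgrPdist_le /(_ _ e2) Herr := err.
near=> n.
have ltn : (complexity f + (mult f).+3 < n)%N by near: n; exists (complexity f + (mult f).+3).+1.
have k0 : (0 < k n)%N by near: n.
have rat_gt0 : 0 < rat n by rewrite divr_gt0 ?B_gt0 //; lia.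
have h1 : `|l - mean_weight R f n * beta r n| <= e * l / 2 by near: n.
have h2 : `|0 - K * (beta r.+1 n * rat n)| <= e * l / 2 by near: n.
have := HK k n ltn k0; rewrite -/r.
have bE i : B_ R (n - i) (k n) / B_ R n (k n) = beta i n * rat n ^+ i.
  by rewrite divfK // expf_neq0 // gt_eqF.
rewrite !bE /= -[rat_ R k n]/(rat n) => H.
rewrite sub0r normrN in h2.
have X0 : 0 < rat n ^+ r by rewrite exprn_gt0.
rewrite [X in _ <= _ * X]gtr0_norm ?mulr_gt0 //.
change (`|prob R k f n - l * rat n ^+ r| <= e * (l * rat n ^+ r)).
have -> : prob R k f n - l * rat n ^+ r = (prob R k f n - mean_weight R f n * (beta r n * rat n ^+ r))
  - (l - mean_weight R f n * beta r n) * rat n ^+ r by ring.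
apply: (le_trans (ler_normB _ _)).
have H' : K * (beta r.+1 n * rat n ^+ r.+1) <= e * l / 2 * rat n ^+ r.
  rewrite exprS (_ : _ * _ = K * (beta r.+1 n * rat n) * rat n ^+ r); last by ring.
  by rewrite ler_wpM2r ?(ltW X0) //; apply: le_trans h2; exact: ler_norm.
have H1 : `|(l - mean_weight R f n * beta r n) * rat n ^+ r| <= e * l / 2 * rat n ^+ r.
  by rewrite normrM [X in _ * X]gtr0_norm // ler_wpM2r // ltW.
by apply: (le_trans (lerD (le_trans H H') H1)); lra.
Unshelve. all: by end_near. Qed.
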